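(* Let $U,V\in\mathcal{L}_2(\mathbb{R}^m)$, $Y:=(U,V)$, $\nu:=\mathrm{Law}(Y)$, and let $S$ be the standard form on $\mathbb{R}^{2m}$. The following are equivalent: (a) there exists a $Y$-equilibrium $(R,f)$ with monotone pricing function $f$; (b) there exist an optimal map $X$ and an optimal set $G$ of the dual problem such that $\mathrm{Law}(X,Y)$ is an optimal plan and $\{u\in\mathbb{R}^m:(u,v)\in G\text{ for some }v\in\mathbb{R}^m\}=\mathbb{R}^m$. Under these conditions, for any optimal set $G$ of the dual problem whose projection on the first $m$ coordinates is $\mathbb{R}^m$, there exists a $Y$-equilibrium $(R,f)$ such that $\operatorname{graph} f\subset G$ and $X:=(R,f(R))$ is an optimal map.
   Context: The standard form on $\mathbb{R}^{2m}$ is $S((r,s),(u,v)):=\langle s,u\rangle+\langle r,v\rangle$, $r,s,u,v\in\mathbb{R}^m$ (with $d=2m$). $G\subset\mathbb{R}^{2m}$ is $S$-monotone if $S(x-y,x-y)\ge0$ for $x,y\in G$; maximal if not a strict subset of another $S$-monotone set; $\mathcal{M}(S)$ is the family of maximal $S$-monotone sets. $\psi_G(y):=\sup_{x\in G}(S(x,y)-\frac12S(x,x))$. $\mathcal{X}(Y):=\{X\in\mathcal{L}_2(\mathbb{R}^{2m}): X\ Y\text{-measurable},\ \mathbb{E}[Y|X]=X\}$; an optimal map maximizes $\frac12\mathbb{E}[S(X,Y)]$ over $\mathcal{X}(Y)$. $\Gamma(\nu)$: Borel probability measures on $\mathbb{R}^{2m}\times\mathbb{R}^{2m}$ (coordinates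 $(x,y)$) with finite second moments, second marginal $\nu$, conditional expectation of $y$ given $x$ equal to $x$; an optimal plan maximizes $\frac12\int S(x,y)d\gamma$ over $\Gamma(\nu)$. An optimal set of the dual problem minimizes $\int\psi_G d\nu$ over $G\in\mathcal{M}(S)$. A function $f:\mathbb{R}^m\to\mathbb{R}^m$ is monotone if $\langle u-r,f(u)-f(r)\rangle\ge0$ for all $u,r$. Given $U,V,R\in\mathcal{L}_2(\mathbb{R}^m)$ with $R$ $Y$-measurable ($Y=(U,V)$) and a Borel function $f:\mathbb{R}^m\to\mathbb{R}^m$, the pair $(R,f)$ is a $Y$-equilibrium if (i) $f(R)=\mathbb{E}[V\mid R]$ and (ii) a.s. $R\in\operatorname{argmax}_{r\in\mathbb{R}^m}\langle r-U,V-f(r)\rangle$. Relations hold a.s. *)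

(* Defs.v *)
From HB Require Import structures.
From mathcomp Require Import all_boot all_order all_algebra.
From mathcomp Require Import all_classical all_reals all_analysis.

Set Implicit Arguments.
Unset Strict Implicit.
Unset Printing Implicit Defensive.

Import Order.TTheory GRing.Theory Num.Theory.
Import numFieldNormedType.Exports.

Local Open Scope classical_set_scope.
Local Open Scope ring_scope.

(* Euclidean space R^m is m.-tuple R, with its library product (= Borel)
   sigma-algebra generated by the coordinates.  R^{2m} is represented as
   the pair space R^m * R^m (first m coordinates, last m coordinates).  *)

Section Euclid.
Variable R : realType.

Definition vec (m : nat) := m.-tuple R.
Definition vec2 (m : nat) := (m.-tuple R * m.-tuple R)%type.

Definition dot m (x y : m.-tuple R) : R := \sum_(i < m) tnth x i * tnth y i.
Definition sqnorm m (x : m.-tuple R) : R := dot x x.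
Definition vsub m (x y : m.-tuple R) : m.-tuple R :=
  [tuple tnth x i - tnth y i | i < m].

Definition sqnorm2 m (z : vec2 m) : R := sqnorm z.1 + sqnorm z.2.
Definition vsub2 m (z w : vec2 m) : vec2 m := (vsub z.1 w.1, vsub z.2 w.2).

Definition Sform m (x y : vec2 m) : R := dot x.2 y.1 + dot x.1 y.2.

Definition S_monotone m (G : set (vec2 m)) : Prop :=
  forall x y, G x -> G y -> 0 <= Sform (vsub2 x y) (vsub2 x y).

Definition maximal_S_monotone m (G : set (vec2 m)) : Prop :=
  S_monotone G /\ forall G', S_monotone G' -> G `<=` G' -> G' = G.

Definition psi m (G : set (vec2 m)) (y : vec2 m) : \bar R :=
  ereal_sup [set (Sform x y - Sform x x / 2)%:E | x in G].

Definition monotone_fun m (f : vec m -> vec m) : Prop :=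
  forall u r, 0 <= dot (vsub u r) (vsub (f u) (f r)).

Definition graph_of m (f : vec m -> vec m) : set (vec2 m) :=
  [set z | z.2 = f z.1].

Definition proj1_set m (G : set (vec2 m)) : set (vec m) :=
  [set u | exists v, G (u, v)].

End Euclid.

Section RandomVariables.
Local Open Scope ereal_scope.
Context {R : realType} {d : measure_display} {Omega : measurableType d}.
Variable P : probability Omega R.

Definition L2 m (Z : Omega -> vec R m) : Prop :=
  measurable_fun setT Z /\ \int[P]_w (sqnorm (Z w))%:E < +oo.

Definition L2_2 m (X : Omega -> vec2 R m) : Prop :=
  measurable_fun setT X /\ \int[P]_w (sqnorm2 (X w))%:E < +oo.

(* H is W-measurable, i.e. sigma(W)-measurable, sigma(W) = {W^-1(C)} *)
Definition meas_wrt {dT} {T : measurableType dT} {dS} {S : measurableType dS}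
  (W : Omega -> T) (H : Omega -> S) : Prop :=
  forall B, measurable B -> exists C, measurable C /\ H @^-1` B = W @^-1` C.

(* E[Z | W] = H  (Z, H integrable R^n-valued) *)
Definition cond_exp_is {dT} {T : measurableType dT} n
  (Z : Omega -> vec R n) (W : Omega -> T) (H : Omega -> vec R n) : Prop :=
  meas_wrt W H /\
  forall B, measurable B -> forall i : 'I_n,
    \int[P]_(w in W @^-1` B) (tnth (Z w) i)%:E =
    \int[P]_(w in W @^-1` B) (tnth (H w) i)%:E.

Definition cond_exp_is2 {dT} {T : measurableType dT} m
  (Z : Omega -> vec2 R m) (W : Omega -> T) (H : Omega -> vec2 R m) : Prop :=
  cond_exp_is (fun w => (Z w).1) W (fun w => (H w).1) /\
  cond_exp_is (fun w => (Z w).2) W (fun w => (H w).2).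

Definition Xset m (Y X : Omega -> vec2 R m) : Prop :=
  L2_2 X /\ meas_wrt Y X /\ cond_exp_is2 Y X X.

Definition optimal_map m (Y X : Omega -> vec2 R m) : Prop :=
  Xset Y X /\
  forall X', Xset Y X' ->
    \int[P]_w (Sform (X' w) (Y w) / 2)%:E <= \int[P]_w (Sform (X w) (Y w) / 2)%:E.

Definition equilibrium m (U V : Omega -> vec R m)
  (Rv : Omega -> vec R m) (f : vec R m -> vec R m) : Prop :=
  L2 Rv /\ meas_wrt (fun w => (U w, V w)) Rv /\ measurable_fun setT f /\
  cond_exp_is V Rv (fun w => f (Rv w)) /\
  {ae P, forall w, forall r : vec R m,
     (dot (vsub r (U w)) (vsub (V w) (f r)) <=
      dot (vsub (Rv w) (U w)) (vsub (V w) (f (Rv w))))%R}.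

Definition is_law_of {dT} {T : measurableType dT} (gamma : probability T R)
  (Z : Omega -> T) : Prop :=
  forall A, measurable A -> gamma A = P (Z @^-1` A).

End RandomVariables.

Section Plans.
Local Open Scope ereal_scope.
Context {R : realType} (m : nat).

Definition in_Gamma (nu : probability (vec2 R m) R)
  (gamma : probability (vec2 R m * vec2 R m)%type R) : Prop :=
  \int[gamma]_z (sqnorm2 z.1 + sqnorm2 z.2)%:E < +oo /\
  (forall A, measurable A -> gamma (snd @^-1` A) = nu A) /\
  (forall B, measurable B -> forall i : 'I_m,
     \int[gamma]_(z in fst @^-1` B) (tnth z.2.1 i)%:E =
     \int[gamma]_(z in fst @^-1` B) (tnth z.1.1 i)%:E /\
     \int[gamma]_(z in fst @^-1` B) (tnth z.2.2 i)%:E =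
     \int[gamma]_(z in fst @^-1` B) (tnth z.1.2 i)%:E).

Definition optimal_plan (nu : probability (vec2 R m) R)
  (gamma : probability (vec2 R m * vec2 R m)%type R) : Prop :=
  in_Gamma nu gamma /\
  forall gamma', in_Gamma nu gamma' ->
    \int[gamma']_z (Sform z.1 z.2 / 2)%:E <= \int[gamma]_z (Sform z.1 z.2 / 2)%:E.

Definition dual_optimal (nu : probability (vec2 R m) R) (G : set (vec2 R m)) : Prop :=
  maximal_S_monotone G /\
  forall G', maximal_S_monotone G' ->
    \int[nu]_y psi G y <= \int[nu]_y psi G' y.

End Plans.

(* Main.v *)
Require Import Defs.
From HB Require Import structures.
From mathcomp Require Import all_boot all_order all_algebra.
From mathcomp Require Import all_classical all_reals all_analysis.
From mathcomp Require Import measurable_realfun.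
From mathcomp Require Import ring lra.

Set Implicit Arguments.
Unset Strict Implicit.
Unset Printing Implicit Defensive.
Import Order.TTheory GRing.Theory Num.Theory.
Import numFieldNormedType.Exports.
Local Open Scope classical_set_scope.
Local Open Scope ring_scope.

(** Write [l_g(y) = S(g,y) - S(g,g)/2], so that [psi_G] is the supremum of the
    affine functions [l_g], [g] in [G], and [psi_G(x) >= S(x,x)/2] when [G] is
    maximal, with equality exactly on [G].

    Weak duality: if [E[Y|X] = X], conditional Jensen gives
    [E psi_G(Y) >= E psi_G(X) >= E S(X,X)/2 = E S(X,Y)/2]; in case of equality
    [X] lies in [G] and [psi_G(Y) = l_X(Y)].

    Strong duality: if the law of [(X,Y)] is an optimal plan, move a mass
    [eps * rho] of [Y], where [rho] is a bounded density, to a new atom at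
    [z = E[rho Y]] and correct [X] on the remaining mass by conditioning. The
    derivative at [eps = 0] is [S(z,z)/2 <= E[rho l_X(Y)]]. Hence the convex set
    of all points [(E[rho Y], E[rho l_X(Y)])] lies above the form [S/2], and a
    Minty type argument produces a maximal monotone [G] all of whose functions
    [l_g] lie below this set, that is [psi_G(Y) <= l_X(Y)].

    The condition that [R] is an argmax says that [psi_(graph f)(Y) = l_(R,f(R))(Y)],
    and [psi] does not change when a monotone set is enlarged beyond the graph of
    an everywhere defined function. So an equilibrium gives a zero duality gap
    with the map [(E[U|R], f(R))]. Conversely, if the gap is zero and [G] has
    full projection, take [R] to be the first component of [X] and
    [f(R) = E[X_2|R]], which remains in [G] because the fibres of [G] are closed and convex;
    elsewhere complete [f] by a Borel selection of [G]. *)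

(** * Vectors *)

(** Maps, plans and dual sets meet in one inequality, the zero duality gap
    [\int psi_G(Y) <= E qf(X)] for a single pair [X], [G]. Weak duality turns it into optimality of
    the map, of the plan and of the set at once, and every other optimal [G] inherits it by
    comparison of dual values. Equilibria are translated to and from this inequality only.

    The hard point is to reach it from primal optimality. The perturbation splits the mass sitting
    at one point, so the new coupling is in general no function of [Y]: it must be compared with
    plans, and is built with an auxiliary uniform variable. As [S] is indefinite, convexity gives no
    bound on its value; an explicit second-order estimate in [eps], with an integrable remainder,
    takes its place.

    Plans are never disintegrated. A conditional expectation is a Borel function composed with the
    conditioning variable and tested on sets, and suprema over [G] are reduced to countable ones so
    that null sets can be united. Limits along segments are taken algebraically by
    [le_of_shrink]. *)

Lemma le_of_shrink (R : realType) (e b : R) :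
  (forall t, 0 < t < 1 -> (1 - t) * e <= b) -> e <= b.
Proof.
move=> key; rewrite leNgt; apply/negP => be.
have [e0|e0] := leP e 0; first by have := key (1/2) ltac:(lra); nra.
have [b0|b0] := ltP b 0; first by have := key (1/2) ltac:(lra); nra.
(* Here [0 <= b < e], and this [t] puts [(1 - t) * e] at the midpoint of [b] and [e]. *)
pose t := (e - b) / (2 * e).
have te : t * (2 * e) = e - b by rewrite /t divfK//; lra.
have t0 : 0 < t by rewrite divr_gt0//; lra.
by have := key t; nra.
Qed.

Section Vectors.
Variables (R : realType) (m : nat).
Implicit Types (x y z : vec R m) (a b c : R).

(** A single binary combination for sums, differences and segments: [dotE] then turns identities
    between vectors into ring identities in scalar products. *)
Definition lin a x b y : vec R m := [tuple a * tnth x i + b * tnth y i | i < m].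

Lemma tnth_lin a x b y i : tnth (lin a x b y) i = a * tnth x i + b * tnth y i.
Proof. by rewrite tnth_mktuple. Qed.

Lemma vsubE x y : vsub x y = lin 1 x (-1) y.
Proof. by apply: eq_from_tnth => i; rewrite tnth_lin tnth_mktuple; ring. Qed.

Lemma dotC x y : dot x y = dot y x.
Proof. by apply: eq_bigr => i _; rewrite mulrC. Qed.

Lemma dot_linl a x b y z : dot (lin a x b y) z = a * dot x z + b * dot y z.
Proof.
rewrite /dot !mulr_sumr -big_split/=; apply: eq_bigr => i _.
by rewrite tnth_lin; ring.
Qed.

Lemma dot_linr a x b y z : dot z (lin a x b y) = a * dot z x + b * dot z y.
Proof. by rewrite !(dotC z) dot_linl. Qed.

Definition vscale a x : vec R m := [tuple a * tnth x i | i < m].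

Lemma tnth_vscale a x i : tnth (vscale a x) i = a * tnth x i.
Proof. by rewrite tnth_mktuple. Qed.

Lemma dot_vscalel a x y : dot (vscale a x) y = a * dot x y.
Proof. by rewrite /dot mulr_sumr; apply: eq_bigr => i _; rewrite tnth_vscale mulrA. Qed.

Lemma dot_vscaler a x y : dot x (vscale a y) = a * dot x y.
Proof. by rewrite !(dotC x) dot_vscalel. Qed.

Definition dotE := (vsubE, dot_linl, dot_linr).

Lemma sqnorm_ge0 x : 0 <= sqnorm x.
Proof. by apply: sumr_ge0 => i _; rewrite -expr2 sqr_ge0. Qed.

Lemma sqr_tnth_le_sqnorm x i : tnth x i ^+ 2 <= sqnorm x.
Proof.
rewrite /sqnorm /dot (bigD1 i)//= expr2 lerDl sumr_ge0// => j _.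
by rewrite -expr2 sqr_ge0.
Qed.

Lemma sqnorm_eq0 x y : sqnorm (vsub x y) <= 0 -> x = y.
Proof.
move=> h; apply: eq_from_tnth => i.
have := le_trans (sqr_tnth_le_sqnorm (vsub x y) i) h.
rewrite tnth_mktuple => h0; apply/eqP; rewrite -subr_eq0 -sqrf_eq0.
by rewrite eq_le h0 sqr_ge0.
Qed.

Definition vcvg (k : nat -> vec R m) x :=
  forall i, (fun n => tnth (k n) i) @ \oo --> tnth x i.

Lemma dot_cvg k l x y : vcvg k x -> vcvg l y ->
  (fun n => dot (k n) (l n)) @ \oo --> dot x y.
Proof.
move=> kx ly; rewrite /dot.
by apply: cvg_big => [|i _]; [exact: add_continuous|exact: cvgM].
Qed.

Lemma vcvg_cst x : vcvg (fun=> x) x.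
Proof. by move=> i; exact: cvg_cst. Qed.

Lemma lin_cvg a b k l x y (u v : nat -> R) : vcvg k x -> vcvg l y ->
  u @ \oo --> a -> v @ \oo --> b ->
  vcvg (fun n => lin (u n) (k n) (v n) (l n)) (lin a x b y).
Proof.
move=> kx ly ua vb i.
under eq_fun do rewrite tnth_lin.
by rewrite tnth_lin; apply: cvgD; exact: cvgM.
Qed.

Lemma vec_cauchy (k : nat -> vec R m) :
  (forall e, 0 < e -> exists N, forall n p, (N <= n)%N -> (N <= p)%N ->
    sqnorm (vsub (k n) (k p)) < e) -> exists x, vcvg k x.
Proof.
move=> ck.
have cv i : cvg ((fun n => tnth (k n) i) @ \oo).
  apply/cauchy_cvgP/cauchy_exP => e e0 /=.
  have [N HN] := ck (e ^+ 2) (exprn_gt0 _ e0).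
  exists (tnth (k N) i); exists N => // n /= Nn.
  rewrite /ball/= -(@ltr_pXn2r _ 2)// ?nnegrE ?ltW//.
  rewrite real_normK ?num_real//.
  have := HN N n (leqnn _) Nn.
  apply: le_lt_trans; apply: le_trans (sqr_tnth_le_sqnorm _ i).
  by rewrite tnth_mktuple.
exists [tuple lim ((fun n => tnth (k n) i) @ \oo) | i < m] => i.
by rewrite tnth_mktuple; exact: cv.
Qed.

End Vectors.

(** * Monotone sets *)

Section Monotone.
Variables (R : realType) (m : nat).
Implicit Types (x y z g : vec2 R m) (G : set (vec2 R m)).

Definition qf z : R := dot z.1 z.2.
(** The [l_g] of the overview, that is the tangent of [qf] at [g]: [qf x - aff g x] equals
    [qf (vsub2 x g)]. Monotonicity of [G] thus says that the tangents taken at points of [G] stay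
    below [qf] on [G]. *)
Definition aff g y : R := Sform g y - Sform g g / 2.

Lemma Sform_diag z : Sform z z = 2 * qf z.
Proof. by rewrite /Sform /qf (dotC z.2); ring. Qed.

Lemma affE g y : aff g y = dot g.2 y.1 + dot g.1 y.2 - qf g.
Proof. by rewrite /aff Sform_diag /Sform; lra. Qed.

Lemma aff_diag z : aff z z = qf z.
Proof. by rewrite affE /qf (dotC z.2); ring. Qed.

Lemma SformC x y : Sform x y = Sform y x.
Proof. by rewrite /Sform (dotC x.1) (dotC x.2) addrC. Qed.

Lemma Sform_vsub2 x y :
  Sform (vsub2 x y) (vsub2 x y) = 2 * (qf x - aff y x).
Proof.
rewrite Sform_diag affE /qf /vsub2 /= !dotE (dotC x.1 y.2); ring.
Qed.

Lemma S_monotoneP G : S_monotone G <-> forall x g, G x -> G g -> aff g x <= qf x.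
Proof.
split=> h x y Gx Gy; have := h x y Gx Gy; rewrite Sform_vsub2; lra.
Qed.

(** The relation [aff g x <= qf x] is symmetric in [g] and [x], so [x] may be added to [G] without
    losing monotonicity. *)
Lemma maximal_mem G x : maximal_S_monotone G ->
  (forall g, G g -> aff g x <= qf x) -> G x.
Proof.
move=> [mG max] h; rewrite -(max (x |` G)); [by left| |by right].
have xg g : G g -> aff x g <= qf g.
  by move=> /h; rewrite !affE (dotC x.1) (dotC x.2); lra.
apply/S_monotoneP => a b [->|Ga] [->|Gb] //; first by rewrite aff_diag.
- exact: h.
- exact: xg.
- by move/S_monotoneP: mG; apply.
Qed.

Lemma maximal_nonempty G : maximal_S_monotone G -> exists g, G g.
Proof.
move=> mG; apply: contrapT => /forallNP G0.
by apply: (G0 ([tuple 0 | i < m], [tuple 0 | i < m])); apply: maximal_mem mG _ => g /G0.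
Qed.

(** If every [aff g] were strictly below [qf] at [x], then [x] would lie in [G], where
    [aff x x = qf x]. The bound [psi G >= qf] thus comes with a witness rather than as a
    supremum. *)
Lemma maximal_aff_ge G x : maximal_S_monotone G ->
  exists2 g, G g & qf x <= aff g x.
Proof.
move=> mG; have [Gx|nGx] := pselect (G x); first by exists x; rewrite ?aff_diag.
apply: contrapT => h; apply: nGx; apply: maximal_mem mG _ => g Gg.
by rewrite leNgt; apply/negP => /ltW ?; apply: h; exists g.
Qed.

(** Zorn's lemma is applied to the sets that can be added to [G]; the empty chain is then covered by
    [G] itself. *)
Lemma maximal_extension G : S_monotone G ->
  exists2 G', maximal_S_monotone G' & G `<=` G'.
Proof.
move=> mG.
have [F FP Ft|A [PA Amax]] := @Zorn_bigcup _ [set B | S_monotone (G `|` B)].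
  move=> x y [Gx|[B FB Bx]] [Gy|[C FC Cy]].
  - exact: mG.
  - by apply: (FP _ FC); [left|right].
  - by apply: (FP _ FB); [right|left].
  - have [BC|CB] := Ft _ _ FB FC.
    + by apply: (FP _ FC); right => //; exact: BC.
    + by apply: (FP _ FB); right => //; exact: CB.
exists (G `|` A); last by left.
split=> // G' mG' GG'; apply/seteqP; split=> // x G'x; right.
apply: contrapT => nAx; apply: (Amax G'); last first.
  rewrite /mkset; suff -> : G `|` G' = G' by [].
  by apply/seteqP; split=> z; [case=> // Gz; apply: GG'; left|right].
split; first by move=> z Az; apply: GG'; right.
by move=> /(_ _ G'x).
Qed.

(* Moving from [r] towards [u] by a small [t] makes the price [f (r - t (r - u))]
   no worse than any [s] in the monotone set above [r]. *)
Lemma aff_le_graph G (f : vec R m -> vec R m) y (c : R) : S_monotone G ->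
  graph_of f `<=` G -> (forall r, aff (r, f r) y <= c) ->
  forall g, G g -> aff g y <= c.
Proof.
move=> /S_monotoneP mG fG hc [r s] Grs; case: y hc => u v hc.
have key t : 0 < t < 1 ->
    (1 - t) * dot (vsub r u) (vsub v s) <= c - dot u v.
  move=> /andP[t0 t1].
  pose r' := lin (1 - t) r t u.
  move: (mG _ (r', f r') Grs (fG (r', f r') erefl)) (hc r').
  move: (f r') => w; rewrite !affE /qf /= /r' !dotE.
  rewrite (dotC w r) (dotC w u) => h1 h2; nra.
move/le_of_shrink : key; rewrite affE /qf /= !dotE (dotC s u); lra.
Qed.

End Monotone.

(** * Minty points of convex sets *)

Section ConvexSets.
Variables (R : realType) (m : nat).
Implicit Types (G : set (vec2 R m)) (A : set (vec2 R m * R)) (a b : vec2 R m * R).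

Definition comb (t : R) a b : vec2 R m * R :=
  ((lin (1 - t) a.1.1 t b.1.1, lin (1 - t) a.1.2 t b.1.2),
   (1 - t) * a.2 + t * b.2).

Definition convex_set A :=
  forall t a b, 0 <= t <= 1 -> A a -> A b -> A (comb t a b).

(* The concave function [D] below is bounded by [0] on [A]; along a maximizing
   sequence the vectors [kk a] form a Cauchy sequence, and half of their limit
   is the required point. *)
Lemma minty_point A (c : vec R m) : convex_set A -> A !=set0 ->
  (forall a, A a -> qf a.1 <= a.2) ->
  exists r : vec R m, forall a, A a ->
    Sform (r, vsub c r) a.1 - a.2 <= qf (r, vsub c r).
Proof.
move=> cA [a0 Aa0] Aq.
(* Completing the square in [r] turns the wanted inequality into [D a + |r - kk a / 2|^2 <= 0]. *)
pose kk a : vec R m := lin 1 (lin 1 c (-1) a.1.2) 1 a.1.1.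
pose D a := dot a.1.1 c - a.2 - sqnorm (kk a) / 4.
have D_comb t a b : D (comb t a b) = (1 - t) * D a + t * D b +
    t * (1 - t) * sqnorm (vsub (kk a) (kk b)) / 4.
  have -> : D (comb t a b) = dot (comb t a b).1.1 c - (comb t a b).2 -
      sqnorm (lin (1 - t) (kk a) t (kk b)) / 4.
    congr (_ - sqnorm _ / 4); apply: eq_from_tnth => i.
    by rewrite !tnth_lin; ring.
  rewrite /D /sqnorm /comb /=; move: (kk a) (kk b) => ka kb.
  by rewrite !dotE (dotC kb ka); field.
(* By polarization [D a = qf a.1 - a.2 - |c - a.1.2 - a.1.1|^2 / 4]. *)
have D_le0 a : A a -> D a <= 0.
  move=> /Aq; rewrite /D /qf.
  have := sqnorm_ge0 (lin 1 (lin 1 c (-1) a.1.2) (-1) a.1.1).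
  rewrite /sqnorm /kk !dotE (dotC c a.1.1) (dotC c a.1.2) (dotC a.1.2 a.1.1); lra.
pose E := [set D a | a in A].
have hE : has_sup E.
  split; first by exists (D a0); exists a0.
  by exists 0 => _ [a Aa <-]; exact: D_le0.
have Ele a : A a -> D a <= sup E by move=> Aa; apply: (ub_le_sup hE.2); exists a.
have s0 : sup E <= 0 by apply: (ge_sup hE.1) => _ [a Aa <-]; exact: D_le0.
have /choice[a_ Ha] : forall n, exists a,
    A a /\ sup E - n.+1%:R^-1 < D a.
  move=> n; have [|_ [a Aa <-] h] := @sup_adherent _ E n.+1%:R^-1 _ hE.
    by rewrite invr_gt0.
  by exists a.
have key t a b : 0 <= t <= 1 -> A a -> A b -> (1 - t) * D a + t * D b +
    t * (1 - t) * sqnorm (vsub (kk a) (kk b)) / 4 <= sup E.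
  by move=> t01 Aa Ab; rewrite -D_comb; apply: Ele; exact: cA.
have [k kcvg] : exists k, vcvg (fun n => kk (a_ n)) k.
  apply: vec_cauchy => e e0.
  (* At [t = 1/2] the concavity defect is [sqnorm / 16], so two values within [e / 16] of the
     supremum force the squared distance below [e]. *)
  have e160 : 0 < e / 16 by lra.
  have [N _ HN] := near_infty_natSinv_lt (PosNum e160).
  exists N => n p Nn Np.
  have [An Dn] := Ha n; have [Ap Dp] := Ha p.
  have := key (1/2) _ _ ltac:(lra) An Ap.
  move: (HN n Nn) (HN p Np) Dn Dp => /=.
  move: (n.+1%:R^-1) (p.+1%:R^-1) (D (a_ n)) (D (a_ p)) (sup E) => x1 x2 x3 x4 x5.
  by move: (sqnorm (vsub _ _)) => x; lra.
(* Compare with the segment from [a_ n] to [b]: let [n] tend to infinity, divide by [t], and let [t]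
   tend to 0. *)
have lim b : A b -> D b - sup E + sqnorm (vsub k (kk b)) / 4 <= 0.
  move=> Ab; suff : sqnorm (vsub k (kk b)) / 4 <= sup E - D b by lra.
  apply: le_of_shrink => t /andP[t0 t1].
  have : t * (D b - sup E) + t * (1 - t) / 4 * sqnorm (vsub k (kk b)) <= 0.
    have c1 : (fun n => t * (D b - sup E) + t * (1 - t) / 4 *
        sqnorm (vsub (kk (a_ n)) (kk b))) @ \oo -->
        t * (D b - sup E) + t * (1 - t) / 4 * sqnorm (vsub k (kk b)).
      apply: cvgD; first exact: cvg_cst.
      apply: cvgM; first exact: cvg_cst.
      have vc : vcvg (fun n => vsub (kk (a_ n)) (kk b)) (vsub k (kk b)).
        under eq_fun do rewrite vsubE.
        by rewrite vsubE; apply: lin_cvg => //; [exact: vcvg_cst|exact: cvg_cst..].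
      exact: (dot_cvg vc vc).
    apply: (ler_cvg_to c1 (@cvg_harmonic R)).
    apply: nearW => n; have [An Dn] := Ha n.
    have := key t _ _ _ An Ab; rewrite (ltW t0) (ltW t1) => /(_ isT).
    move: (sqnorm _) => x; rewrite /harmonic /=.
    have : 0 < n.+1%:R^-1 :> R by rewrite invr_gt0.
    move: Dn; move: (n.+1%:R^-1) => e; nra.
  move: (sqnorm _) => x; nra.
exists (lin (1/2) k 0 k) => a Aa; have := lim a Aa.
rewrite /D /sqnorm /qf /Sform /=.
have -> : dot (vsub k (kk a)) (vsub k (kk a)) =
  dot k k - 2 * (dot k c - dot k a.1.2 + dot k a.1.1) + dot (kk a) (kk a).
  have <- : dot k (kk a) = dot k c - dot k a.1.2 + dot k a.1.1.
    by rewrite /kk !dot_linr; ring.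
  by move: (kk a) => ka; rewrite !dotE (dotC ka k); ring.
move: (dot (kk a) (kk a)) => K.
rewrite !dotE (dotC c a.1.1); lra.
Qed.

(** Minty's surjectivity theorem. [A] is the epigraph of the Fitzpatrick function of [G] with second
    coordinates multiplied by [lam]; it lies above [qf] by maximality and contains every [emb g].
    The Minty point of [A] for [c = r] is monotonically related to the whole rescaled set, hence
    belongs to it. *)
Lemma resolvent_exists G (lam : R) (r : vec R m) : maximal_S_monotone G ->
  0 < lam -> exists s, G (lin 1 r (- lam) s, s).
Proof.
move=> mG lam0; have [/S_monotoneP monG _] := mG.
have lamE : lam * lam^-1 = 1 by rewrite mulfV ?gt_eqF.
pose A : set (vec2 R m * R) := [set a | forall g, G g ->
  lam * dot g.2 a.1.1 + dot g.1 a.1.2 - lam * qf g <= a.2].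
pose emb g : vec2 R m * R := ((g.1, lin lam g.2 0 g.2), lam * qf g).
have Aemb g : G g -> A (emb g).
  move=> Gg h Gh; have := monG _ _ Gg Gh.
  by rewrite affE /emb /= !dotE; nra.
have [|||r0 Hr0] := @minty_point A r.
- move=> t a b /andP[t0 t1] Aa Ab g Gg.
  have := Aa g Gg; have := Ab g Gg; rewrite /comb /= !dotE; nra.
- by have [g Gg] := maximal_nonempty mG; exists (emb g); exact: Aemb.
- move=> a Aa.
  have [g Gg] := maximal_aff_ge (a.1.1, lin lam^-1 a.1.2 0 a.1.2) mG.
  have := Aa g Gg; rewrite affE /qf /= !dotE.
  move=> h1 h2; have := ler_wpM2l (ltW lam0) h2.
  have lamK x : lam * (lam^-1 * x) = x by rewrite mulrA lamE mul1r.
  by rewrite !mul0r !addr0 mulrBr mulrDr !lamK; lra.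
exists (lin lam^-1 (vsub r r0) 0 r).
have -> : lin 1 r (- lam) (lin lam^-1 (vsub r r0) 0 r) = r0.
  apply: eq_from_tnth => i; rewrite !tnth_lin tnth_mktuple.
  by rewrite !mul0r addr0 mulNr mulrA lamE; ring.
apply: maximal_mem mG _ => g Gg; have := Hr0 _ (Aemb g Gg).
rewrite affE /qf /Sform /emb /= !dotE (dotC r g.1) (dotC r0 g.1) (dotC r0 g.2) (dotC r0 r) => h.
have lamK x : lam * (lam^-1 * x) = x by rewrite mulrA lamE mul1r.
by rewrite -(ler_pM2l lam0) !mul0r !addr0 !mulrBr mulrDr !lamK; move: h; rewrite /qf; lra.
Qed.

Lemma comb0 a b : comb 0 a b = a.
Proof.
case: a => -[a1 a2] a3; rewrite /comb /= subr0 mul1r mul0r addr0.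
by congr ((_, _), _); apply: eq_from_tnth => i; rewrite tnth_lin mul1r mul0r addr0.
Qed.

Lemma comb1 a b : comb 1 a b = b.
Proof.
case: b => -[b1 b2] b3; rewrite /comb /= subrr mul1r mul0r add0r.
by congr ((_, _), _); apply: eq_from_tnth => i; rewrite tnth_lin mul1r mul0r add0r.
Qed.

Lemma qf_comb t a b :
  qf (comb t a b).1 = (1 - t) ^+ 2 * qf a.1 + t ^+ 2 * qf b.1 +
    t * (1 - t) * Sform a.1 b.1.
Proof. by rewrite /qf /Sform /comb /= !dotE (dotC a.1.2 b.1.1); ring. Qed.

Lemma convex_join A b : convex_set A ->
  convex_set [set c | exists2 a, A a & exists2 t, 0 <= t <= 1 & c = comb t a b].
Proof.
move=> cA s c1 c2 /andP[s0 s1] [a Aa [t /andP[t0 t1] ->]] [a' Aa' [t' /andP[t'0 t'1] ->]].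
(* [w] is the total weight that the mixture puts on points of [A], and [al] below is the share of
   [a'] in it. *)
pose w := (1 - s) * (1 - t) + s * (1 - t').
have mix (x x' y : R) : (1 - s) * ((1 - t) * x + t * y) +
    s * ((1 - t') * x' + t' * y) =
    (1 - s) * (1 - t) * x + s * (1 - t') * x' + (1 - w) * y by rewrite /w; ring.
have w0 : 0 <= w by rewrite /w addr_ge0// mulr_ge0//; lra.
have w1 : w <= 1 by rewrite /w; nra.
(* With [w = 0] the mixture is [b] itself and the share [al] is undefined; any point of [A] with
   parameter 1 serves. *)
have [wz|wn] := eqVneq w 0.
  exists a => //; exists 1; first lra.
  have h1 : (1 - s) * (1 - t) = 0 by rewrite /w in wz; nra.
  have h2 : s * (1 - t') = 0 by rewrite /w in wz; nra.
  rewrite comb1; case: b => -[b1 b2] b3; rewrite /comb /=; congr ((_, _), _).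
  - by apply: eq_from_tnth => i; rewrite !tnth_lin mix h1 h2 wz; ring.
  - by apply: eq_from_tnth => i; rewrite !tnth_lin mix h1 h2 wz; ring.
  - by rewrite mix h1 h2 wz; ring.
pose al := s * (1 - t') / w.
have al0 : 0 <= al by rewrite divr_ge0// mulr_ge0//; lra.
have al1 : al <= 1.
  rewrite ler_pdivrMr ?mul1r ?lt_neqAle 1?eq_sym ?wn ?w0// /w lerDr mulr_ge0//; lra.
exists (comb al a a'); first by apply: cA => //; lra.
exists (1 - w); first lra.
have e1 : (1 - (1 - w)) * al = s * (1 - t').
  by rewrite opprB addrCA subrr addr0 mulrC /al divfK.
have e2 : (1 - (1 - w)) * (1 - al) = (1 - s) * (1 - t).
  by rewrite mulrBr e1 /w; ring.
have mix' (x x' y : R) : (1 - (1 - w)) * ((1 - al) * x + al * x') + (1 - w) * y =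
    (1 - s) * (1 - t) * x + s * (1 - t') * x' + (1 - w) * y.
  by rewrite -e1 -e2; ring.
rewrite /comb /=; congr ((_, _), _).
- by apply: eq_from_tnth => i; rewrite !tnth_lin mix mix'.
- by apply: eq_from_tnth => i; rewrite !tnth_lin mix mix'.
- by rewrite mix mix'.
Qed.

(** Zorn's lemma enlarges [A] to a maximal convex set [A'] above [qf], and [G] collects the points
    where [A'] touches the graph of [qf]. A point [z] with [aff z] below [A'] can be joined to [A']
    by segments that stay above [qf], so it lies in [G]; conversely the derivative at a touching
    point, along segments into [A'], puts [aff z] below [A']. For maximality, let [(u, v)] belong to
    a larger monotone set: the Minty point of [A'] for [c = u + v] is some [(r, s)] in [G] with
    [r + s = u + v], and monotonicity gives [- |u - r|^2 >= 0]. *)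
Lemma maximal_below A : convex_set A -> A !=set0 ->
  (forall a, A a -> qf a.1 <= a.2) ->
  exists2 G, maximal_S_monotone G & forall g a, G g -> A a -> aff g a.1 <= a.2.
Proof.
move=> cA A0 qA.
pose good (C : set (vec2 R m * R)) :=
  convex_set C /\ forall a, C a -> qf a.1 <= a.2.
have [F FP Ft|B [[cB qB] Bmax]] := @Zorn_bigcup _ [set B | good (A `|` B)].
  split.
    move=> t a b t01 [Aa|[C FC Ca]] [Ab|[C' FC' Cb]].
    - by left; exact: cA.
    - have [] := (FP _ FC').1 t a b t01; [by left|by right|by left|].
      by right; exists C'.
    - have [] := (FP _ FC).1 t a b t01; [by right|by left|by left|].
      by right; exists C.
    - have [CC|CC] := Ft _ _ FC FC'.
      + have [] := (FP _ FC').1 t a b t01; [by right; exact: CC|by right|by left|].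
        by right; exists C'.
      + have [] := (FP _ FC).1 t a b t01; [by right|by right; exact: CC|by left|].
        by right; exists C.
  move=> a [/qA//|[C FC Ca]]; apply: (FP _ FC).2; by right.
set A' := A `|` B in cB qB.
pose G := [set z | A' (z, qf z)].
have addG z : (forall a, A' a -> Sform z a.1 - a.2 <= qf z) -> G z.
  move=> hz; apply: contrapT => nGz.
  pose B' := [set c | exists2 a, A' a & exists2 t, 0 <= t <= 1 & c = comb t a (z, qf z)].
  have A'B' : A' `<=` B'.
    by move=> a Aa; exists a => //; exists 0; [lra|rewrite comb0].
  apply: (Bmax B').
    split; first by move=> b Bb; apply: A'B'; right.
    move=> /(_ (z, qf z)) h; apply: nGz; right; apply: h.
    have [a0 Aa0] := A0; exists a0; first by left.
    by exists 1; [lra|rewrite comb1].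
  rewrite /mkset; have -> : A `|` B' = B'.
    by apply/seteqP; split=> c; [case=> // Ac; apply: A'B'; left|right].
  split; first exact: convex_join.
  move=> _ [a Aa [t /andP[t0 t1] ->]].
  rewrite qf_comb /=; have := hz a Aa; have := qB a Aa.
  rewrite (SformC z) => h1 h2.
  rewrite -subr_ge0.
  have -> : (1 - t) * a.2 + t * qf z - ((1 - t) ^+ 2 * qf a.1 + t ^+ 2 * qf z +
    t * (1 - t) * Sform a.1 z) = (1 - t) ^+ 2 * (a.2 - qf a.1) +
    t * (1 - t) * (a.2 + qf z - Sform a.1 z) by ring.
  by rewrite addr_ge0// mulr_ge0 ?sqr_ge0 ?mulr_ge0//; lra.
have pair z a : G z -> A' a -> aff z a.1 <= a.2.
  move=> Gz Aa; suff : Sform z a.1 - qf z - qf a.1 <= a.2 - qf a.1.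
    by rewrite /aff Sform_diag; lra.
  apply: le_of_shrink => t /andP[t0 t1].
  have := qB _ (cB t _ _ _ Gz Aa); rewrite (ltW t0) (ltW t1) => /(_ isT).
  by rewrite qf_comb /=; nra.
exists G; last by move=> g a Gg Aa; apply: pair => //; left.
split; first by apply/S_monotoneP => x g Gx Gg; exact: (pair g (x, qf x)).
move=> G' /S_monotoneP mG' GG'; apply/seteqP; split=> // -[u v] G'uv.
have [|r Hr] := @minty_point A' (lin 1 u 1 v) cB _ qB.
  by have [a0 Aa0] := A0; exists a0; left.
set s := vsub _ r in Hr.
have Grs : G (r, s) by exact: addG.
have := mG' _ _ G'uv (GG' _ Grs).
have := sqnorm_ge0 (vsub u r) => h1 h2.
have ur : u = r.
  apply: sqnorm_eq0; move: h2; rewrite affE /qf /s /sqnorm /= !dotE.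
  rewrite (dotC r u) (dotC v u); lra.
have vs : v = s.
  by apply: eq_from_tnth => i; rewrite /s ur vsubE !tnth_lin; ring.
by rewrite {1}ur vs.
Qed.

End ConvexSets.

(** * Expectations *)

Section MeasurableSets.
Context {d : measure_display} {T : measurableType d} {R : realType}.
Implicit Types f g : T -> R.

Lemma measurable_set_le f g : measurable_fun setT f -> measurable_fun setT g ->
  measurable [set x | f x <= g x].
Proof. by move=> mf mg; rewrite -[X in measurable X]setTI; exact: measurable_fun_le. Qed.

Lemma measurable_set_lt f g : measurable_fun setT f -> measurable_fun setT g ->
  measurable [set x | f x < g x].
Proof.
move=> mf mg; rewrite (_ : [set x | _] = ~` [set x | g x <= f x]).
  by apply: measurableC; exact: measurable_set_le.
by apply/seteqP; split=> x /=; rewrite ltNge => /negP.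
Qed.

Lemma measurable_funV f : measurable_fun setT f -> (forall x, 0 < f x) ->
  measurable_fun setT (fun x => (f x)^-1).
Proof.
move=> mf f0; rewrite (_ : (fun x => _) = (fun x => expR (- ln (f x)))).
  by do 2 apply: measurableT_comp => //; exact: measurableT_comp.
by apply/funext => x; rewrite expRN lnK// posrE.
Qed.

End MeasurableSets.

Section Expectation.
Context {d : measure_display} {T : measurableType d} {R : realType}.
Variable P : probability T R.
Implicit Types (f g h : T -> R).

Definition Rintegrable f := P.-integrable setT (EFin \o f).
(** Real-valued by [fine], hence informative for integrable functions only; comparisons of
    expectations become goals for [lra]. *)
Definition Ex f : R := fine (\int[P]_x (f x)%:E)%E.

Lemma Rintegrable_meas f : Rintegrable f -> measurable_fun setT f.
Proof. by move/measurable_int/measurable_EFinP. Qed.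

Lemma ExE f : Rintegrable f -> (\int[P]_x (f x)%:E)%E = (Ex f)%:E.
Proof. by move=> intf; rewrite /Ex fineK//; exact: integrable_fin_num. Qed.

Lemma eq_intb f g : f =1 g -> Rintegrable f -> Rintegrable g.
Proof. by move/funext ->. Qed.

Lemma eq_Ex f g : f =1 g -> Ex f = Ex g.
Proof. by move/funext ->. Qed.

Lemma RintegrableD f g : Rintegrable f -> Rintegrable g -> Rintegrable (fun x => f x + g x).
Proof. exact: integrableD. Qed.

Lemma RintegrableZ (k : R) f : Rintegrable f -> Rintegrable (fun x => k * f x).
Proof. exact: integrableZl. Qed.

Lemma RintegrableB f g : Rintegrable f -> Rintegrable g -> Rintegrable (fun x => f x - g x).
Proof. exact: integrableB. Qed.

Lemma Rintegrable_cst (k : R) : Rintegrable (fun=> k).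
Proof. exact: finite_measure_integrable_cst. Qed.

Lemma Rintegrable_sum (I : Type) (s : seq I) (F : I -> T -> R) :
  (forall i, Rintegrable (F i)) -> Rintegrable (fun x => \sum_(i <- s) F i x).
Proof.
move=> intF; rewrite /Rintegrable.
have -> : (EFin \o fun x => \sum_(i <- s) F i x) =
    (fun x => \sum_(i <- s) (EFin \o F i) x)%E.
  by apply/funext => x /=; rewrite sumEFin.
by apply: integrable_sum => // i _; exact: intF.
Qed.

Lemma Rintegrable_le f g : measurable_fun setT f -> (forall x, `|f x| <= g x) ->
  Rintegrable g -> Rintegrable f.
Proof.
move=> mf fg; apply: le_integrable => //; first exact/measurable_EFinP.
by move=> x _ /=; rewrite lee_fin (le_trans (fg x))// ler_norm.
Qed.

Lemma Rintegrable_abs f : Rintegrable f -> Rintegrable (fun x => `|f x|).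
Proof. by move=> intf; exact: integrable_norm. Qed.

Lemma Rintegrable_bounded (k : R) f : measurable_fun setT f ->
  (forall x, `|f x| <= k) -> Rintegrable f.
Proof. by move=> mf fk; apply: Rintegrable_le mf fk _; exact: Rintegrable_cst. Qed.

Lemma Rintegrable_bM (k : R) h f : measurable_fun setT h -> (forall x, `|h x| <= k) ->
  Rintegrable f -> Rintegrable (fun x => h x * f x).
Proof.
move=> mh hk intf; apply: (@Rintegrable_le _ (fun x => k * `|f x|)).
- by apply: measurable_funM => //; exact: Rintegrable_meas.
- by move=> x; rewrite normrM ler_wpM2r.
- exact/RintegrableZ/Rintegrable_abs.
Qed.

Lemma Rintegrable_indic (B : set T) f : measurable B -> Rintegrable f ->
  Rintegrable (fun x => \1_B x * f x).
Proof.
move=> mB intf; apply: (@Rintegrable_bM 1) => //.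
by move=> x; rewrite indicE; case: (_ \in _); rewrite ?normr1 ?normr0.
Qed.

Lemma Rintegrable_ge0_lty f : measurable_fun setT f -> (forall x, 0 <= f x) ->
  (\int[P]_x (f x)%:E < +oo)%E -> Rintegrable f.
Proof.
move=> mf f0 intf; apply/integrableP; split; first exact/measurable_EFinP.
by under eq_integral => x _ do rewrite /= ger0_norm//.
Qed.

Lemma ExD f g : Rintegrable f -> Rintegrable g -> Ex (fun x => f x + g x) = Ex f + Ex g.
Proof.
move=> intf intg; apply: EFin_inj; rewrite EFinD -!ExE//; last exact: RintegrableD.
exact: (integralD measurableT intf intg).
Qed.

Lemma ExZ (k : R) f : Rintegrable f -> Ex (fun x => k * f x) = k * Ex f.
Proof.
move=> intf; apply: EFin_inj; rewrite EFinM -!ExE//; last exact: RintegrableZ.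
exact: (integralZl measurableT intf).
Qed.

Lemma ExB f g : Rintegrable f -> Rintegrable g -> Ex (fun x => f x - g x) = Ex f - Ex g.
Proof.
move=> intf intg; apply: EFin_inj; rewrite EFinB -!ExE//; last exact: RintegrableB.
exact: (integralB measurableT intf intg).
Qed.

Lemma Ex_cst (k : R) : Ex (fun=> k) = k.
Proof.
apply: EFin_inj; rewrite -ExE; last exact: Rintegrable_cst.
by rewrite [LHS](integral_cst P measurableT k%:E) [X in (_ * X)%E]probability_setT mule1.
Qed.

Lemma Ex_sum (I : Type) (s : seq I) (F : I -> T -> R) :
  (forall i, Rintegrable (F i)) ->
  Ex (fun x => \sum_(i <- s) F i x) = \sum_(i <- s) Ex (F i).
Proof.
move=> intF; elim: s => [|i s IH].
  by rewrite big_nil; under eq_Ex => x do rewrite big_nil; exact: Ex_cst.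
rewrite big_cons -IH -ExD//; last exact: Rintegrable_sum.
by apply: eq_Ex => x; rewrite big_cons.
Qed.

Lemma Ex_le f g : Rintegrable f -> Rintegrable g -> (forall x, f x <= g x) -> Ex f <= Ex g.
Proof.
move=> intf intg fg; rewrite -lee_fin -!ExE//.
by apply: le_integral => // x _; rewrite lee_fin.
Qed.

Lemma Ex_ge0 f : (forall x, 0 <= f x) -> 0 <= Ex f.
Proof. by move=> f0; apply: fine_ge0; apply: integral_ge0 => x _; rewrite lee_fin. Qed.

Lemma integral_setE (A : set T) f : measurable A -> Rintegrable f ->
  (\int[P]_(x in A) (f x)%:E)%E = (Ex (fun x => \1_A x * f x))%:E.
Proof.
move=> mA intf; rewrite -ExE; last exact: Rintegrable_indic.
rewrite integral_mkcond; apply: eq_integral => x _.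
by rewrite patchE indicE; case: (_ \in _); rewrite ?mul1r ?mul0r.
Qed.

Lemma Ex_eq0_ae f : Rintegrable f -> (forall x, 0 <= f x) -> Ex f <= 0 ->
  {ae P, forall x, f x = 0}.
Proof.
move=> intf f0 Ef.
have E0 : (\int[P]_x `|(f x)%:E| = 0)%E.
  under eq_integral => x _ do rewrite /= ger0_norm//.
  by rewrite ExE//; congr EFin; apply/eqP; rewrite eq_le Ef Ex_ge0.
have mf : measurable_fun setT (EFin \o f) by exact/measurable_EFinP/Rintegrable_meas.
have := (ae_eq_integral_abs P measurableT mf).1 E0.
by apply: filterS => x /(_ I) [].
Qed.

Lemma eq_Ex_ae f g : measurable_fun setT f -> measurable_fun setT g ->
  {ae P, forall x, f x = g x} -> Ex f = Ex g.
Proof.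
move=> mf mg fg; rewrite /Ex; congr fine.
apply: ae_eq_integral => //; [exact/measurable_EFinP..|].
by move: fg; apply: filterS => x -> _.
Qed.

Lemma Ex_le_ae f g : Rintegrable f -> Rintegrable g -> {ae P, forall x, f x <= g x} ->
  Ex f <= Ex g.
Proof.
(* [h] dominates [f] everywhere and equals [g] almost everywhere. *)
move=> intf intg fg; pose h x := Num.max (f x) (g x).
have mh : measurable_fun setT h by apply: measurable_maxr; exact: Rintegrable_meas.
have inth : Rintegrable h.
  apply: (Rintegrable_le mh _ (RintegrableD (Rintegrable_abs intf) (Rintegrable_abs intg))) => x.
  by rewrite /h; case: (leP (f x) (g x)) => _; rewrite ?lerDl ?lerDr.
rewrite -(@eq_Ex_ae h g) //; last 2 first.
- exact: Rintegrable_meas.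
- by move: fg; apply: filterS => x /max_idPr.
by apply: Ex_le => // x; rewrite /h le_max lexx.
Qed.

Lemma Ex_squeeze_ae f g : Rintegrable f -> Rintegrable g -> {ae P, forall x, f x <= g x} ->
  Ex g <= Ex f -> {ae P, forall x, f x = g x}.
Proof.
move=> intf intg fg Efg; pose h x := Num.max (f x) (g x).
have mh : measurable_fun setT h by apply: measurable_maxr; exact: Rintegrable_meas.
have hg : {ae P, forall x, h x = g x}.
  by move: fg; apply: filterS => x /max_idPr.
have inth : Rintegrable h.
  apply: (Rintegrable_le mh _ (RintegrableD (Rintegrable_abs intf) (Rintegrable_abs intg))) => x.
  by rewrite /h; case: (leP (f x) (g x)) => _; rewrite ?lerDl ?lerDr.
have := @Ex_eq0_ae (fun x => h x - f x).
move=> /(_ (RintegrableB inth intf)) H.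
have : {ae P, forall x, h x - f x = 0}.
  apply: H => [x|]; first by rewrite subr_ge0 /h le_max lexx.
  rewrite ExB// (@eq_Ex_ae h g)//; [lra|exact: Rintegrable_meas].
apply: filterS2 hg => x -> /eqP; by rewrite subr_eq0 => /eqP.
Qed.

Definition sqint f := measurable_fun setT f /\ Rintegrable (fun x => f x ^+ 2).

Lemma sqint_meas f : sqint f -> measurable_fun setT f. Proof. by case. Qed.

Lemma sqint_le f g : measurable_fun setT f -> (forall x, `|f x| <= `|g x|) ->
  sqint g -> sqint f.
Proof.
move=> mf fg [mg intg]; split=> //; apply: Rintegrable_le intg.
  exact: measurable_funX.
by move=> x; rewrite ger0_norm ?sqr_ge0// -[leLHS]real_normK ?num_real//
  -[leRHS]real_normK ?num_real// lerXn2r ?nnegrE.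
Qed.

Lemma sqintM f g : sqint f -> sqint g -> Rintegrable (fun x => f x * g x).
Proof.
move=> [mf intf] [mg intg]; apply: Rintegrable_le (RintegrableD intf intg).
  exact: measurable_funM.
move=> x; rewrite ler_norml.
by have := sqr_ge0 (f x + g x); have := sqr_ge0 (f x - g x); nra.
Qed.

Lemma sqint_cst (k : R) : sqint (fun=> k).
Proof. by split; [exact: measurable_cst|exact: Rintegrable_cst]. Qed.

Lemma sqint_int f : sqint f -> Rintegrable f.
Proof.
move=> sf; apply: eq_intb (sqintM sf (sqint_cst 1)) => x; by rewrite mulr1.
Qed.

Lemma sqintD f g : sqint f -> sqint g -> sqint (fun x => f x + g x).
Proof.
move=> sf sg; split; first by apply: measurable_funD; exact: sqint_meas.
apply: eq_intb (RintegrableD (RintegrableD sf.2 (RintegrableZ 2 (sqintM sf sg))) sg.2) => x /=.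
by rewrite sqrrD mulr_natl.
Qed.

Lemma sqintZ (k : R) f : sqint f -> sqint (fun x => k * f x).
Proof.
move=> sf; split; first by apply: measurable_funM => //; exact: sqint_meas.
by apply: eq_intb (RintegrableZ (k ^+ 2) sf.2) => x /=; rewrite exprMn.
Qed.

Lemma sqintB f g : sqint f -> sqint g -> sqint (fun x => f x - g x).
Proof.
move=> sf sg; have := sqintD sf (sqintZ (-1) sg).
by under eq_fun do rewrite mulN1r.
Qed.

Lemma sqint_bM (k : R) h f : measurable_fun setT h -> (forall x, `|h x| <= k) ->
  sqint f -> sqint (fun x => h x * f x).
Proof.
move=> mh hk sf; apply: (@sqint_le _ (fun x => k * f x)).
- by apply: measurable_funM => //; exact: sqint_meas.
- move=> x; rewrite !normrM ler_wpM2r//; apply: (le_trans (hk x)); exact: ler_norm.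
- exact: sqintZ.
Qed.

End Expectation.

(** * Conditional expectations *)

Section ConditionalExpectation.
Context {d : measure_display} {T : measurableType d} {R : realType}.
Variable P : probability T R.
Context {d' : measure_display} {T' : measurableType d'}.
Variable W : T -> T'.
Hypothesis mW : measurable_fun setT W.
Implicit Types (h k : T -> R) (g : T' -> R).

(** Equality of the conditional expectations given [W], without choosing a version. *)
Definition same_cexp h k := forall B, measurable B ->
  Ex P (fun x => \1_B (W x) * h x) = Ex P (fun x => \1_B (W x) * k x).

Lemma measurable_preimageW B : measurable B -> measurable (W @^-1` B).
Proof. by move=> mB; rewrite -[X in measurable X]setTI; exact: mW. Qed.

Lemma Rintegrable_indicW (B : set T') h : measurable B -> Rintegrable P h ->
  Rintegrable P (fun x => \1_B (W x) * h x).
Proof. by move=> mB; apply: Rintegrable_indic; exact: measurable_preimageW. Qed.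

Lemma same_cexp_integralP h k : Rintegrable P h -> Rintegrable P k ->
  (forall B, measurable B ->
    (\int[P]_(x in W @^-1` B) (h x)%:E = \int[P]_(x in W @^-1` B) (k x)%:E)%E)
  <-> same_cexp h k.
Proof.
move=> ih ik; split=> H B mB; have mWB := measurable_preimageW mB.
  by apply: EFin_inj; rewrite -(integral_setE mWB ih) -(integral_setE mWB ik); exact: H.
by rewrite !integral_setE//; congr EFin; exact: H.
Qed.

Section Tower.
Import HBNNSimple.
Variable D : T -> R.
Hypothesis intD : Rintegrable P D.
Hypothesis D0 : forall B, measurable B -> Ex P (fun x => \1_B (W x) * D x) = 0.

Let tower_nnsfun (s : {nnsfun T' >-> R}) : Ex P (fun x => s (W x) * D x) = 0.
Proof.
under eq_Ex => x do rewrite fimfunEord mulr_suml.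
rewrite Ex_sum; last first.
  move=> i; under eq_fun do rewrite -mulrA.
  by apply: RintegrableZ; apply: Rintegrable_indicW.
rewrite big1// => i _; under eq_Ex do rewrite -mulrA.
by rewrite ExZ ?D0 ?mulr0//; exact: Rintegrable_indicW.
Qed.

Let Rintegrable_nnsfun (s : {nnsfun T' >-> R}) : Rintegrable P (fun x => s (W x) * D x).
Proof.
under eq_fun => x do rewrite fimfunEord mulr_suml.
apply: Rintegrable_sum => i; under eq_fun do rewrite -mulrA.
by apply: RintegrableZ; apply: Rintegrable_indicW.
Qed.

(** Simple functions increase to [g] and [|g(W) D|] dominates the products, so [g] may be unbounded
    as long as its product with [D] is integrable. *)
Let tower_ge0 g : measurable_fun setT g -> (forall y, 0 <= g y) ->
  Rintegrable P (fun x => g (W x) * D x) -> Ex P (fun x => g (W x) * D x) = 0.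
Proof.
move=> mg g0 intg.
have mEg : measurable_fun setT (EFin \o g) by exact/measurable_EFinP.
have g0' y : [set: T'] y -> (0 <= (EFin \o g) y)%E by move=> _ /=; rewrite lee_fin.
pose s := nnsfun_approx measurableT mEg.
pose F n x : \bar R := (s n (W x) * D x)%:E.
have [] := @dominated_convergence _ _ _ P setT measurableT F
   (EFin \o (fun x => g (W x) * D x)) (EFin \o (fun x => `|g (W x) * D x|)).
- by move=> n; apply/measurable_EFinP/(@Rintegrable_meas _ _ _ P); exact: Rintegrable_nnsfun.
- by apply/measurable_EFinP/(@Rintegrable_meas _ _ _ P).
- apply: aeW => x _; rewrite /F; apply: cvg_EFin; first exact: nearW.
  apply: cvgM; last exact: cvg_cst.
  rewrite /= /s; under eq_fun do rewrite nnsfun_approxE.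
  by apply: (cvg_approx g0' I); rewrite ltry.
- exact: Rintegrable_abs.
- apply: aeW => x n _; rewrite /F /= lee_fin !normrM ler_wpM2r//.
  rewrite !ger0_norm//; have := le_approx n g0' (I : setT (W x)).
  by rewrite -nnsfun_approxE lee_fin.
- move=> _ _ lim; apply: EFin_inj; rewrite -ExE//.
  have := cvg_lim _ lim => <-//.
  rewrite (_ : [sequence _]_n = cst 0%E) ?lim_cst//.
  by apply/funext => n; rewrite /= /F ExE ?tower_nnsfun//; exact: Rintegrable_nnsfun.
Qed.

Lemma tower0 g : measurable_fun setT g ->
  Rintegrable P (fun x => g (W x) * D x) -> Ex P (fun x => g (W x) * D x) = 0.
Proof.
move=> mg intg.
pose gp y := Num.max (g y) 0; pose gn y := Num.max (- g y) 0.
have mgp : measurable_fun setT gp by exact: measurable_maxr.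
have mgn : measurable_fun setT gn.
  by apply: measurable_maxr => //; exact: measurableT_comp.
have mD : measurable_fun setT D by exact: Rintegrable_meas intD.
have ip : Rintegrable P (fun x => gp (W x) * D x).
  apply: Rintegrable_le (Rintegrable_abs intg).
    by apply: measurable_funM => //; exact: measurableT_comp.
  move=> x; rewrite !normrM ler_wpM2r// /gp.
  by case: (leP (g (W x)) 0); rewrite ?normr0.
have in' : Rintegrable P (fun x => gn (W x) * D x).
  apply: Rintegrable_le (Rintegrable_abs intg).
    by apply: measurable_funM => //; exact: measurableT_comp.
  move=> x; rewrite !normrM ler_wpM2r// /gn.
  by case: (leP (- g (W x)) 0); rewrite ?normr0 ?normrN.
rewrite (@eq_Ex _ _ _ _ _ (fun x => gp (W x) * D x - gn (W x) * D x)); last first.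
  move=> x; rewrite -mulrBl; congr (_ * _); rewrite /gp /gn.
  by case: (leP (g (W x)) 0); case: (leP (- g (W x)) 0); lra.
rewrite ExB// !tower_ge0 ?subrr//.
- by move=> y; rewrite /gn le_max lexx orbT.
- by move=> y; rewrite /gp le_max lexx orbT.
Qed.

End Tower.

Lemma tower h k g : Rintegrable P h -> Rintegrable P k -> same_cexp h k -> measurable_fun setT g ->
  Rintegrable P (fun x => g (W x) * h x) -> Rintegrable P (fun x => g (W x) * k x) ->
  Ex P (fun x => g (W x) * h x) = Ex P (fun x => g (W x) * k x).
Proof.
move=> ih ik hk mg igh igk; apply/eqP; rewrite -subr_eq0 -ExB//.
under eq_Ex do rewrite -mulrBr.
rewrite (tower0 (RintegrableB ih ik))//.
- move=> B mB; under eq_Ex do rewrite mulrBr.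
  by rewrite ExB ?hk ?subrr//; exact: Rintegrable_indicW.
- by under eq_fun do rewrite mulrBr; exact: RintegrableB.
Qed.

(** The version is obtained directly as a function of [W]: it is the Radon-Nikodym derivative, with
    respect to the law of [W], of the image under [W] of the signed measure with density [h]. *)
Lemma cond_exp_exists h : Rintegrable P h -> exists g : T' -> R,
  [/\ measurable_fun setT g, Rintegrable P (g \o W) & same_cexp h (g \o W)].
Proof.
move=> ih.
pose X : {mfun T >-> T'} := mfun_Sub (mem_set mW : W \in mfun).
pose mu : probability T' R := distribution P X.
pose nu0 : {charge set T' -> \bar R} := pushforward (induced_charge ih) X.
pose nu := nu0 mW.
have numu : nu `<< mu.
  apply/null_content_dominatesP => A mA muA.
  rewrite /nu /= /pushforward /induced_charge.
  apply: null_set_integral => //; first exact: measurable_preimageW.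
  by apply: measurable_funTS; exact: measurable_int ih.
pose g := fine \o (Radon_Nikodym nu mu).
have intRN := Radon_Nikodym_integrable numu.
have gE y : (g y)%:E = (Radon_Nikodym nu mu) y.
  by rewrite /g /= fineK//; exact: Radon_Nikodym_fin_num.
have mg : measurable_fun setT g.
  apply/measurable_EFinP; rewrite (_ : EFin \o g = (Radon_Nikodym nu mu)).
    exact: measurable_int intRN.
  by apply/funext => y /=; rewrite gE.
have ig : Rintegrable P (g \o W).
  apply/integrableP; split.
    by apply/measurable_EFinP; exact: measurableT_comp.
  have /integrableP[_] := intRN.
  rewrite ge0_integral_distribution//; last exact/measurableT_comp/(measurable_int _ intRN).
  by under eq_integral => x _ do rewrite /= -gE.
exists g; split=> //; apply/same_cexp_integralP => // B mB.
have -> : (\int[P]_(x in W @^-1` B) (h x)%:E)%E = nu B by [].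
rewrite (Radon_Nikodym_integral numu mB).
transitivity (\int[mu]_(y in B) (EFin \o g) y)%E.
  by apply: eq_integral => y _; rewrite /= gE.
rewrite /mu /distribution integral_pushforward//; first exact/measurable_EFinP.
exact: integrableS (measurable_preimageW mB) _ ig.
Qed.

(** Let [u] be [g] cut off to 0 where [|g| > n]. The tower property gives [E[u(W)^2] = E[u(W) h] <=
    (E[u(W)^2] + E[h^2]) / 2], so [E[u(W)^2] <= E[h^2]], and monotone convergence in [n]
    concludes. *)
Lemma same_cexp_sqint h g : measurable_fun setT g -> sqint P h -> Rintegrable P (g \o W) ->
  same_cexp h (g \o W) -> sqint P (g \o W).
Proof.
move=> mg sh ig hg; have ih := sqint_int sh.
have mgW : measurable_fun setT (g \o W) by exact: measurableT_comp.
split=> //.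
pose B n := [set y | `|g y| <= n%:R].
have mB n : measurable (B n).
  by apply: measurable_set_le; [exact: measurableT_comp|exact: measurable_cst].
have bd n : Rintegrable P (fun x => \1_(B n) (W x) * g (W x) ^+ 2) /\
    Ex P (fun x => \1_(B n) (W x) * g (W x) ^+ 2) <= Ex P (fun x => h x ^+ 2).
  pose u y := \1_(B n) y * g y.
  have mu : measurable_fun setT u by apply: measurable_funM.
  have ub y : `|u y| <= n%:R.
    rewrite /u indicE; case: (boolP (y \in B n)); rewrite ?mul1r ?mul0r ?normr0//.
    by rewrite inE.
  have muW : measurable_fun setT (u \o W) by exact: measurableT_comp.
  have uu x : \1_(B n) (W x) * g (W x) ^+ 2 = u (W x) * g (W x).
    by rewrite /u expr2 mulrA.
  have uu2 x : u (W x) * g (W x) = u (W x) ^+ 2.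
    by rewrite /u indicE; case: (_ \in _); rewrite ?mul1r ?mul0r ?expr2 ?mul0r.
  have i1 : Rintegrable P (fun x => u (W x) * g (W x)) by apply: (Rintegrable_bM muW _ ig) => x; exact: ub.
  have i2 : Rintegrable P (fun x => u (W x) * h x) by apply: (Rintegrable_bM muW _ ih) => x; exact: ub.
  split; first by under eq_fun do rewrite uu.
  under eq_Ex do rewrite uu.
  have i3 : Rintegrable P (fun x => u (W x) ^+ 2) by under eq_fun do rewrite -uu2.
  have : Ex P (fun x => u (W x) * h x) <=
      Ex P (fun x => 2^-1 * u (W x) ^+ 2 + 2^-1 * h x ^+ 2).
    apply: Ex_le => //; first by apply: RintegrableD; apply: RintegrableZ => //; exact: sh.2.
    by move=> x; have := sqr_ge0 (u (W x) - h x); lra.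
  rewrite ExD; [|apply: RintegrableZ => //; exact: sh.2..].
  rewrite !ExZ//; last exact: sh.2.
  rewrite (tower ih ig hg mu i2 i1) /=.
  by rewrite -(eq_Ex P uu2); lra.
apply: Rintegrable_ge0_lty; first exact: measurable_funX.
  by move=> x; exact: sqr_ge0.
pose F n := W @^-1` (B n).
have mF n : measurable (F n) by exact: measurable_preimageW.
have UF : \bigcup_n F n = setT.
  apply/seteqP; split=> // x _; exists (Num.truncn `|g (W x)|).+1 => //.
  by rewrite /F /B /=; apply/ltW/truncnS_gt.
have ndF : nondecreasing_seq F.
  move=> a b ab; apply/subsetPset => x; rewrite /F /B /= => /le_trans; apply.
  by rewrite ler_nat.
have := @ge0_nondecreasing_set_cvg_integral _ _ _ F (fun x => ((g \o W) x ^+ 2)%:E) P ndF mF.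
rewrite UF => lim.
apply: (@le_lt_trans _ _ (Ex P (fun x => h x ^+ 2))%:E); last by rewrite ltry.
have {}lim := lim (fun n => measurable_funTS ((measurable_EFinP _ _).2
  (measurable_funX 2 mgW))) (fun n x _ => _).
have f0 x : (0 <= ((g \o W) x ^+ 2)%:E)%E by rewrite lee_fin sqr_ge0.
rewrite -(cvg_lim _ (lim f0))//; apply: lime_le; first exact: cvgP (lim f0).
apply: nearW => n; have [ibd hbd] := bd n; rewrite integral_mkcond.
suff -> : (\int[P]_x ((fun x => ((g \o W) x ^+ 2)%:E) \_ (F n)) x =
    \int[P]_x (\1_(B n) (W x) * g (W x) ^+ 2)%:E)%E by rewrite ExE// lee_fin.
apply: eq_integral => x _; rewrite patchE indicE.
by rewrite (_ : (x \in F n) = (W x \in B n))//; case: (_ \in _); rewrite ?mul1r ?mul0r.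
Qed.

(** The bounds of [h] pass to its conditional expectation almost surely, and clipping yields a
    version bounded at every point. This keeps [1 - eps * rb x] away from 0 for every [x] in
    [optimal_density]. *)
Lemma same_cexp_clip (C : R) h g : 0 <= C -> measurable_fun setT h ->
  (forall x, 0 <= h x <= C) ->
  measurable_fun setT g -> Rintegrable P (g \o W) -> same_cexp h (g \o W) ->
  exists g' : T' -> R, [/\ measurable_fun setT g', forall y, 0 <= g' y <= C &
    same_cexp h (g' \o W)].
Proof.
move=> C0 mh h0C mg ig hg.
have ih : Rintegrable P h.
  apply: (@Rintegrable_bounded _ _ _ _ C) => // x.
  by have /andP[? ?] := h0C x; rewrite ger0_norm.
have mgW : measurable_fun setT (g \o W) by exact: measurableT_comp.
have hi : {ae P, forall x, g (W x) <= C}.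
  pose B := [set y | C < g y].
  have mB : measurable B.
    by apply: measurable_set_lt => //; exact: measurable_cst.
  have iC : Rintegrable P (fun=> C) by exact: Rintegrable_cst.
  have i1 : Rintegrable P (fun x => \1_B (W x) * (g (W x) - C)).
    by apply: Rintegrable_indicW => //; exact: RintegrableB.
  have : {ae P, forall x, \1_B (W x) * (g (W x) - C) = 0}.
    apply: Ex_eq0_ae i1 _ _ => [x|].
      rewrite indicE; case: (boolP (W x \in B)); rewrite ?mul0r// inE /B /= => h1.
      by rewrite mul1r; lra.
    under eq_Ex do rewrite mulrBr.
    rewrite ExB; [|exact: Rintegrable_indicW..].
    rewrite -(hg B mB) -ExB; [|exact: Rintegrable_indicW..].
    rewrite -[leRHS](Ex_cst P 0); apply: Ex_le; [|exact: Rintegrable_cst|].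
      by apply: RintegrableB; exact: Rintegrable_indicW.
    move=> x; rewrite -mulrBr indicE; have := h0C x.
    by case: (_ \in _); rewrite ?mul0r ?mul1r; lra.
  apply: filterS => x; rewrite indicE; case: (boolP (W x \in B)).
    rewrite inE /B /= mul1r; lra.
  by move=> /negP; rewrite inE /B /= => /negP; rewrite -leNgt.
have lo : {ae P, forall x, 0 <= g (W x)}.
  pose B := [set y | g y < 0].
  have mB : measurable B.
    by apply: measurable_set_lt => //; exact: measurable_cst.
  have i1 : Rintegrable P (fun x => - 1 * (\1_B (W x) * g (W x))).
    by apply: RintegrableZ; exact: Rintegrable_indicW.
  have : {ae P, forall x, - 1 * (\1_B (W x) * g (W x)) = 0}.
    apply: Ex_eq0_ae i1 _ _ => [x|].
      rewrite indicE; case: (boolP (W x \in B)); rewrite ?mul0r ?mulr0// inE /B /= => h1.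
      by rewrite mul1r; lra.
    rewrite ExZ; last exact: Rintegrable_indicW.
    rewrite -(hg B mB) -ExZ; last exact: Rintegrable_indicW.
    rewrite -[leRHS](Ex_cst P 0); apply: Ex_le; [|exact: Rintegrable_cst|].
      by apply: RintegrableZ; exact: Rintegrable_indicW.
    move=> x; rewrite indicE; have := h0C x.
    by case: (_ \in _); rewrite ?mul0r ?mul1r; lra.
  apply: filterS => x; rewrite indicE; case: (boolP (W x \in B)).
    rewrite inE /B /= mul1r; lra.
  by move=> /negP; rewrite inE /B /= => /negP; rewrite -leNgt.
exists (fun y => Num.min (Num.max (g y) 0) C).
have mg' : measurable_fun setT (fun y => Num.min (Num.max (g y) 0) C).
  apply: measurable_minr; last exact: measurable_cst.
  by apply: measurable_maxr.
split=> //.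
  by move=> y; rewrite le_min le_max lexx orbT C0 ge_min lexx orbT.
move=> B mB; rewrite hg//; apply: eq_Ex_ae.
- by apply: measurable_funM => //; apply: measurableT_comp.
- by apply: measurable_funM; apply: measurableT_comp.
apply: filterS2 hi lo => x h1 h2 /=; congr (_ * _).
by rewrite (max_idPl h2) (min_idPl h1).
Qed.

(** Equality with the finite integral of [h] excludes an infinite positive or negative part. This is
    how the price [f(R)] of an equilibrium is seen to be integrable. *)
Lemma same_cexp_integrable h g : measurable_fun setT g -> Rintegrable P h ->
  (\int[P]_x (h x)%:E = \int[P]_x (g (W x))%:E)%E -> Rintegrable P (g \o W).
Proof.
move=> mg ih e.
have mgW : measurable_fun setT (EFin \o (g \o W)).
  by apply/measurable_EFinP; exact: measurableT_comp.
apply/integrableP; split=> //; apply/abse_integralP => //.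
by rewrite [X in (`|X|)%E](_ : _ = (Ex P h)%:E) ?ltry// -ExE.
Qed.

End ConditionalExpectation.

(** * Countable suprema *)

Section Dense.
Context {R : realType}.

(** For every rational grid point and every scale [1/(n+1)], pick a point of [G] within that scale
    if there is one, and [x0] otherwise; such pairs are countable. *)
Lemma dense_sequence (S : Type) (I : finType) (G : set S) (phi : S -> I -> R) :
  G !=set0 -> exists e : nat -> S, (forall k, G (e k)) /\
    forall x eps, G x -> 0 < eps ->
      exists k, forall i, `|phi (e k) i - phi x i| < eps.
Proof.
move=> [x0 Gx0].
pose C := ({ffun I -> rat} * nat)%type.
pose near (c : C) x := G x /\ forall i, `|phi x i - ratr (c.1 i)| < c.2.+1%:R^-1.
have /choice[pickf Hpick] : forall c : C, exists x, G x /\ ((exists y, near c y) -> near c x).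
  move=> c; have [[y ny]|no] := pselect (exists y, near c y).
    by exists y; split=> //; case: ny.
  by exists x0.
pose e k := if unpickle k is Some c then pickf c else x0.
exists e; split=> [k|x eps Gx eps0].
  by rewrite /e; case: unpickle => [c|//]; exact: (Hpick c).1.
have eps20 : 0 < eps / 2 by lra.
have [N _ HN] := near_infty_natSinv_lt (PosNum eps20).
have {HN} := HN N (leqnn N); rewrite /= => HN.
have d0 : 0 < N.+1%:R^-1 :> R by rewrite invr_gt0.
have /choice[q Hq] : forall i, exists q : rat, `|phi x i - ratr q| < N.+1%:R^-1.
  move: d0; move: (N.+1%:R^-1) => z z0 i.
  have /rat_in_itvoo[q] : phi x i - z < phi x i + z by lra.
  by rewrite in_itv /= => /andP[h1 h2]; exists q; rewrite ltr_norml; lra.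
pose c : C := ([ffun i => q i], N).
have nx : near c x by split=> // i; rewrite ffunE.
exists (pickle c) => i; rewrite /e pickleK.
have [_ /(_ (ex_intro _ x nx)) [_ h]] := Hpick c.
have := h i; rewrite ffunE => h1; have h2 := Hq i.
rewrite -(subrK (ratr (q i)) (phi (pickf c) i)) -addrA.
apply: (le_lt_trans (ler_normD _ _)); rewrite (distrC (ratr _)).
move: h1 h2 HN; set a := `| _ |; set b := `| _ |; move: (N.+1%:R^-1) => z; lra.
Qed.

Variable m : nat.
Implicit Types (G : set (vec2 R m)).

Lemma aff_dense G : G !=set0 -> exists e : nat -> vec2 R m,
  (forall k, G (e k)) /\
  forall g y c, G g -> c < aff g y -> exists k, c < aff (e k) y.
Proof.
move=> G0.
(* With [qf] added to the coordinates, [aff g y] at fixed [y] is affine in the approximated data,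
   and [Y] below is a Lipschitz constant for it. *)
pose phi (g : vec2 R m) (i : option ('I_m + 'I_m)) : R :=
  match i with Some (inl i) => tnth g.1 i | Some (inr i) => tnth g.2 i
  | None => qf g end.
have [e [Ge He]] := dense_sequence phi G0.
exists e; split=> // g y c Gg cg.
pose Y := \sum_(i < m) (`|tnth y.1 i| + `|tnth y.2 i|) + 1.
have Y1 : 1 <= Y by rewrite /Y lerDr sumr_ge0// => i _; rewrite addr_ge0.
pose eps := (aff g y - c) / (2 * Y).
have eps0 : 0 < eps by rewrite divr_gt0//; lra.
have epsY : eps * (2 * Y) = aff g y - c by rewrite divfK//; lra.
have [k Hk] := He g eps Gg eps0; exists k.
suff : aff g y - aff (e k) y <= eps * Y by nra.
rewrite !affE /dot.
have -> : \sum_(i < m) tnth g.2 i * tnth y.1 i + \sum_(i < m) tnth g.1 i * tnth y.2 i -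
    qf g - (\sum_(i < m) tnth (e k).2 i * tnth y.1 i +
    \sum_(i < m) tnth (e k).1 i * tnth y.2 i - qf (e k)) =
  \sum_(i < m) ((tnth g.2 i - tnth (e k).2 i) * tnth y.1 i +
    (tnth g.1 i - tnth (e k).1 i) * tnth y.2 i) + (qf (e k) - qf g).
  under [in RHS]eq_bigr do rewrite !mulrBl.
  by rewrite big_split /= !big_split/= !sumrN; ring.
rewrite /Y mulrDr mulr1 lerD//; last first.
  by have := Hk None; rewrite /= ltr_norml => /andP[_ /ltW].
rewrite mulr_sumr ler_sum// => i _; rewrite mulrDr lerD//.
- apply: le_trans (ler_norm _) _; rewrite normrM ler_wpM2r// distrC.
  exact: ltW (Hk (Some (inr i))).
- apply: le_trans (ler_norm _) _; rewrite normrM ler_wpM2r// distrC.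
  exact: ltW (Hk (Some (inl i))).
Qed.

Lemma psi_le G y (c : R) : (psi G y <= c%:E)%E <-> forall g, G g -> aff g y <= c.
Proof.
split=> [h g Gg|h]; last first.
  by apply: ge_ereal_sup => _ [g Gg <-]; rewrite lee_fin; exact: h.
rewrite -lee_fin; apply: le_trans h; apply: ereal_sup_ubound.
by exists g.
Qed.

Lemma aff_le_psi G g y : G g -> ((aff g y)%:E <= psi G y)%E.
Proof. by move=> Gg; apply: ereal_sup_ubound; exists g. Qed.

Lemma psi_seq G (e : nat -> vec2 R m) y : (forall k, G (e k)) ->
  (forall g y c, G g -> c < aff g y -> exists k, c < aff (e k) y) ->
  psi G y = esups (fun k => (aff (e k) y)%:E) 0.
Proof.
move=> Ge He; apply/eqP; rewrite eq_le; apply/andP; split.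
  apply: ge_ereal_sup => _ [g Gg <-]; rewrite leNgt; apply/negP.
  set s := esups _ _ => sg.
  have [k hk] : exists k, (s < (aff (e k) y)%:E)%E.
    move: sg; case: s => [r| |] //=; rewrite ?ltNye.
    + by rewrite lte_fin => /(He _ _ _ Gg)[k ?]; exists k; rewrite lte_fin.
    + by move=> _; exists 0%N; rewrite ltNyr.
  move: hk; rewrite ltNge => /negP; apply; apply: ereal_sup_ubound.
  by exists k.
by apply: ge_ereal_sup => _ [k _ <-]; exact: aff_le_psi.
Qed.

Lemma measurable_dot d (T : measurableType d) (X Y : T -> vec R m) :
  measurable_fun setT X -> measurable_fun setT Y ->
  measurable_fun setT (fun w => dot (X w) (Y w)).
Proof.
move=> /measurable_fun_tnthP mX /measurable_fun_tnthP mY.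
apply: measurable_sum => i; exact: measurable_funM (mX i) (mY i).
Qed.

Lemma measurable_Sform d (T : measurableType d) (X Y : T -> vec2 R m) :
  measurable_fun setT X -> measurable_fun setT Y ->
  measurable_fun setT (fun w => Sform (X w) (Y w)).
Proof.
move=> /measurable_fun_pairP[mX1 mX2] /measurable_fun_pairP[mY1 mY2].
by apply: measurable_funD; exact: measurable_dot.
Qed.

Lemma measurable_qf : measurable_fun setT (@qf R m).
Proof. exact: measurable_dot. Qed.

Lemma measurable_aff g : measurable_fun setT (@aff R m g).
Proof.
apply: measurable_funB; last exact: measurable_cst.
by apply: measurable_Sform => //; exact: measurable_cst.
Qed.

Lemma measurable_psi G : G !=set0 -> measurable_fun setT (psi G).
Proof.
move=> /aff_dense[e [Ge He]].
rewrite (_ : psi G = fun y => esups (fun k => (aff (e k) y)%:E) 0).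
  by apply: measurable_fun_esups => k; apply/measurable_EFinP; exact: measurable_aff.
by apply/funext => y; exact: psi_seq.
Qed.

End Dense.

(** * Martingale couplings *)

Section SquareIntegrableVectors.
Context {d : measure_display} {T : measurableType d} {R : realType}.
Variable P : probability T R.
Variable m : nat.
Implicit Types (X Y Z : T -> vec R m).

Definition sqintv X := forall i, sqint P (fun w => tnth (X w) i).

Lemma sqintv_meas X : sqintv X -> measurable_fun setT X.
Proof. by move=> sX; apply/measurable_fun_tnthP => i; exact: (sX i).1. Qed.

Lemma Rintegrable_dot X Y : sqintv X -> sqintv Y -> Rintegrable P (fun w => dot (X w) (Y w)).
Proof. by move=> sX sY; apply: Rintegrable_sum => i; exact: sqintM. Qed.

Lemma L2_sqintv X : L2 P X <-> sqintv X.
Proof.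
split=> [[mX iX] i|sX]; last first.
  split; first exact: sqintv_meas.
  by rewrite ExE ?ltry//; exact: Rintegrable_dot.
have isq : Rintegrable P (fun w => sqnorm (X w)).
  apply: Rintegrable_ge0_lty => // [|x]; last exact: sqnorm_ge0.
  exact: measurable_dot.
have mXi : measurable_fun setT (fun w => tnth (X w) i).
  by move/measurable_fun_tnthP : mX; exact.
split=> //; apply: Rintegrable_le isq; first exact: measurable_funX.
by move=> x; rewrite ger0_norm ?sqr_ge0//; exact: sqr_tnth_le_sqnorm.
Qed.

Lemma sqintv_lin (a b : R) X Y : sqintv X -> sqintv Y -> sqintv (fun w => lin a (X w) b (Y w)).
Proof.
move=> sX sY i; under eq_fun do rewrite tnth_lin.
by apply: sqintD; exact: sqintZ.
Qed.

Lemma sqintv_cst (x : vec R m) : sqintv (fun=> x).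
Proof. by move=> i; exact: sqint_cst. Qed.

Context {d' : measure_display} {T' : measurableType d'}.
Variable W : T -> T'.
Hypothesis mW : measurable_fun setT W.

Definition same_cexpv Y Z := forall i, same_cexp P W (fun w => tnth (Y w) i) (fun w => tnth (Z w) i).

Lemma tower_dot (g : T' -> vec R m) Y Z : measurable_fun setT g ->
  sqintv (g \o W) -> sqintv Y -> sqintv Z -> same_cexpv Y Z ->
  Ex P (fun w => dot (g (W w)) (Y w)) = Ex P (fun w => dot (g (W w)) (Z w)).
Proof.
move=> mg sg sY sZ YZ; rewrite /dot !Ex_sum; try by move=> i; exact: sqintM (sg i) _.
apply: eq_bigr => i _.
apply: (tower mW (g := fun y => tnth (g y) i)) => //; try exact: sqint_int.
- by move/measurable_fun_tnthP : mg; exact.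
- exact: sqintM (sg i) _.
- exact: sqintM (sg i) _.
Qed.

Lemma cond_expv_exists Y : sqintv Y -> exists g : T' -> vec R m,
  [/\ measurable_fun setT g, sqintv (g \o W) & same_cexpv Y (g \o W)].
Proof.
move=> sY.
have /choice[g Hg] : forall i, exists g : T' -> R, [/\ measurable_fun setT g,
    Rintegrable P (g \o W) & same_cexp P W (fun w => tnth (Y w) i) (g \o W)].
  by move=> i; apply: cond_exp_exists => //; exact: sqint_int.
exists (fun y => [tuple g i y | i < m]); split.
- apply/measurable_fun_tnthP => i; rewrite /comp.
  by under eq_fun do rewrite tnth_mktuple; have [] := Hg i.
- move=> i; have [mg ig cg] := Hg i.
  have := same_cexp_sqint mW mg (sY i) ig cg.
  by rewrite /comp; under [in X in _ -> X]eq_fun do rewrite tnth_mktuple.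
- move=> i; have [mg ig cg] := Hg i; rewrite /comp.
  by under [X in same_cexp _ _ _ X]eq_fun do rewrite tnth_mktuple.
Qed.

End SquareIntegrableVectors.

(** * Martingale pairs and the conditional Jensen inequality *)

Section WeakDuality.
Context {d : measure_display} {T : measurableType d} {R : realType}.
Variable P : probability T R.
Variable m : nat.
Implicit Types (X Y : T -> vec2 R m) (G : set (vec2 R m)).

Definition sqint2 X := sqintv P (fst \o X) /\ sqintv P (snd \o X).

Lemma sqint2_meas X : sqint2 X -> measurable_fun setT X.
Proof. by move=> [? ?]; apply/measurable_fun_pairP; split; exact: (@sqintv_meas _ _ _ P). Qed.

Lemma L2_2_sqint2 X : L2_2 P X <-> sqint2 X.
Proof.
split=> [[mX iX]|[s1 s2]]; last first.
  split; first exact: sqint2_meas.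
  by rewrite ExE ?ltry//; apply: RintegrableD; exact: (@Rintegrable_dot _ _ _ _ _ (_ \o X) (_ \o X)).
have [mX1 mX2] := (measurable_fun_pairP _).1 mX.
have iX' : Rintegrable P (fun w => sqnorm2 (X w)).
  apply: Rintegrable_ge0_lty => // [|x]; last by rewrite addr_ge0// sqnorm_ge0.
  by apply: measurable_funD; exact: (@measurable_dot _ _ _ _ (_ \o X) (_ \o X)).
split=> i.
- have mXi : measurable_fun setT (fun w => tnth (X w).1 i).
    by move/measurable_fun_tnthP : mX1; exact.
  split=> //; apply: Rintegrable_le iX'; first exact: measurable_funX.
  move=> x; rewrite ger0_norm ?sqr_ge0//; apply: le_trans (sqr_tnth_le_sqnorm _ i) _.
  by rewrite lerDl sqnorm_ge0.
- have mXi : measurable_fun setT (fun w => tnth (X w).2 i).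
    by move/measurable_fun_tnthP : mX2; exact.
  split=> //; apply: Rintegrable_le iX'; first exact: measurable_funX.
  move=> x; rewrite ger0_norm ?sqr_ge0//; apply: le_trans (sqr_tnth_le_sqnorm _ i) _.
  by rewrite lerDr sqnorm_ge0.
Qed.

(** Measurability of [X] with respect to [Y] is kept apart in [meas_wrt], so that the notion covers
    both the maps of [Xset] and the two projections under a plan of [in_Gamma]. *)
Definition martingale X Y := [/\ sqint2 X, sqint2 Y,
  same_cexpv P X (fst \o Y) (fst \o X) & same_cexpv P X (snd \o Y) (snd \o X)].

Lemma Rintegrable_Sform X Y : sqint2 X -> sqint2 Y -> Rintegrable P (fun w => Sform (X w) (Y w)).
Proof.
by move=> [? ?] [? ?]; apply: RintegrableD; exact: (@Rintegrable_dot _ _ _ _ _ (_ \o X) (_ \o Y)).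
Qed.

Lemma Rintegrable_qf X : sqint2 X -> Rintegrable P (fun w => qf (X w)).
Proof. by move=> [? ?]; exact: (@Rintegrable_dot _ _ _ _ _ (_ \o X) (_ \o X)). Qed.

Lemma sqint2_cst (x : vec2 R m) : sqint2 (fun=> x).
Proof. by split; exact: sqintv_cst. Qed.

Lemma Rintegrable_aff g Y : sqint2 Y -> Rintegrable P (fun w => aff g (Y w)).
Proof.
by move=> sY; apply: RintegrableB (Rintegrable_cst _ _); exact: Rintegrable_Sform (sqint2_cst g) sY.
Qed.

Lemma martingale_Sform X Y (g : vec2 R m -> vec2 R m) : martingale X Y ->
  measurable_fun setT g -> sqint2 (g \o X) ->
  Ex P (fun w => Sform (g (X w)) (Y w)) = Ex P (fun w => Sform (g (X w)) (X w)).
Proof.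
move=> [sX sY c1 c2] /measurable_fun_pairP[mg1 mg2] [sg1 sg2].
have mX := sqint2_meas sX.
have k1 Z : sqint2 Z -> Rintegrable P (fun w => dot (g (X w)).2 (Z w).1).
  by move=> sZ; exact: (Rintegrable_dot sg2 sZ.1).
have k2 Z : sqint2 Z -> Rintegrable P (fun w => dot (g (X w)).1 (Z w).2).
  by move=> sZ; exact: (Rintegrable_dot sg1 sZ.2).
rewrite /Sform (ExD (k1 _ sY) (k2 _ sY)) (ExD (k1 _ sX) (k2 _ sX)).
congr (_ + _).
- exact: (tower_dot mX mg2 sg2 sY.1 sX.1 c1).
- exact: (tower_dot mX mg1 sg1 sY.2 sX.2 c2).
Qed.

Lemma martingale_value X Y : martingale X Y ->
  Ex P (fun w => Sform (X w) (Y w) / 2) = Ex P (fun w => qf (X w)).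
Proof.
move=> mXY; have [sX sY _ _] := mXY.
under eq_Ex do rewrite mulrC.
rewrite ExZ ?(martingale_Sform mXY (g := id))//; try exact: Rintegrable_Sform.
under eq_Ex do rewrite Sform_diag.
by rewrite ExZ; [lra|exact: Rintegrable_qf].
Qed.

Lemma Ex_aff_set (B : set (vec2 R m)) g X Y : martingale X Y -> measurable B ->
  Ex P (fun w => \1_B (X w) * aff g (Y w)) = Ex P (fun w => \1_B (X w) * aff g (X w)).
Proof.
move=> mXY mB; have [sX sY c1 c2] := mXY; have mX := sqint2_meas sX.
have key Z : sqint2 Z -> Ex P (fun w => \1_B (X w) * aff g (Z w)) =
  \sum_(i < m) tnth g.2 i * Ex P (fun w => \1_B (X w) * tnth (Z w).1 i) +
  \sum_(i < m) tnth g.1 i * Ex P (fun w => \1_B (X w) * tnth (Z w).2 i) -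
  qf g * Ex P (fun w => \1_B (X w) * 1).
  move=> [s1 s2].
  have i1 i : Rintegrable P (fun w => tnth g.2 i * (\1_B (X w) * tnth (Z w).1 i)).
    by apply/RintegrableZ/Rintegrable_indicW => //; exact: sqint_int (s1 i).
  have i2 i : Rintegrable P (fun w => tnth g.1 i * (\1_B (X w) * tnth (Z w).2 i)).
    by apply/RintegrableZ/Rintegrable_indicW => //; exact: sqint_int (s2 i).
  have i3 : Rintegrable P (fun w => qf g * (\1_B (X w) * 1)).
    by apply/RintegrableZ/Rintegrable_indicW => //; exact: Rintegrable_cst.
  transitivity (Ex P (fun w =>
    \sum_(i < m) tnth g.2 i * (\1_B (X w) * tnth (Z w).1 i) +
    \sum_(i < m) tnth g.1 i * (\1_B (X w) * tnth (Z w).2 i) -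
    qf g * (\1_B (X w) * 1))).
    apply: eq_Ex => w; rewrite affE; move: (qf g) => qg.
    rewrite /dot mulrBr mulrDr !mulr_sumr.
    congr (_ + _ - _); [apply: eq_bigr => i _; ring..|ring].
  rewrite ExB//; last by apply: RintegrableD; exact: Rintegrable_sum.
  rewrite ExD; [|exact: Rintegrable_sum..].
  rewrite !Ex_sum//; congr (_ + _ - _).
  - by apply: eq_bigr => i _; rewrite ExZ//; apply: Rintegrable_indicW => //; exact: sqint_int (s1 i).
  - by apply: eq_bigr => i _; rewrite ExZ//; apply: Rintegrable_indicW => //; exact: sqint_int (s2 i).
  - by rewrite ExZ//; apply: Rintegrable_indicW => //; exact: Rintegrable_cst.
rewrite !key//; congr (_ + _ - _); apply: eq_bigr => i _; congr (_ * _).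
- exact: c1.
- exact: c2.
Qed.

(* Conditional Jensen inequality for a supremum of affine functions, without
   disintegration: split according to the first affine function that nearly
   reaches [q] at [X]. *)
Lemma jensen_set (e : nat -> vec2 R m) (p : T -> R) (q : vec2 R m -> R) X Y
    (B : set (vec2 R m)) :
  martingale X Y -> Rintegrable P p -> (forall k, {ae P, forall w, aff (e k) (Y w) <= p w}) ->
  measurable_fun setT q -> Rintegrable P (q \o X) ->
  (forall x c, c < q x -> exists k, c < aff (e k) x) -> measurable B ->
  Ex P (fun w => \1_B (X w) * q (X w)) <= Ex P (fun w => \1_B (X w) * p w).
Proof.
move=> mXY ip hp mq iq he mB; have [sX sY _ _] := mXY; have mX := sqint2_meas sX.
apply/ler_addgt0Pr => del del0.
pose r w := p w - q (X w) + del.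
have ir : Rintegrable P r by apply: RintegrableD; [exact: RintegrableB|exact: Rintegrable_cst].
pose C k := [set x | B x /\ q x - del < aff (e k) x].
have mC k : measurable (C k).
  apply: measurableI => //; apply: measurable_set_lt; last exact: measurable_aff.
  by apply: measurable_funB => //; exact: measurable_cst.
pose C' := seqDU C.
have mC' k : measurable (C' k).
  by apply: measurableD => //; apply: bigsetU_measurable => i _; exact: mC.
have UC : \bigcup_k C' k = B.
  rewrite -seqDU_bigcup_eq; apply/seteqP; split=> [x [k _ []]//|x Bx].
  have [|k hk] := he x (q x - del); first by lra.
  by exists k.
have tF : trivIset setT (fun k => X @^-1` C' k).
  apply/trivIsetP => i j _ _ ij; rewrite -preimage_setI.
  by have /trivIsetP/(_ i j I I ij) -> := trivIset_seqDU C; rewrite preimage_set0.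
have mF k : measurable (X @^-1` C' k) by exact: measurable_preimageW.
(* On the piece [C' k] the mean of [p] is at least that of [aff (e k) (Y)], which equals that of
   [aff (e k) (X)] and exceeds that of [q(X) - del]; countable additivity of the integral of [r]
   adds up the pieces. *)
have H : (0 <= \int[P]_(w in X @^-1` B) (r w)%:E)%E.
  rewrite -UC preimage_bigcup integral_bigcup//; last first.
    rewrite -preimage_bigcup UC; apply: integrableS ir => //; exact: measurable_preimageW.
  apply: nneseries_ge0 => k _ _.
  rewrite integral_setE// lee_fin.
  have ia := Rintegrable_indicW mX (mC' k) (Rintegrable_aff (e k) sX).
  have ib := Rintegrable_indicW mX (mC' k) (Rintegrable_aff (e k) sY).
  have ic := Rintegrable_indicW mX (mC' k) ip.
  have iq' := Rintegrable_indicW mX (mC' k) iq.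
  have id' := Rintegrable_indicW mX (mC' k) (Rintegrable_cst P del).
  have h1 : Ex P (fun w => \1_(C' k) (X w) * aff (e k) (Y w)) <=
      Ex P (fun w => \1_(C' k) (X w) * p w).
    apply: Ex_le_ae => //; move: (hp k); apply: filterS => w hw.
    by rewrite indicE; case: (_ \in _); rewrite ?mul1r ?mul0r.
  have h2 : Ex P (fun w => \1_(C' k) (X w) * q (X w)) -
      Ex P (fun w => \1_(C' k) (X w) * del) <=
      Ex P (fun w => \1_(C' k) (X w) * aff (e k) (X w)).
    rewrite -ExB//; apply: Ex_le => //; first exact: RintegrableB.
    move=> w; rewrite indicE; case: (boolP (X w \in C' k)); rewrite ?mul1r ?mul0r ?subr0//.
    by rewrite inE => -[[_ /ltW]].
  rewrite (@eq_Ex _ _ _ P _ (fun w => \1_(C' k) (X w) * p w - \1_(C' k) (X w) * q (X w)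
     + \1_(C' k) (X w) * del)); last first.
    by move=> w; rewrite /r -mulrBr -mulrDr.
  rewrite ExD// ?ExB//; last exact: RintegrableB.
  have := Ex_aff_set (e k) mXY (mC' k); lra.
move: H; rewrite integral_setE//; last exact: measurable_preimageW.
rewrite lee_fin.
have ic := Rintegrable_indicW mX mB ip.
have iq' := Rintegrable_indicW mX mB iq.
have id' := Rintegrable_indicW mX mB (Rintegrable_cst P del).
rewrite (@eq_Ex _ _ _ P _ (fun w => \1_B (X w) * p w - \1_B (X w) * q (X w)
     + \1_B (X w) * del)); last by move=> w; rewrite /r -mulrBr -mulrDr.
rewrite ExD// ?ExB//; last exact: RintegrableB.
have : Ex P (fun w => \1_B (X w) * del) <= del.
  rewrite -[leRHS](Ex_cst P); apply: Ex_le => //; first exact: Rintegrable_cst.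
  by move=> w; rewrite indicE; case: (_ \in _); rewrite ?mul1r ?mul0r// ltW.
lra.
Qed.

End WeakDuality.

(** * Duality *)

Section Duality.
Context {d : measure_display} {T : measurableType d} {R : realType}.
Variable P : probability T R.
Variable m : nat.
Implicit Types (X Y : T -> vec2 R m) (G : set (vec2 R m)).

(** [psi] takes extended values. The minorant [l] controls its negative part and the finite integral
    then its positive part, which gives a real representative [p] almost everywhere. *)
Lemma integrable_of_lower (f : T -> \bar R) (l : T -> R) :
  measurable_fun setT f -> Rintegrable P l -> (forall w, ((l w)%:E <= f w)%E) ->
  (\int[P]_w f w < +oo)%E ->
  exists p : T -> R, [/\ Rintegrable P p, {ae P, forall w, f w = (p w)%:E} &
    (\int[P]_w f w = (Ex P p)%:E)%E].
Proof.
move=> mf il lf foo.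
have mp := measurable_funepos mf; have mn := measurable_funeneg mf.
have negfin : (\int[P]_w f^\- w < +oo)%E.
  apply: (@le_lt_trans _ _ (\int[P]_w (`|l w|)%:E)%E); last first.
    by rewrite ExE ?ltry//; exact: Rintegrable_abs.
  apply: ge0_le_integral => //.
  - by apply/measurable_EFinP/(@Rintegrable_meas _ _ _ P); exact: Rintegrable_abs.
  - move=> w _; rewrite funenegE; case: (leP (- f w)%E 0%E) => [_|h].
      by rewrite lee_fin.
    apply: (@le_trans _ _ (- (l w)%:E)%E).
      by rewrite leeN2.
    by rewrite -EFinN lee_fin -normrN ler_norm.
have nfin : (\int[P]_w f^\- w)%E \is a fin_num by rewrite ge0_fin_numE// integral_ge0.
have posfin : (\int[P]_w f^\+ w < +oo)%E.
  move: foo; rewrite integralE -(fineK nfin); case: (\int[P]_w f^\+ w)%E => // r _.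
  by rewrite ltry.
have intf : P.-integrable setT f.
  apply/integrableP; split=> //; apply/abse_integralP => //.
  have pfin : (\int[P]_w f^\+ w)%E \is a fin_num by rewrite ge0_fin_numE// integral_ge0.
  by rewrite integralE -ge0_fin_numE// abse_fin_num fin_numB pfin nfin.
pose p w := fine (f w).
have fp : {ae P, forall w, f w = (p w)%:E}.
  have := integrable_ae measurableT intf.
  by apply: filterS => w /(_ I) ?; rewrite /p fineK.
have mpp : measurable_fun setT p by exact: measurableT_comp.
have ip : Rintegrable P p.
  apply/integrableP; split; first exact/measurable_EFinP.
  have /integrableP[_] := intf; apply: le_lt_trans.
  apply: ge0_le_integral => //.
  - by apply: measurableT_comp => //; exact/measurable_EFinP.
  - exact: measurableT_comp.
  - by move=> w _ /=; rewrite /p; case: (f w) => //=; rewrite normr0 leey.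
exists p; split=> //.
rewrite -ExE//; apply: ae_eq_integral => //; first exact/measurable_EFinP.
by move: fp; apply: filterS => w -> _.
Qed.

Lemma psi_integrable G Y : maximal_S_monotone G -> sqint2 P Y ->
  (\int[P]_w psi G (Y w) < +oo)%E ->
  exists p : T -> R, [/\ Rintegrable P p, {ae P, forall w, psi G (Y w) = (p w)%:E} &
    (\int[P]_w psi G (Y w) = (Ex P p)%:E)%E].
Proof.
move=> mG sY; have [g Gg] := maximal_nonempty mG.
apply: (@integrable_of_lower _ (fun w => aff g (Y w))).
- apply: measurableT_comp (sqint2_meas sY) => //.
  by apply: measurable_psi; exists g.
- exact: Rintegrable_aff.
- by move=> w; exact: aff_le_psi.
Qed.

Lemma psi_integral_le G Y (b : T -> R) : maximal_S_monotone G -> sqint2 P Y ->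
  Rintegrable P b -> {ae P, forall w, (psi G (Y w) <= (b w)%:E)%E} ->
  (\int[P]_w psi G (Y w) <= (Ex P b)%:E)%E.
Proof.
move=> mG sY ib psi_ub; have [g Gg] := maximal_nonempty mG.
pose l w := aff g (Y w).
have il : Rintegrable P l by exact: Rintegrable_aff.
have mpsi : measurable_fun setT (fun w => psi G (Y w)).
  apply: measurableT_comp (sqint2_meas sY) => //; apply: measurable_psi.
  exact: maximal_nonempty.
(* Truncation at [b] changes [psi] on a null set only and places it between two integrable real
   functions, the minimum of [l] and [b], and [b]. *)
pose f' w := Order.min (psi G (Y w)) (b w)%:E.
have mf' : measurable_fun setT f'.
  by apply: measurable_mine => //; apply/measurable_EFinP; exact: (Rintegrable_meas ib).
have f'b w : (f' w <= (b w)%:E)%E by rewrite /f' ge_min lexx orbT.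
have f'l w : ((Num.min (l w) (b w))%:E <= f' w)%E.
  rewrite /f' le_min; apply/andP; split; last by rewrite lee_fin ge_min lexx orbT.
  apply: (@le_trans _ _ (l w)%:E); first by rewrite lee_fin ge_min lexx.
  exact: aff_le_psi.
have f'E w : f' w = (fine (f' w))%:E.
  rewrite fineK// fin_numElt (lt_le_trans (ltNyr _) (f'l w)) /=.
  exact: le_lt_trans (f'b w) (ltry _).
have ip : Rintegrable P (fine \o f').
  apply: (@Rintegrable_le _ _ _ _ _ (fun w => `|l w| + `|b w|)).
  - exact: measurableT_comp.
  - move=> w; have := f'b w; have := f'l w; rewrite f'E !lee_fin /= => h1 h2.
    have b1 := ler_norm (b w); have b2 := ler_norm (- b w); rewrite normrN in b2.
    have l2 := ler_norm (- l w); rewrite normrN in l2.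
    have := normr_ge0 (l w); have := normr_ge0 (b w).
    rewrite ler_norml; move: h1; rewrite ge_min => /orP[] ?; lra.
  - by apply: RintegrableD; apply: Rintegrable_abs.
have -> : (\int[P]_w psi G (Y w) = \int[P]_w f' w)%E.
  apply: ae_eq_integral => //; move: psi_ub; apply: filterS => w hw _.
  by rewrite /f' min_l.
under eq_integral do rewrite f'E.
rewrite (ExE ip) lee_fin.
apply: Ex_le => // w /=; have := f'b w; by rewrite {1}f'E lee_fin.
Qed.

Lemma jensen_maximal G X Y p (B : set (vec2 R m)) : maximal_S_monotone G ->
  martingale P X Y -> Rintegrable P p -> {ae P, forall w, psi G (Y w) = (p w)%:E} ->
  measurable B ->
  Ex P (fun w => \1_B (X w) * qf (X w)) <= Ex P (fun w => \1_B (X w) * p w).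
Proof.
move=> mG mXY ip pE mB; have [sX sY _ _] := mXY.
have [e [Ge He]] := aff_dense (maximal_nonempty mG).
apply: (jensen_set (e := e) (Y := Y)) => //.
- move=> k; move: pE; apply: filterS => w pw.
  by rewrite -lee_fin -pw; exact: aff_le_psi.
- exact: measurable_qf.
- exact: Rintegrable_qf.
- move=> x c cx; have [g Gg qg] := maximal_aff_ge x mG.
  exact: He Gg (lt_le_trans cx qg).
Qed.

Lemma weak_duality G X Y : maximal_S_monotone G -> martingale P X Y ->
  ((Ex P (fun w => Sform (X w) (Y w) / 2))%:E <= \int[P]_w psi G (Y w))%E.
Proof.
move=> mG mXY; have [sX sY _ _] := mXY; rewrite leNgt; apply/negP => lt.
have [p [ip pE IE]] := psi_integrable mG sY (lt_trans lt (ltry _)).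
move: lt; rewrite IE lte_fin martingale_value// ltNge => /negP; apply.
have := jensen_maximal mG mXY ip pE measurableT.
by under eq_Ex do rewrite indicT mul1r; under [leRHS]eq_Ex do rewrite indicT mul1r.
Qed.

Lemma weak_duality_eq G X Y : maximal_S_monotone G -> martingale P X Y ->
  (\int[P]_w psi G (Y w) <= (Ex P (fun w => Sform (X w) (Y w) / 2))%:E)%E ->
  {ae P, forall w, G (X w)} /\
  {ae P, forall w, psi G (Y w) = (aff (X w) (Y w))%:E}.
Proof.
move=> mG mXY le; have [sX sY _ _] := mXY; have mX := sqint2_meas sX.
have [p [ip pE IE]] := psi_integrable mG sY (le_lt_trans le (ltry _)).
move: le; rewrite IE lee_fin martingale_value// => le.
have [e [Ge He]] := aff_dense (maximal_nonempty mG).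
have iq := Rintegrable_qf sX.
(* On [B] the bound by [aff (e k)] is strictly better than the one by [qf]. Using it on [B] and
   Jensen's inequality on the complement would make the duality gap strictly positive unless [X]
   avoids [B] almost surely. *)
have ek k : {ae P, forall w, aff (e k) (X w) <= qf (X w)}.
  pose B := [set x | qf x < aff (e k) x].
  have mB : measurable B by apply: measurable_set_lt; [exact: measurable_qf|exact: measurable_aff].
  have mBC : measurable (~` B) by exact: measurableC.
  have iaX := Rintegrable_indicW mX mB (Rintegrable_aff (e k) sX).
  have iaY := Rintegrable_indicW mX mB (Rintegrable_aff (e k) sY).
  have iqB := Rintegrable_indicW mX mB iq.
  have iqC := Rintegrable_indicW mX mBC iq.
  have ipB := Rintegrable_indicW mX mB ip.
  have ipC := Rintegrable_indicW mX mBC ip.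
  have splt (h : T -> R) : Rintegrable P h -> Ex P h =
      Ex P (fun w => \1_B (X w) * h w) + Ex P (fun w => \1_(~` B) (X w) * h w).
    move=> ih; rewrite -ExD; [|exact: Rintegrable_indicW..].
    apply: eq_Ex => w; rewrite !indicE in_setC.
    by case: (_ \in _); rewrite /= ?mul1r ?mul0r ?addr0 ?add0r.
  have h1 := jensen_maximal mG mXY ip pE mBC.
  have h2 : Ex P (fun w => \1_B (X w) * aff (e k) (Y w)) <=
      Ex P (fun w => \1_B (X w) * p w).
    apply: Ex_le_ae => //; move: pE; apply: filterS => w pw.
    rewrite indicE; case: (_ \in _); rewrite ?mul1r ?mul0r//.
    by rewrite -lee_fin -pw; exact: aff_le_psi.
  have h3 := Ex_aff_set (e k) mXY mB.
  have h4 := splt _ ip; have h5 := splt _ iq.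
  have : {ae P, forall w, \1_B (X w) * aff (e k) (X w) - \1_B (X w) * qf (X w) = 0}.
    apply: Ex_eq0_ae; first exact: RintegrableB.
      move=> w; rewrite indicE; case: (boolP (X w \in B)); rewrite ?mul1r ?mul0r ?subrr//.
      by rewrite inE /B /= => ?; lra.
    by rewrite ExB//; lra.
  apply: filterS => w; rewrite indicE; case: (boolP (X w \in B)).
    by rewrite inE /B /= !mul1r => ? ?; lra.
  by move=> /negP; rewrite inE /B /= => /negP; rewrite -leNgt.
have GX : {ae P, forall w, G (X w)}.
  have := ae_foralln ek; apply: filterS => w hw.
  apply: maximal_mem mG _ => g Gg; rewrite leNgt; apply/negP => lt.
  have [k] := He g _ _ Gg lt; rewrite ltNge => /negP; apply; exact: hw.
split=> //.
have ia : Rintegrable P (fun w => aff (X w) (Y w)).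
  have := RintegrableB (Rintegrable_Sform sX sY) iq; apply: eq_intb => w.
  by rewrite /aff Sform_diag; lra.
have : {ae P, forall w, aff (X w) (Y w) = p w}.
  apply: Ex_squeeze_ae => //.
    apply: filterS2 GX pE => w Gw pw.
    by rewrite -lee_fin -pw; exact: aff_le_psi.
  rewrite (@eq_Ex _ _ _ P (fun w => aff (X w) (Y w))
    (fun w => Sform (X w) (Y w) - qf (X w))); last first.
    by move=> w; rewrite /aff Sform_diag; lra.
  rewrite ExB//; last exact: Rintegrable_Sform.
  have := martingale_value mXY; under eq_Ex do rewrite mulrC.
  by rewrite ExZ; [lra|exact: Rintegrable_Sform].
by apply: filterS2 pE => w -> ->.
Qed.

End Duality.

(** * Integrals under laws, and plans as martingale pairs *)

Section Laws.
Context {d : measure_display} {T : measurableType d} {R : realType}.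
Variable P : probability T R.
Context {d' : measure_display} {T' : measurableType d'}.
Variables (gamma : probability T' R) (Z : T -> T').
Hypothesis mZ : measurable_fun setT Z.
Hypothesis law : is_law_of P gamma Z.

Lemma integral_law (f : T' -> \bar R) : measurable_fun setT f ->
  (\int[gamma]_z f z = \int[P]_w f (Z w))%E.
Proof.
move=> mf.
pose X : {mfun T >-> T'} := mfun_Sub (mem_set mZ : Z \in mfun).
have -> : (\int[gamma]_z f z = \int[distribution P X]_z f z)%E.
  by apply: eq_measure_integral => A mA _; exact: law.
rewrite integralE [RHS]integralE.
rewrite !ge0_integral_distribution//; [|exact: measurable_funeneg|exact: measurable_funepos].
by congr (_ - _)%E; apply: eq_integral => w _; rewrite /= ?funeposE ?funenegE.
Qed.

Lemma Rintegrable_law (f : T' -> R) : measurable_fun setT f ->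
  Rintegrable gamma f <-> Rintegrable P (f \o Z).
Proof.
move=> mf; have mfZ : measurable_fun setT (f \o Z) by exact: measurableT_comp.
split=> /integrableP[_ h]; apply/integrableP; split; try exact/measurable_EFinP.
- rewrite (_ : (\int[P]_x _)%E = \int[gamma]_x `|(EFin \o f) x|)%E// integral_law//.
  by apply: measurableT_comp => //; exact/measurable_EFinP.
- rewrite integral_law//.
  by apply: measurableT_comp => //; exact/measurable_EFinP.
Qed.

Lemma Ex_law (f : T' -> R) : measurable_fun setT f -> Ex gamma f = Ex P (f \o Z).
Proof. by move=> mf; rewrite /Ex integral_law//; exact/measurable_EFinP. Qed.

End Laws.

Section Plans.
Context {R : realType} {m : nat}.
Variable nu : probability (vec2 R m) R.

Lemma in_Gamma_martingale (gamma : probability (vec2 R m * vec2 R m)%type R) :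
  in_Gamma nu gamma -> martingale gamma fst snd.
Proof.
move=> [I2 [_ H]].
have msq (g : vec2 R m * vec2 R m -> vec2 R m) : measurable_fun setT g ->
    measurable_fun setT (fun z => sqnorm2 (g z)).
  move=> /measurable_fun_pairP[m1 m2].
  by apply: measurable_funD; exact: (@measurable_dot _ _ _ _ (_ \o g) (_ \o g)).
have isum : Rintegrable gamma (fun z => sqnorm2 z.1 + sqnorm2 z.2).
  apply: Rintegrable_ge0_lty => //.
    by apply: measurable_funD; exact: msq.
  by move=> z; rewrite !addr_ge0 ?sqnorm_ge0.
have s1 : sqint2 gamma fst.
  apply/L2_2_sqint2; split=> //.
  suff i1 : Rintegrable gamma (fun z => sqnorm2 z.1) by rewrite ExE ?ltry.
  apply: Rintegrable_le isum => [|z]; first exact: msq.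
  by rewrite ger0_norm ?addr_ge0 ?sqnorm_ge0// lerDl addr_ge0 ?sqnorm_ge0.
have s2 : sqint2 gamma snd.
  apply/L2_2_sqint2; split=> //.
  suff i1 : Rintegrable gamma (fun z => sqnorm2 z.2) by rewrite ExE ?ltry.
  apply: Rintegrable_le isum => [|z]; first exact: msq.
  by rewrite ger0_norm ?addr_ge0 ?sqnorm_ge0// lerDr addr_ge0 ?sqnorm_ge0.
split=> // i.
- apply/same_cexp_integralP => //; [exact: sqint_int (s2.1 i)|exact: sqint_int (s1.1 i)|].
  by move=> B mB; have [] := H B mB i.
- apply/same_cexp_integralP => //; [exact: sqint_int (s2.2 i)|exact: sqint_int (s1.2 i)|].
  by move=> B mB; have [] := H B mB i.
Qed.

Lemma martingale_in_Gamma d (T : measurableType d) (P : probability T R)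
    (X Y : T -> vec2 R m) (gamma : probability (vec2 R m * vec2 R m)%type R) :
  martingale P X Y -> is_law_of P nu Y -> is_law_of P gamma (fun w => (X w, Y w)) ->
  in_Gamma nu gamma.
Proof.
move=> [sX sY c1 c2] lawY law.
have mX := sqint2_meas sX; have mY := sqint2_meas sY.
have mXY : measurable_fun setT (fun w => (X w, Y w)) by exact: measurable_fun_pair.
have tr i (g : vec2 R m * vec2 R m -> vec R m) : measurable_fun setT g ->
    measurable_fun setT (fun z => tnth (g z) i).
  by move=> /measurable_fun_tnthP; exact.
have msq (g : vec2 R m * vec2 R m -> vec2 R m) : measurable_fun setT g ->
    measurable_fun setT (fun z => sqnorm2 (g z)).
  move=> /measurable_fun_pairP[m1 m2].
  by apply: measurable_funD; exact: (@measurable_dot _ _ _ _ (_ \o g) (_ \o g)).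
split; [|split].
- rewrite (integral_law mXY law (f := fun z => (sqnorm2 z.1 + sqnorm2 z.2)%:E)); last first.
    by apply/measurable_EFinP/measurable_funD; exact: msq.
  rewrite ExE ?ltry//; apply: RintegrableD.
    by apply: RintegrableD; [exact: (Rintegrable_dot sX.1 sX.1)|exact: (Rintegrable_dot sX.2 sX.2)].
  by apply: RintegrableD; [exact: (Rintegrable_dot sY.1 sY.1)|exact: (Rintegrable_dot sY.2 sY.2)].
- move=> A mA; rewrite law//; first by rewrite lawY.
  by rewrite -[X in measurable X]setTI; exact: measurable_snd.
- have key (a b : vec2 R m * vec2 R m -> R) : measurable_fun setT a -> measurable_fun setT b ->
      Rintegrable P (fun w => a (X w, Y w)) -> Rintegrable P (fun w => b (X w, Y w)) ->
      same_cexp P X (fun w => a (X w, Y w)) (fun w => b (X w, Y w)) ->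
      forall B, measurable B -> (\int[gamma]_(z in fst @^-1` B) (a z)%:E =
        \int[gamma]_(z in fst @^-1` B) (b z)%:E)%E.
    move=> ma mb ia ib ab.
    apply/(same_cexp_integralP (W := fst)) => //; try by apply/(Rintegrable_law mXY law).
    move=> B mB.
    have m1B : measurable_fun setT (fun z : vec2 R m * vec2 R m => \1_B z.1 : R).
      by apply: measurableT_comp.
    rewrite (Ex_law mXY law); last exact: measurable_funM.
    rewrite (Ex_law mXY law); last exact: measurable_funM.
    exact: ab.
  move=> B mB i; split; apply: key => //.
  + exact: (tr _ (fst \o snd) (measurableT_comp _ _)).
  + exact: (tr _ (fst \o fst) (measurableT_comp _ _)).
  + exact: sqint_int (sY.1 i).
  + exact: sqint_int (sX.1 i).
  + exact: (tr _ (snd \o snd) (measurableT_comp _ _)).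
  + exact: (tr _ (snd \o fst) (measurableT_comp _ _)).
  + exact: sqint_int (sY.2 i).
  + exact: sqint_int (sX.2 i).
Qed.

End Plans.

(** * Randomization *)

Section Mixture.
Context {d : measure_display} {T : measurableType d} {R : realType}.
Variable P : probability T R.
Variable th : T -> R.
Hypothesis mth : measurable_fun setT th.
Hypothesis th01 : forall w, 0 <= th w <= 1.

Let U : probability (measurableTypeR R) R := uniform_prob (@ltr01 R).
(** The event [z.2 < th z.1] has conditional probability [th z.1], so a fraction [th] of the mass at
    each point can be moved even where [P] has atoms. *)
Definition randomized : probability (T * measurableTypeR R)%type R := (P \x U)%E.
Local Notation Q := randomized.

Definition sel (A : Type) (a b : T -> A) (z : T * measurableTypeR R) : A :=
  if z.2 < th z.1 then a z.1 else b z.1.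

Lemma measurable_sel dA (A : measurableType dA) (a b : T -> A) :
  measurable_fun setT a -> measurable_fun setT b ->
  measurable_fun setT (sel a b).
Proof.
move=> ma mb; apply: measurable_fun_ifT.
- by apply: measurable_fun_ltr => //; exact: measurableT_comp.
- exact: measurableT_comp.
- exact: measurableT_comp.
Qed.

Lemma uniform_prob_lt (t : R) : 0 <= t <= 1 ->
  U [set s | s < t] = t%:E.
Proof.
move=> /andP[t0 t1]; rewrite /U /= /uniform_prob integral_uniform_pdf.
rewrite (_ : _ `&` _ = `[0, t[%classic); last first.
  apply/seteqP; split=> s /=; rewrite !in_itv/=.
    by move=> [-> /andP[-> _]].
  by move=> /andP[-> st]; rewrite st (le_trans (ltW st) t1).
rewrite (eq_integral (fun=> 1%:E)); last first.
  move=> s; rewrite inE/= in_itv/= /uniform_pdf => /andP[-> st].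
  by rewrite (le_trans (ltW st) t1)/= subr0 invr1.
rewrite integral_cst//= lebesgue_measure_itv/= lte_fin mul1e.
by case: ltgtP t0 => // [_|<-] _; rewrite ?oppr0 ?adde0 ?sube0.
Qed.

Lemma uniform_sel (al be t : R) : 0 <= t <= 1 ->
  (\int[U]_s (if (s : R) < t then al else be)%:E = (t * al + (1 - t) * be)%:E)%E.
Proof.
move=> t01; pose A : set (measurableTypeR R) := [set s : R | s < t].
have mA : measurable A.
  by apply: measurable_set_lt => //; exact: measurable_cst.
have i1 : Rintegrable U (fun s => be + (al - be) * (\1_A s * 1)).
  by apply: RintegrableD; [exact: Rintegrable_cst|apply: RintegrableZ; apply: Rintegrable_indic => //; exact: Rintegrable_cst].
have -> : (fun s : R => (if s < t then al else be)%:E) =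
    (fun s => (be + (al - be) * (\1_A s * 1))%:E).
  apply/funext => s; congr EFin; rewrite indicE.
  have -> : (s \in A) = (s < t) by apply/idP/idP; rewrite inE.
  by case: ifP => _ /=; ring.
rewrite (ExE i1); congr EFin.
rewrite ExD; [|exact: Rintegrable_cst|apply: RintegrableZ; apply: Rintegrable_indic => //; exact: Rintegrable_cst].
rewrite Ex_cst ExZ; last by apply: Rintegrable_indic => //; exact: Rintegrable_cst.
suff -> : Ex U (fun s => \1_A s * 1) = t by lra.
under eq_Ex do rewrite mulr1.
by rewrite /Ex integral_indic// setIT; exact: (congr1 fine (uniform_prob_lt t01)).
Qed.

Lemma Rintegrable_sel (a b : T -> R) : Rintegrable P a -> Rintegrable P b -> Rintegrable Q (sel a b).
Proof.
move=> ia ib.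
have ms : measurable_fun setT (EFin \o sel a b).
  by apply/measurable_EFinP; apply: measurable_sel; [exact: Rintegrable_meas ia|exact: Rintegrable_meas ib].
apply: (@integrable12ltyP _ _ _ _ R P U _ ms).2.
have i1 : Rintegrable P (fun w => th w * `|a w| + (1 - th w) * `|b w|).
  apply: RintegrableD; apply: (@Rintegrable_bM _ _ _ _ 1).
  - exact: mth.
  - by move=> w; have /andP[? ?] := th01 w; rewrite ger0_norm.
  - exact: Rintegrable_abs.
  - by apply: measurable_funB => //; exact: measurable_cst.
  - by move=> w; have /andP[? ?] := th01 w; rewrite ger0_norm; lra.
  - exact: Rintegrable_abs.
rewrite [ltLHS](_ : _ = \int[P]_w (th w * `|a w| + (1 - th w) * `|b w|)%:E)%E.
  by rewrite ExE// ltry.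
apply: eq_integral => w _; rewrite -uniform_sel//.
by apply: eq_integral => s _; rewrite /sel /=; case: ifP.
Qed.

Lemma Ex_sel (a b : T -> R) : Rintegrable P a -> Rintegrable P b ->
  Ex Q (sel a b) = Ex P (fun w => th w * a w + (1 - th w) * b w).
Proof.
move=> ia ib; rewrite /Ex; congr fine.
have := @integral12_prod_meas1 _ _ _ _ R P U _ (Rintegrable_sel ia ib) => <-.
apply: eq_integral => w _; rewrite -uniform_sel//.
Qed.

Lemma law_fst d' (T' : measurableType d') (nu : probability T' R) (Y : T -> T') :
  measurable_fun setT Y -> is_law_of P nu Y -> is_law_of Q nu (Y \o fst).
Proof.
move=> mY lawY A mA; rewrite lawY//.
rewrite (_ : _ @^-1` A = (Y @^-1` A) `*` setT); last first.
  by apply/seteqP; split=> z //= -[].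
rewrite [RHS]/= product_measure1E//; last exact: (measurable_preimageW mY).
by rewrite -[LHS]mule1; congr (_ * _)%E; exact/esym/(probability_setT U).
Qed.

(** The moved and the remaining mass are balanced separately on each test set, so [zz] may also be a
    value of [k]. In use, [zc] and [kc] are one coordinate of [zz] and [k]. *)
Lemma mix_cexp d' (T' : measurableType d') (X : T -> T') dA (A : measurableType dA)
   (zz : A) (k : T' -> A) (h : T -> R) (zc : R) (kc : T' -> R) :
  measurable_fun setT X -> measurable_fun setT k ->
  Rintegrable P h -> Rintegrable P (kc \o X) ->
  Ex P (fun w => th w * h w) = zc * Ex P th ->
  (forall B, measurable B ->
    Ex P (fun w => \1_B (X w) * ((1 - th w) * h w)) =
    Ex P (fun w => \1_B (X w) * ((1 - th w) * kc (X w)))) ->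
  same_cexp Q (sel (fun=> zz) (k \o X)) (h \o fst) (sel (fun=> zc) (kc \o X)).
Proof.
move=> mX mk ih ik hz hB B mB.
have bt w : `|th w| <= 1 by have /andP[? ?] := th01 w; rewrite ger0_norm.
have bt1 w : `|1 - th w| <= 1 by have /andP[? ?] := th01 w; rewrite ger0_norm; lra.
have mt1 : measurable_fun setT (fun w => 1 - th w).
  by apply: measurable_funB => //; exact: measurable_cst.
have mkB : measurable (k @^-1` B) by exact: measurable_preimageW.
have iz : Rintegrable P (fun=> zc) by exact: Rintegrable_cst.
have e1 z : \1_B (sel (fun=> zz) (k \o X) z) * (h \o fst) z =
    sel (fun w => \1_B zz * h w) (fun w => \1_(k @^-1` B) (X w) * h w) z.
  by rewrite /sel /=; case: ifP.
have e2 z : \1_B (sel (fun=> zz) (k \o X) z) * sel (fun=> zc) (kc \o X) z =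
    sel (fun w => \1_B zz * zc) (fun w => \1_(k @^-1` B) (X w) * kc (X w)) z.
  by rewrite /sel /=; case: ifP.
rewrite (eq_Ex _ e1) (eq_Ex _ e2).
have ih' := Rintegrable_indicW mX mkB ih.
have ik' := Rintegrable_indicW mX mkB ik.
rewrite !Ex_sel//; [|exact: Rintegrable_cst|exact: RintegrableZ].
rewrite ExD; [|by apply: Rintegrable_bM bt _ => //; exact: RintegrableZ|exact: Rintegrable_bM bt1 _].
rewrite ExD; [|by apply: Rintegrable_bM bt _ => //; exact: Rintegrable_cst|exact: Rintegrable_bM bt1 _].
congr (_ + _).
- transitivity (\1_B zz * Ex P (fun w => th w * h w)).
    rewrite -ExZ; last exact: Rintegrable_bM bt _.
    by apply: eq_Ex => w; ring.
  rewrite hz mulrA -ExZ; last by apply: Rintegrable_bounded bt.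
  by apply: eq_Ex => w; ring.
- transitivity (Ex P (fun w => \1_(k @^-1` B) (X w) * ((1 - th w) * h w))).
    by apply: eq_Ex => w; ring.
  by rewrite hB//; apply: eq_Ex => w /=; ring.
Qed.

End Mixture.

(** * Second-order estimate for the corrected map *)

Section Estimate.
Variables (R : realType) (m : nat).
Implicit Types x y z : vec2 R m.

Lemma norm_dot_le (u v : vec R m) : `|dot u v| <= (sqnorm u + sqnorm v) / 2.
Proof.
have h1 := sqnorm_ge0 (lin 1 u 1 v); have h2 := sqnorm_ge0 (lin 1 u (-1) v).
rewrite ler_norml; move: h1 h2; rewrite /sqnorm !dotE (dotC v u).
by move: (dot u u) (dot v v) (dot u v) => a b c; lra.
Qed.

Lemma norm_qf_le z : `|qf z| <= sqnorm2 z.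
Proof.
apply: le_trans (norm_dot_le _ _) _; rewrite /sqnorm2.
have := sqnorm_ge0 z.1; have := sqnorm_ge0 z.2.
by move: (sqnorm z.1) (sqnorm z.2) => a b; lra.
Qed.

Lemma norm_Sform_le x y : `|Sform x y| <= sqnorm2 x + sqnorm2 y.
Proof.
apply: le_trans (ler_normD _ _) _; rewrite /sqnorm2.
have := norm_dot_le x.2 y.1; have := norm_dot_le x.1 y.2.
have := sqnorm_ge0 x.1; have := sqnorm_ge0 x.2.
have := sqnorm_ge0 y.1; have := sqnorm_ge0 y.2.
move: (sqnorm _) (sqnorm _) (sqnorm _) (sqnorm _) `|_| `|_| => a b c d e f.
by lra.
Qed.

(** For [y = E[rho Y | X = x]] and [q = eps * E[rho | X = x]] this is the mean of [Y] given [X = x]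
    under the weight [1 - eps * rho]. *)
Definition shrink (q eps : R) x y : vec2 R m :=
  (vscale (1 - q)^-1 (lin 1 x.1 (- eps) y.1),
   vscale (1 - q)^-1 (lin 1 x.2 (- eps) y.2)).

(** Write [v] for the right-hand side, [s] for the sum of the two [sqnorm2], and [N = qf x - eps *
    Sform y x + eps ^+ 2 * qf y]. Then [(1 - q) * v = N], hence [v = N + q * N + q ^+ 2 * v]. The
    constants [1], [2 * C] and [6 * C ^+ 2] account for [eps ^+ 2 * qf y], for [q * N] without
    [q * qf x], and for [q ^+ 2 * v]; the last uses [v >= - 6 * s], from [N >= - 3 * s] and
    [1 - q >= 1/2]. *)
Lemma shrink_estimate (C q eps : R) x y : 0 <= C -> 0 <= eps <= 1 ->
  0 <= q <= 1/2 -> q <= eps * C ->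
  qf x - eps * Sform y x + q * qf x -
    eps ^+ 2 * ((1 + 2 * C + 6 * C ^+ 2) * (sqnorm2 x + sqnorm2 y))
    <= (1 - q) * qf (shrink q eps x y).
Proof.
move=> C0 /andP[e0 e1] /andP[q0 q1] qC.
set v := (1 - q) * _; set s := sqnorm2 x + sqnorm2 y.
have vN : (1 - q) * v = qf x - eps * Sform y x + eps ^+ 2 * qf y.
  rewrite /v /qf /shrink /= dot_vscalel dot_vscaler /Sform !dotE (dotC y.2 x.1).
  by field; lra.
have hx := norm_qf_le x; have hy := norm_qf_le y; have hS := norm_Sform_le y x.
have sx0 : 0 <= sqnorm2 x by rewrite addr_ge0 ?sqnorm_ge0.
have sy0 : 0 <= sqnorm2 y by rewrite addr_ge0 ?sqnorm_ge0.
have {hx}[hx1 hx2] : - s <= qf x /\ qf x <= s.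
  by move: hx; rewrite ler_norml /s; lra.
have {hy}[hy1 hy2] : - s <= qf y /\ qf y <= s.
  by move: hy; rewrite ler_norml /s; lra.
have {hS}[hS1 hS2] : - s <= Sform y x /\ Sform y x <= s.
  by move: hS; rewrite ler_norml /s; lra.
have s0 : 0 <= s by rewrite /s; lra.
move: vN; clearbody v s; move: (qf x) (qf y) (Sform y x) hx1 hx2 hy1 hy2 hS1 hS2.
clear x y sx0 sy0 => a b S ha1 ha2 hb1 hb2 hS1 hS2 vN.
have e2 : 0 <= eps ^+ 2 <= 1 by rewrite sqr_ge0 /= expr_le1.
have v6 : - (6 * s) <= v.
  have : - (3 * s) <= (1 - q) * v.
    have : - s <= eps ^+ 2 * b by nra.
    by rewrite vN; nra.
  by move=> ?; nra.
have qq : q ^+ 2 <= eps ^+ 2 * C ^+ 2 by rewrite -exprMn lerXn2r ?nnegrE ?mulr_ge0.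
have -> : v = a - eps * S + q * a + (eps ^+ 2 * b + q * (eps ^+ 2 * b - eps * S) + q ^+ 2 * v).
  by have := congr1 (fun t => q * t) vN; rewrite /=; lra.
suff : - (eps ^+ 2 * ((1 + 2 * C + 6 * C ^+ 2) * s)) <=
   eps ^+ 2 * b + q * (eps ^+ 2 * b - eps * S) + q ^+ 2 * v by lra.
have h1 : - (eps ^+ 2 * s) <= eps ^+ 2 * b by rewrite -mulrN ler_wpM2l ?sqr_ge0.
have h2 : - (eps ^+ 2 * (2 * C * s)) <= q * (eps ^+ 2 * b - eps * S).
  have h : - (2 * (eps * s)) <= eps ^+ 2 * b - eps * S.
    have : eps ^+ 2 * s <= eps * s by rewrite ler_wpM2r// expr2 ler_piMl.
    have : eps * S <= eps * s by rewrite ler_wpM2l.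
    lra.
  apply: (@le_trans _ _ (q * - (2 * (eps * s)))); last by rewrite ler_wpM2l.
  have : q * (eps * s) <= eps * C * (eps * s) by rewrite ler_wpM2r// mulr_ge0.
  rewrite expr2; nra.
have h3 : - (eps ^+ 2 * (6 * C ^+ 2 * s)) <= q ^+ 2 * v.
  apply: (@le_trans _ _ (q ^+ 2 * - (6 * s))); last by rewrite ler_wpM2l ?sqr_ge0.
  have : q ^+ 2 * s <= eps ^+ 2 * C ^+ 2 * s by rewrite ler_wpM2r.
  lra.
lra.
Qed.

End Estimate.

(** * Conditional means after removal of the mass [eps * rho] *)

Section PerturbedConditions.
Context {d : measure_display} {T : measurableType d} {R : realType}.
Variable P : probability T R.

Lemma sqint_sel (th : T -> R) (a b : T -> R) : measurable_fun setT th ->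
  (forall w, 0 <= th w <= 1) -> sqint P a -> sqint P b ->
  sqint (randomized P) (sel th a b).
Proof.
move=> mth th01 sa sb; split.
  by apply: measurable_sel => //; [exact: sa.1|exact: sb.1].
rewrite (_ : (fun x => _) = sel th (fun w => a w ^+ 2) (fun w => b w ^+ 2)); last first.
  by apply/funext => z; rewrite /sel; case: ifP.
by apply: Rintegrable_sel => //; [exact: sa.2|exact: sb.2].
Qed.

Context {d' : measure_display} {T' : measurableType d'}.
Variable X : T -> T'.
Hypothesis mX : measurable_fun setT X.

(** Both sides integrate [xc - eps * mc] over [X^-1(B)]: the left one by the choice of [xc] and
    [mc], the right one because [rho] may be replaced by [rb] against the function [kc(X)] of
    [X]. *)
Lemma pert_cexp (C eps : R) (rho h : T -> R) (rb xc mc kc : T' -> R) :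
  measurable_fun setT rho -> (forall w, 0 <= rho w <= C) ->
  measurable_fun setT rb -> (forall x, 0 <= rb x <= C) ->
  same_cexp P X rho (rb \o X) -> Rintegrable P h -> same_cexp P X h (xc \o X) ->
  same_cexp P X (fun w => rho w * h w) (mc \o X) ->
  Rintegrable P (xc \o X) -> Rintegrable P (mc \o X) ->
  measurable_fun setT kc -> Rintegrable P (kc \o X) ->
  (forall x, (1 - eps * rb x) * kc x = xc x - eps * mc x) ->
  forall B, measurable B ->
    Ex P (fun w => \1_B (X w) * ((1 - eps * rho w) * h w)) =
    Ex P (fun w => \1_B (X w) * ((1 - eps * rho w) * kc (X w))).
Proof.
move=> mrho rhoC mrb rbC cr ih ch cm ix im mk ik kE B mB.
have brho w : `|rho w| <= C by have /andP[? ?] := rhoC w; rewrite ger0_norm.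
have brb w : `|rb (X w)| <= C by have /andP[? ?] := rbC (X w); rewrite ger0_norm.
have mrbX : measurable_fun setT (rb \o X) by exact: measurableT_comp.
have irho : Rintegrable P rho by exact: Rintegrable_bounded brho.
have irb : Rintegrable P (rb \o X) by apply: Rintegrable_bounded brb.
have irh : Rintegrable P (fun w => rho w * h w) by exact: Rintegrable_bM brho ih.
have irk : Rintegrable P (fun w => rho w * kc (X w)) by exact: Rintegrable_bM brho ik.
have irbk : Rintegrable P (fun w => rb (X w) * kc (X w)) by apply: Rintegrable_bM brb ik.
have I (f : T -> R) : Rintegrable P f -> Rintegrable P (fun w => \1_B (X w) * f w).
  exact: Rintegrable_indicW.
transitivity (Ex P (fun w => \1_B (X w) * h w) - eps * Ex P (fun w => \1_B (X w) * (rho w * h w))).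
  rewrite -ExZ; last exact: I.
  rewrite -ExB; [|exact: I|by apply: RintegrableZ; exact: I].
  by apply: eq_Ex => w; ring.
rewrite ch// cm// -ExZ; last exact: I.
rewrite -ExB; [|exact: I|by apply: RintegrableZ; exact: I].
symmetry.
transitivity (Ex P (fun w => \1_B (X w) * kc (X w)) -
    eps * Ex P (fun w => (\1_B (X w) * kc (X w)) * rho w)).
  rewrite -ExZ; last by apply: eq_intb (I _ irk) => w; ring.
  rewrite -ExB; [|exact: I|apply: RintegrableZ; by apply: eq_intb (I _ irk) => w; ring].
  by apply: eq_Ex => w; ring.
rewrite (tower mX irho irb cr (g := fun x => \1_B x * kc x)).
- rewrite -ExZ; last by apply: eq_intb (I _ irbk) => w /=; ring.
  rewrite -ExB; [|exact: I|apply: RintegrableZ; by apply: eq_intb (I _ irbk) => w /=; ring].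
  apply: eq_Ex => w /=; have := kE (X w) => e.
  transitivity (\1_B (X w) * ((1 - eps * rb (X w)) * kc (X w))); first by ring.
  by rewrite e; ring.
- by apply: measurable_funM.
- by apply: eq_intb (I _ irk) => w; ring.
- by apply: eq_intb (I _ irbk) => w /=; ring.
Qed.

End PerturbedConditions.

(** * Strong duality *)

Section StrongDuality.
Context {d : measure_display} {T : measurableType d} {R : realType}.
Variable P : probability T R.
Variable m : nat.
Variables (X Y : T -> vec2 R m).
Hypothesis mXY : martingale P X Y.
Variables (nu : probability (vec2 R m) R)
  (gamma : probability (vec2 R m * vec2 R m)%type R).
Hypothesis lawY : is_law_of P nu Y.
Hypothesis law : is_law_of P gamma (fun w => (X w, Y w)).
Hypothesis opt : optimal_plan nu gamma.

Let sX : sqint2 P X. Proof. by case: mXY. Qed.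
Let sY : sqint2 P Y. Proof. by case: mXY. Qed.
Let mX : measurable_fun setT X. Proof. exact: sqint2_meas sX. Qed.
Let mY : measurable_fun setT Y. Proof. exact: sqint2_meas sY. Qed.

Lemma law_exists d0 (T0 : measurableType d0) (Q : probability T0 R) d1
    (T1 : measurableType d1) (Z : T0 -> T1) : measurable_fun setT Z ->
  exists ga : probability T1 R, is_law_of Q ga Z.
Proof.
move=> mZ; pose Z' : {mfun T0 >-> T1} := mfun_Sub (mem_set mZ : Z \in mfun).
by exists (distribution Q Z').
Qed.

Lemma integral_plan d0 (T0 : measurableType d0) (Q : probability T0 R)
    (X' Y' : T0 -> vec2 R m) ga : martingale Q X' Y' ->
  is_law_of Q ga (fun w => (X' w, Y' w)) ->
  (\int[ga]_z (Sform z.1 z.2 / 2)%:E = (Ex Q (fun w => qf (X' w)))%:E)%E.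
Proof.
move=> mXY' law'; have [sX' sY' _ _] := mXY'.
rewrite -(martingale_value mXY') -ExE; last first.
  apply: eq_intb (RintegrableZ 2^-1 (Rintegrable_Sform sX' sY')) => w; exact: mulrC.
apply: (integral_law (f := fun z => (Sform z.1 z.2 / 2)%:E) _ law').
  by apply: measurable_fun_pair; [exact: sqint2_meas sX'|exact: sqint2_meas sY'].
apply/measurable_EFinP; apply: measurable_funM; last exact: measurable_cst.
exact: measurable_Sform.
Qed.

(** The point where optimality of the plan enters: competitors may live on any probability space, in
    particular on the randomized one. *)
Lemma plan_bound d0 (T0 : measurableType d0) (Q : probability T0 R)
    (X' Y' : T0 -> vec2 R m) : martingale Q X' Y' -> is_law_of Q nu Y' ->
  Ex Q (fun w => qf (X' w)) <= Ex P (fun w => qf (X w)).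
Proof.
move=> mXY' lawY'; have [sX' sY' _ _] := mXY'.
have [|ga lawga] := law_exists Q (Z := fun w => (X' w, Y' w)).
  by apply: measurable_fun_pair; [exact: sqint2_meas sX'|exact: sqint2_meas sY'].
rewrite -lee_fin -(integral_plan mXY' lawga) -(integral_plan mXY law).
by apply: opt.2; exact: martingale_in_Gamma lawY' lawga.
Qed.

Definition baryc (rho : T -> R) : vec2 R m :=
  ([tuple Ex P (fun w => rho w * tnth (Y w).1 i) | i < m],
   [tuple Ex P (fun w => rho w * tnth (Y w).2 i) | i < m]).

Let Rintegrable_affXY : Rintegrable P (fun w => aff (X w) (Y w)).
Proof.
apply: eq_intb (RintegrableB (Rintegrable_Sform sX sY) (Rintegrable_qf sX)) => w.
by rewrite /aff Sform_diag; lra.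
Qed.

(** The competitor [X'] equals [z] on the moved mass and [k(X)] on the rest. Its value [eps * qf z +
    E[(1 - eps * rb(X)) * qf (k(X))]] is at most [E[qf(X)]]; comparing terms of order [eps] leaves
    [qf z <= a1 - a2], and the tower property identifies [a1 - a2] with the right-hand side. *)
Lemma optimal_density (rho : T -> R) (C : R) : measurable_fun setT rho ->
  (forall w, 0 <= rho w <= C) -> Ex P rho = 1 ->
  qf (baryc rho) <= Ex P (fun w => rho w * aff (X w) (Y w)).
Proof.
move=> mrho rhoC rho1; set z := baryc rho.
have C0 : 0 <= C.
  rewrite leNgt; apply/negP => Cn.
  have : Ex P rho <= Ex P (fun=> 0).
    apply: Ex_le; [|exact: Rintegrable_cst|].
      by apply: (@Rintegrable_bounded _ _ _ _ C) => // w; have := rhoC w; lra.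
    by move=> w; have := rhoC w; lra.
  by rewrite rho1 Ex_cst; lra.
have brho w : `|rho w| <= C by have /andP[? ?] := rhoC w; rewrite ger0_norm.
have irho : Rintegrable P rho by exact: Rintegrable_bounded brho.
have [rb [mrb rbC crb]] : exists rb : vec2 R m -> R, [/\ measurable_fun setT rb,
    forall x, 0 <= rb x <= C & same_cexp P X rho (rb \o X)].
  have [g [mg ig cg]] := cond_exp_exists mX irho.
  exact: (same_cexp_clip mX C0 mrho rhoC mg ig cg).
have brb x : `|rb x| <= C by have /andP[? ?] := rbC x; rewrite ger0_norm.
have mrbX : measurable_fun setT (rb \o X) by exact: measurableT_comp.
have irb : Rintegrable P (rb \o X) by apply: (@Rintegrable_bounded _ _ _ _ C) => // w; exact: brb.
have srY1 : sqintv P (fun w => vscale (rho w) (Y w).1).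
  by move=> i; under eq_fun do rewrite tnth_vscale; exact: sqint_bM brho (sY.1 i).
have srY2 : sqintv P (fun w => vscale (rho w) (Y w).2).
  by move=> i; under eq_fun do rewrite tnth_vscale; exact: sqint_bM brho (sY.2 i).
have [m1 [mm1 sm1 cm1]] := cond_expv_exists mX srY1.
have [m2 [mm2 sm2 cm2]] := cond_expv_exists mX srY2.
pose mm x : vec2 R m := (m1 x, m2 x).
have smm : sqint2 P (mm \o X) by split.
pose K := 1 + 2 * C + 6 * C ^+ 2.
have K0 : 0 <= K by rewrite /K; nra.
pose a1 := Ex P (fun w => Sform (mm (X w)) (X w)).
pose a2 := Ex P (fun w => rb (X w) * qf (X w)).
pose M := Ex P (fun w => sqnorm2 (X w) + sqnorm2 (mm (X w))).
have iM : Rintegrable P (fun w => sqnorm2 (X w) + sqnorm2 (mm (X w))).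
  apply: RintegrableD; apply: RintegrableD.
  - exact: (Rintegrable_dot sX.1 sX.1).
  - exact: (Rintegrable_dot sX.2 sX.2).
  - exact: (Rintegrable_dot sm1 sm1).
  - exact: (Rintegrable_dot sm2 sm2).
have M0 : 0 <= M by apply: Ex_ge0 => w; rewrite !addr_ge0// sqnorm_ge0.
have iS : Rintegrable P (fun w => Sform (mm (X w)) (X w)) by exact: (Rintegrable_Sform smm sX).
have irq : Rintegrable P (fun w => rb (X w) * qf (X w)).
  by apply: (Rintegrable_bM mrbX _ (Rintegrable_qf sX)) => w; exact: brb.
have main eps : 0 < eps -> eps <= 1 / 2 -> eps * C <= 1 / 2 ->
    qf z <= a1 - a2 + eps * (K * M).
  move=> e0 e1 eC.
  pose th w := eps * rho w.
  have mth : measurable_fun setT th.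
    by apply: measurable_funM => //; exact: measurable_cst.
  have th01 w : 0 <= th w <= 1 by have := rhoC w; rewrite /th; nra.
  pose k x := shrink (eps * rb x) eps x (mm x).
  have qb x : 0 <= eps * rb x <= 1 / 2 by have := rbC x; nra.
  have q1 x : 1 - eps * rb x != 0 by have := qb x; lra.
  have mq : measurable_fun setT (fun x => (1 - eps * rb x)^-1).
    apply: measurable_funV => [|x]; last by have := qb x; lra.
    apply: measurable_funB; first exact: measurable_cst.
    by apply: measurable_funM => //; exact: measurable_cst.
  have bq x : `|(1 - eps * rb x)^-1| <= 2.
    have := qb x => ?; rewrite ger0_norm ?invr_ge0; last lra.
    rewrite -[leRHS]invrK lef_pV2 ?posrE; lra.
  have mqX : measurable_fun setT (fun w => (1 - eps * rb (X w))^-1).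
    exact: (measurableT_comp mq mX).
  have sk : sqint2 P (k \o X).
    split=> i; rewrite /comp /k /shrink /=; under eq_fun do rewrite tnth_vscale.
    - apply: (sqint_bM mqX (fun w => bq (X w))).
      exact: (sqintv_lin 1 (- eps) sX.1 sm1).
    - apply: (sqint_bM mqX (fun w => bq (X w))).
      exact: (sqintv_lin 1 (- eps) sX.2 sm2).
  have mk : measurable_fun setT k.
    apply/measurable_fun_pairP; split; apply/measurable_fun_tnthP => i;
      rewrite /comp /k /shrink /=; under eq_fun do rewrite tnth_vscale tnth_lin.
    - apply: measurable_funM => //; apply: measurable_funD; apply: measurable_funM => //;
        try exact: measurable_cst.
      + exact: (measurableT_comp (measurable_tnth i) measurable_fst).
      + exact: (measurableT_comp (measurable_tnth i) mm1).
    - apply: measurable_funM => //; apply: measurable_funD; apply: measurable_funM => //;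
        try exact: measurable_cst.
      + exact: (measurableT_comp (measurable_tnth i) measurable_snd).
      + exact: (measurableT_comp (measurable_tnth i) mm2).
  have [_ _ c1 c2] := mXY.
  have Eth : Ex P th = eps by rewrite /th ExZ// rho1 mulr1.
  pose X' := sel th (fun=> z) (k \o X).
  have martingale' : martingale (randomized P) X' (Y \o fst).
    have selD (pr : vec2 R m -> R) : (fun z0 => pr (X' z0)) =
        sel th (fun=> pr z) (fun w => pr (k (X w))).
      by apply/funext => z0; rewrite /X' /sel; case: ifP.
    have selC (h : T -> R) : (fun z0 : T * measurableTypeR R => h z0.1) = sel th h h.
      by apply/funext => z0; rewrite /sel; case: ifP.
    have Ez (h : T -> R) : Rintegrable P h -> Ex P (fun w => th w * h w) =
        Ex P (fun w => rho w * h w) * Ex P th.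
      move=> ih; rewrite Eth mulrC -ExZ; last exact: Rintegrable_bM brho ih.
      by apply: eq_Ex => w; rewrite /th mulrA.
    split.
    - split=> i.
      + rewrite /comp (selD (fun y => tnth y.1 i)).
        by apply: sqint_sel => //; [exact: sqint_cst|exact: sk.1].
      + rewrite /comp (selD (fun y => tnth y.2 i)).
        by apply: sqint_sel => //; [exact: sqint_cst|exact: sk.2].
    - split=> i.
      + rewrite /comp (selC (fun w => tnth (Y w).1 i)).
        by apply: sqint_sel => //; exact: sY.1.
      + rewrite /comp (selC (fun w => tnth (Y w).2 i)).
        by apply: sqint_sel => //; exact: sY.2.
    - move=> i; rewrite /comp (selD (fun y => tnth y.1 i)).
      have ih := sqint_int (sY.1 i).
      apply: (mix_cexp mth th01 z (h := fun w => tnth (Y w).1 i)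
         (kc := fun x => tnth (k x).1 i) mX mk ih (sqint_int (sk.1 i))).
        by rewrite Ez// tnth_mktuple.
      apply: (@pert_cexp _ _ _ P _ _ X mX C eps rho (fun w => tnth (Y w).1 i) rb
        (fun x => tnth x.1 i) (fun x => tnth (m1 x) i) (fun x => tnth (k x).1 i)
        mrho rhoC mrb rbC crb ih (c1 i)).
      + move=> B mB; rewrite -(cm1 i B mB); apply: eq_Ex => w.
        by rewrite tnth_vscale.
      + exact: sqint_int (sX.1 i).
      + exact: sqint_int (sm1 i).
      + exact: (measurableT_comp (measurable_tnth i) (measurableT_comp measurable_fst mk)).
      + exact: sqint_int (sk.1 i).
      + by move=> x; rewrite /k /= tnth_vscale tnth_lin mulrA mulfV// mul1r; ring.
    - move=> i; rewrite /comp (selD (fun y => tnth y.2 i)).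
      have ih := sqint_int (sY.2 i).
      apply: (mix_cexp mth th01 z (h := fun w => tnth (Y w).2 i)
         (kc := fun x => tnth (k x).2 i) mX mk ih (sqint_int (sk.2 i))).
        by rewrite Ez// tnth_mktuple.
      apply: (@pert_cexp _ _ _ P _ _ X mX C eps rho (fun w => tnth (Y w).2 i) rb
        (fun x => tnth x.2 i) (fun x => tnth (m2 x) i) (fun x => tnth (k x).2 i)
        mrho rhoC mrb rbC crb ih (c2 i)).
      + move=> B mB; rewrite -(cm2 i B mB); apply: eq_Ex => w.
        by rewrite tnth_vscale.
      + exact: sqint_int (sX.2 i).
      + exact: sqint_int (sm2 i).
      + exact: (measurableT_comp (measurable_tnth i) (measurableT_comp measurable_snd mk)).
      + exact: sqint_int (sk.2 i).
      + by move=> x; rewrite /k /= tnth_vscale tnth_lin mulrA mulfV// mul1r; ring.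
  have := plan_bound martingale' (law_fst mY lawY).
  have iqk : Rintegrable P (fun w => qf (k (X w))) by exact: (Rintegrable_qf sk).
  have -> : (fun w => qf (X' w)) = sel th (fun=> qf z) (fun w => qf (k (X w))).
    by apply/funext => z0; rewrite /X' /sel; case: ifP.
  rewrite Ex_sel//; last exact: Rintegrable_cst.
  have bth w : `|th w| <= 1 by have /andP[? ?] := th01 w; rewrite ger0_norm.
  have bth1 w : `|1 - th w| <= 1 by have /andP[? ?] := th01 w; rewrite ger0_norm; lra.
  have mth1 : measurable_fun setT (fun w => 1 - th w).
    by apply: measurable_funB => //; exact: measurable_cst.
  rewrite ExD; [|by apply: Rintegrable_bM bth _ => //; exact: Rintegrable_cst|exact: Rintegrable_bM bth1 iqk].
  have -> : Ex P (fun w => th w * qf z) = eps * qf z.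
    by under eq_Ex do rewrite mulrC; rewrite ExZ ?Eth 1?mulrC//; exact: Rintegrable_bounded bth.
  have irk : Rintegrable P (fun w => qf (k (X w)) * rho w).
    by apply: eq_intb (Rintegrable_bM mrho brho iqk) => w; rewrite mulrC.
  have irbk : Rintegrable P (fun w => qf (k (X w)) * rb (X w)).
    by apply: eq_intb (Rintegrable_bM mrbX (fun w => brb (X w)) iqk) => w; rewrite mulrC.
  (* Since [qf (k (X))] is a function of [X], [rho] can be replaced by [rb(X)]; the pointwise
     estimate then applies. *)
  have -> : Ex P (fun w => (1 - th w) * qf (k (X w))) =
      Ex P (fun w => (1 - eps * rb (X w)) * qf (k (X w))).
    transitivity (Ex P (fun w => qf (k (X w))) - eps * Ex P (fun w => qf (k (X w)) * rho w)).
      rewrite -ExZ// -ExB//; last exact: RintegrableZ.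
      by apply: eq_Ex => w; rewrite /th; ring.
    rewrite (tower mX irho irb crb (g := fun x => qf (k x)))//.
      rewrite -ExZ// -ExB//; last exact: RintegrableZ.
      by apply: eq_Ex => w /=; ring.
    exact: measurableT_comp (@measurable_qf R m) mk.
  have low : Ex P (fun w => qf (X w)) - eps * a1 + eps * a2 - eps ^+ 2 * (K * M) <=
      Ex P (fun w => (1 - eps * rb (X w)) * qf (k (X w))).
    have j1 := Rintegrable_qf sX; have j2 := RintegrableZ eps iS; have j3 := RintegrableZ eps irq.
    have j4 := RintegrableZ (eps ^+ 2) (RintegrableZ K iM).
    rewrite /a1 /a2 /M -!ExZ//; last exact: RintegrableZ.
    rewrite -ExB// -ExD//; last exact: RintegrableB.
    rewrite -ExB//; last by apply: RintegrableD => //; exact: RintegrableB.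
    apply: Ex_le.
    - by apply: RintegrableB => //; apply: RintegrableD => //; exact: RintegrableB.
    - apply: eq_intb (RintegrableB iqk (RintegrableZ eps irbk)) => w; ring.
    - move=> w; rewrite [X in _ + X - _ <= _]mulrA.
      apply: shrink_estimate => //; [lra|].
      by have := rbC (X w); nra.
  move=> h; have {h low} : eps * qf z <= eps * (a1 - a2 + eps * (K * M)) by nra.
  by rewrite ler_pM2l.
have fin : qf z <= a1 - a2.
  apply/ler_addgt0Pr => del del0.
  (* For [eps = del / L] the first summand of [L] gives [eps * (K * M) <= del], and the second gives
     [eps * (2 * (C + 1)) <= 1], hence both smallness conditions of [main]. *)
  pose L := K * M + 2 * (C + 1) * (1 + del).
  have KM0 : 0 <= K * M by rewrite mulr_ge0.
  have L0 : 0 < L by rewrite /L; nra.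
  have ed : del / L * L = del by rewrite divfK//; lra.
  have e0 : 0 < del / L by rewrite divr_gt0.
  have := main (del / L) e0.
  move: ed e0; move: (del / L) => e ed e0 main'.
  have eL : e * (K * M) <= del by rewrite -ed ler_wpM2l ?(ltW e0)// /L; nra.
  have eC : e * (2 * (C + 1) * (1 + del)) <= del by rewrite -[leRHS]ed ler_wpM2l ?(ltW e0)// /L; lra.
  have eC' : e * (2 * (C + 1)) <= 1 by nra.
  have eC0 : 0 <= e * C by rewrite mulr_ge0// ltW.
  have := main' ltac:(lra) ltac:(lra); lra.
apply: le_trans fin _.
have irS : Rintegrable P (fun w => rho w * Sform (X w) (Y w)).
  exact: Rintegrable_bM brho (Rintegrable_Sform sX sY).
have irqX : Rintegrable P (fun w => rho w * qf (X w)) by exact: Rintegrable_bM brho (Rintegrable_qf sX).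
have -> : Ex P (fun w => rho w * aff (X w) (Y w)) =
    Ex P (fun w => rho w * Sform (X w) (Y w)) - Ex P (fun w => rho w * qf (X w)).
  rewrite -ExB//; apply: eq_Ex => w.
  by rewrite /aff Sform_diag; lra.
have -> : a2 = Ex P (fun w => rho w * qf (X w)).
  rewrite /a2; symmetry; under eq_Ex do rewrite mulrC.
  under [RHS]eq_Ex do rewrite mulrC.
  apply: (tower mX irho irb crb (@measurable_qf R m)).
  - by apply: eq_intb irqX => w; rewrite mulrC.
  - by apply: eq_intb irq => w; rewrite mulrC.
suff -> : a1 = Ex P (fun w => rho w * Sform (X w) (Y w)) by [].
have t1 := tower_dot mX measurable_fst sX.1 srY2 sm2 cm2.
have t2 := tower_dot mX measurable_snd sX.2 srY1 sm1 cm1.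
have j1 := Rintegrable_dot sX.1 srY2; have j2 := Rintegrable_dot sX.2 srY1.
have j3 := Rintegrable_dot sX.1 sm2; have j4 := Rintegrable_dot sX.2 sm1.
transitivity (Ex P (fun w => dot (X w).1 (m2 (X w))) + Ex P (fun w => dot (X w).2 (m1 (X w)))).
  rewrite -ExD//; apply: eq_Ex => w; rewrite /Sform /mm /=.
  by rewrite (dotC (m2 _)) (dotC (m1 _)).
rewrite -t1 -t2 -ExD//; apply: eq_Ex => w /=.
by rewrite !dot_vscaler /Sform; ring.
Qed.

Lemma Ex_aff_density (rho : T -> R) (C : R) g : measurable_fun setT rho ->
  (forall w, `|rho w| <= C) -> Ex P rho = 1 ->
  Ex P (fun w => rho w * aff g (Y w)) = aff g (baryc rho).
Proof.
move=> mrho rhoC rho1.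
have irho : Rintegrable P rho by exact: Rintegrable_bounded rhoC.
have i1 i : Rintegrable P (fun w => rho w * tnth (Y w).1 i).
  exact: Rintegrable_bM rhoC (sqint_int (sY.1 i)).
have i2 i : Rintegrable P (fun w => rho w * tnth (Y w).2 i).
  exact: Rintegrable_bM rhoC (sqint_int (sY.2 i)).
transitivity (Ex P (fun w => \sum_(i < m) tnth g.2 i * (rho w * tnth (Y w).1 i) +
    \sum_(i < m) tnth g.1 i * (rho w * tnth (Y w).2 i) - qf g * rho w)).
  apply: eq_Ex => w; rewrite affE; move: (qf g) => qg.
  rewrite /dot mulrBr mulrDr !mulr_sumr; congr (_ + _ - _); last exact: mulrC.
  - by apply: eq_bigr => i _; ring.
  - by apply: eq_bigr => i _; ring.
rewrite ExB; [|by apply: RintegrableD; apply: Rintegrable_sum => i; exact: RintegrableZ|exact: RintegrableZ].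
rewrite ExD; [|by apply: Rintegrable_sum => i; exact: RintegrableZ..].
rewrite !Ex_sum; try by move=> i; exact: RintegrableZ.
rewrite ExZ// rho1 mulr1 affE /dot; congr (_ + _ - _); apply: eq_bigr => i _.
- by rewrite ExZ// tnth_mktuple.
- by rewrite ExZ// tnth_mktuple.
Qed.

(* The points (E[rho Y], E[rho l_X(Y)]), for bounded densities rho, form a convex
   set lying above the quadratic form; a maximal monotone set below it is the
   dual optimizer. *)
Lemma strong_duality : exists2 G, maximal_S_monotone G &
  (\int[P]_w psi G (Y w) <= (Ex P (fun w => qf (X w)))%:E)%E.
Proof.
pose dens (rho : T -> R) := [/\ measurable_fun setT rho,
  exists C, forall w, 0 <= rho w <= C & Ex P rho = 1].
have dens_abs rho : dens rho -> exists C, forall w, `|rho w| <= C.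
  move=> [_ [C HC] _]; exists C => w; have /andP[? ?] := HC w.
  by rewrite ger0_norm.
pose pt rho := (baryc rho, Ex P (fun w => rho w * aff (X w) (Y w))).
pose A := [set pt rho | rho in dens].
have [|||G mG GA] := @maximal_below R m A.
- move=> t _ _ /andP[t0 t1] [rho dr <-] [rho' dr' <-].
  have [mr [C HC] r1] := dr; have [mr' [C' HC'] r1'] := dr'.
  have [D HD] := dens_abs _ dr; have [D' HD'] := dens_abs _ dr'.
  pose r w := (1 - t) * rho w + t * rho' w.
  have lin_r (h : T -> R) : Rintegrable P h -> Ex P (fun w => r w * h w) =
      (1 - t) * Ex P (fun w => rho w * h w) + t * Ex P (fun w => rho' w * h w).
    move=> ih; have i1 := Rintegrable_bM mr HD ih; have i2 := Rintegrable_bM mr' HD' ih.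
    rewrite -!ExZ// -ExD; [|exact: RintegrableZ..].
    by apply: eq_Ex => w; rewrite /r; ring.
  exists r.
    split.
    + by apply: measurable_funD; apply: measurable_funM => //; exact: measurable_cst.
    + exists (C + C') => w; have := HC w; have := HC' w; rewrite /r; nra.
    + have := lin_r (fun=> 1) (Rintegrable_cst P 1).
      under eq_Ex do rewrite mulr1; under [X in _ = _ * X + _]eq_Ex do rewrite mulr1.
      by under [X in _ = _ + _ * X]eq_Ex do rewrite mulr1; rewrite r1 r1'; lra.
  rewrite /pt /comb /baryc /=; congr ((_, _), _).
  + apply: eq_from_tnth => i; rewrite tnth_lin !tnth_mktuple.
    exact: lin_r (sqint_int (sY.1 i)).
  + apply: eq_from_tnth => i; rewrite tnth_lin !tnth_mktuple.
    exact: lin_r (sqint_int (sY.2 i)).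
  + exact: lin_r.
- exists (pt (fun=> 1)); exists (fun=> 1) => //; split.
  + exact: measurable_cst.
  + by exists 1 => w; rewrite ler01 lexx.
  + exact: Ex_cst.
- move=> _ [rho [mr [C HC] r1] <-]; exact: optimal_density HC r1.
exists G => //.
have affG g : G g -> {ae P, forall w, aff g (Y w) <= aff (X w) (Y w)}.
  (* If [B] had positive probability [p], its normalized indicator would be a density, and [GA] at
     that density would contradict, in the mean, the strict inequality defining [B]. *)
  move=> Gg; pose B := [set w | aff (X w) (Y w) < aff g (Y w)].
  have iag := Rintegrable_aff g sY.
  have mB : measurable B by apply: measurable_set_lt; exact: (@Rintegrable_meas _ _ _ P).
  have i1 : Rintegrable P (fun w => \1_B w * 1) by apply: Rintegrable_indic => //; exact: Rintegrable_cst.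
  have [PB0|PB0] := leP (Ex P (fun w => \1_B w * 1)) 0.
    have : {ae P, forall w, \1_B w * 1 = 0 :> R}.
      apply: Ex_eq0_ae i1 _ PB0 => w.
      by rewrite indicE mulr1; case: (_ \in _).
    apply: filterS => w; rewrite indicE mulr1; case: (boolP (w \in B)).
      by move=> _ /eqP; rewrite oner_eq0.
    by move=> /negP; rewrite inE /B /= => /negP; rewrite -leNgt.
  set p := Ex P _ in PB0; pose rho w := p^-1 * (\1_B w * 1).
  have rb w : 0 <= rho w <= p^-1.
    rewrite /rho indicE; have : 0 < p^-1 by rewrite invr_gt0.
    by case: (_ \in _) => /=; rewrite ?mulr1 ?mul0r ?mulr0; lra.
  have rb' w : `|rho w| <= p^-1 by have /andP[? ?] := rb w; rewrite ger0_norm.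
  have mrho : measurable_fun setT rho by exact: (Rintegrable_meas (RintegrableZ p^-1 i1)).
  have rho1 : Ex P rho = 1 by rewrite /rho ExZ// mulVf// gt_eqF.
  have dr : dens rho by split=> //; exists p^-1.
  have := GA g (pt rho) Gg (ex_intro2 _ _ rho dr erefl).
  rewrite /= -(Ex_aff_density g mrho rb' rho1) => h.
  have j1 := Rintegrable_indic mB iag; have j2 := Rintegrable_indic mB Rintegrable_affXY.
  have : {ae P, forall w, \1_B w * aff g (Y w) - \1_B w * aff (X w) (Y w) = 0}.
    apply: Ex_eq0_ae; first exact: RintegrableB.
      move=> w; rewrite indicE; case: (boolP (w \in B)); rewrite ?mul1r ?mul0r ?subrr//.
      by rewrite inE /B /=; lra.
    rewrite ExB// subr_le0 -(@ler_pM2l _ p^-1) ?invr_gt0// -!ExZ//.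
    move: h; congr (_ <= _); apply: eq_Ex => w; rewrite /rho; ring.
  apply: filterS => w; rewrite indicE; case: (boolP (w \in B)).
    by rewrite inE /B /= !mul1r; lra.
  by move=> /negP; rewrite inE /B /= => /negP; rewrite -leNgt.
have [e [Ge He]] := aff_dense (maximal_nonempty mG).
have psi_ub : {ae P, forall w, (psi G (Y w) <= (aff (X w) (Y w))%:E)%E}.
  have := ae_foralln (fun k => affG _ (Ge k)); apply: filterS => w hw.
  apply/psi_le => g Gg; rewrite leNgt; apply/negP => lt.
  by have [k] := He g _ _ Gg lt; rewrite ltNge hw.
apply: le_trans (psi_integral_le mG sY Rintegrable_affXY psi_ub) _.
rewrite lee_fin le_eqVlt; apply/orP; left; apply/eqP; symmetry.
rewrite (@eq_Ex _ _ _ P (fun w => aff (X w) (Y w)) (fun w => Sform (X w) (Y w) - qf (X w))); last first.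
  by move=> w; rewrite /aff Sform_diag; lra.
rewrite ExB; [|exact: Rintegrable_Sform|exact: Rintegrable_qf].
have := martingale_value mXY; under eq_Ex do rewrite mulrC.
by rewrite ExZ; [lra|exact: Rintegrable_Sform].
Qed.

End StrongDuality.

(** * Borel selections *)

Section Selection.
Variables (R : realType) (m : nat).
Implicit Types (G : set (vec2 R m)).

Lemma S_monotone_dot G x y : S_monotone G -> G x -> G y ->
  0 <= dot (vsub x.1 y.1) (vsub x.2 y.2).
Proof.
move=> mG Gx Gy; have := mG _ _ Gx Gy; rewrite Sform_diag /qf /vsub2 /=.
by lra.
Qed.

(** [L] bounds the square of the Lipschitz constant. The set where [F > c] is a countable union of
    balls, centred at dense points with [F (e k) > c], on which the bound keeps [F] above [c]. *)
Lemma lipschitz_measurable (F : vec R m -> R) (L : R) : 0 <= L ->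
  (forall r r', (F r - F r') ^+ 2 <= L * sqnorm (vsub r r')) ->
  measurable_fun setT F.
Proof.
move=> L0 FL.
have [e [_ He]] := @dense_sequence R (vec R m) 'I_m setT (fun r i => tnth r i)
  (ex_intro _ [tuple 0 | i < m] I).
apply: (measurability _ (RGenOInfty.measurableE R)) => _ [_ [c ->] <-].
rewrite setTI.
rewrite (_ : _ @^-1` _ = \bigcup_k (if c < F (e k) then
   [set r | L * sqnorm (vsub r (e k)) < (F (e k) - c) ^+ 2] else set0)); last first.
  apply/seteqP; split=> [r /=|r [k _]].
    rewrite in_itv /= andbT => cr.
    pose del := F r - c; have del0 : 0 < del by rewrite subr_gt0.
    pose N := L * m%:R; have N0 : 0 <= N by rewrite mulr_ge0.
    (* A dense point with coordinates [eta]-close to [r] has [L * sqnorm <= (del / 4) ^+ 2], so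
       [F (e k) - c] is at least [3/4 * del] and its ball contains [r]. *)
    pose eta := del / (4 * (N + 1)).
    have eta0 : 0 < eta by rewrite divr_gt0//; lra.
    have etaE : eta * (4 * (N + 1)) = del by rewrite divfK//; lra.
    have [k Hk] := He r eta I eta0.
    have sq : sqnorm (vsub r (e k)) <= m%:R * eta ^+ 2.
      rewrite /sqnorm /dot -[m in m%:R]card_ord -sum1_card natr_sum mulr_suml.
      apply: ler_sum => i _; rewrite mul1r tnth_mktuple -expr2.
      rewrite -[leLHS]real_normK ?num_real// lerXn2r ?nnegrE ?(ltW eta0)//.
      by rewrite distrC; exact: ltW (Hk i).
    have sq2 : L * sqnorm (vsub r (e k)) <= N * eta ^+ 2.
      by rewrite /N -mulrA ler_wpM2l.
    have sq3 : N * eta ^+ 2 <= (del / 4) ^+ 2.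
      rewrite -etaE.
      have -> : eta * (4 * (N + 1)) / 4 = eta * (N + 1) by field.
      suff h (x n : R) : 0 <= n -> n * x ^+ 2 <= (x * (n + 1)) ^+ 2 by exact: h.
      by move=> n0; rewrite exprMn; have := sqr_ge0 x; nra.
    have d4 : `|F r - F (e k)| <= del / 4.
      rewrite -(@ler_pXn2r _ 2)// ?nnegrE ?normr_ge0//; last lra.
      by rewrite real_normK ?num_real//; apply: le_trans (FL _ _) _; lra.
    exists k => //; have cek : c < F (e k).
      by move: d4; rewrite ler_norml /del; lra.
    rewrite cek /=; apply: le_lt_trans sq2 _; apply: le_lt_trans sq3 _.
    rewrite ltrXn2r//= ?nnegrE; try by rewrite /del; lra.
    by move: d4; rewrite ler_norml /del; lra.
  case: ifP => // cek /= h; rewrite in_itv /= andbT.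
  rewrite ltNge; apply/negP => Fc.
  have := le_lt_trans (FL r (e k)) h.
  by move: (F r) (F (e k)) Fc cek => a b; nra.
apply: bigcup_measurable => k _; case: ifP => // _.
apply: measurable_set_lt; last exact: measurable_cst.
apply: measurable_funM; first exact: measurable_cst.
have mv : measurable_fun setT (fun r : vec R m => vsub r (e k)).
  apply/measurable_fun_tnthP => i; rewrite /comp.
  under eq_fun do rewrite tnth_mktuple.
  by apply: measurable_funB; [exact: measurable_tnth|exact: measurable_cst].
exact: measurable_dot.
Qed.

(* The Yosida approximations of a maximal monotone set with full domain are
   Lipschitz and converge pointwise (to the selection of minimal norm). *)
Lemma borel_selection G : maximal_S_monotone G -> proj1_set G = setT ->
  exists2 f : vec R m -> vec R m, measurable_fun setT f & graph_of f `<=` G.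
Proof.
move=> mG pG; have [monG _] := mG.
pose lam n : R := n.+1%:R^-1.
have lam0 n : 0 < lam n by rewrite invr_gt0.
have lam_nd n p : (n < p)%N -> lam p < lam n.
  by move=> np; rewrite ltf_pV2 ?posrE// ltr_nat.
have /choice[s Hs] : forall a : nat * vec R m, exists s,
    G (lin 1 a.2 (- lam a.1) s, s).
  by move=> a; exact: resolvent_exists.
(* With [h = r - r'] and [k] the difference of the two [s], monotonicity reads
   [<h - lam k, k> >= 0], and [|h|^2 = |h - lam k|^2 + 2 lam <h - lam k, k> + lam^2 |k|^2]. *)
have lip n r r' : lam n ^+ 2 * sqnorm (vsub (s (n, r)) (s (n, r'))) <= sqnorm (vsub r r').
  have := S_monotone_dot monG (Hs (n, r)) (Hs (n, r')); rewrite /=.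
  move: (s (n, r)) (s (n, r')) (lam n) (lam0 n) => a b l l0.
  have := sqnorm_ge0 (lin 1 (vsub r r') (- l) (vsub a b)).
  rewrite /sqnorm !dotE (dotC r' r) (dotC a r) (dotC a r') (dotC b r) (dotC b r') (dotC b a).
  move: (dot r r) (dot r r') (dot r' r') (dot r a) (dot r b) (dot r' a) (dot r' b) (dot a a) (dot a b) (dot b b).
  by move=> *; nra.
have ms n : measurable_fun setT (fun r => s (n, r)).
  apply/measurable_fun_tnthP => i; rewrite /comp.
  apply: (@lipschitz_measurable _ (lam n ^- 2)); first by rewrite invr_ge0 sqr_ge0.
  move=> r r'; rewrite mulrC ler_pdivlMr ?exprn_gt0// mulrC.
  apply: le_trans (lip n r r'); rewrite ler_wpM2l ?sqr_ge0//.
  by have := sqr_tnth_le_sqnorm (vsub (s (n, r)) (s (n, r'))) i; rewrite tnth_mktuple.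
have lim r : exists x, vcvg (fun n => s (n, r)) x.
  have [v Grv] : proj1_set G r by rewrite pG.
  (* Monotonicity against [(r, v)] gives [<s, s - v> <= 0]. *)
  have bd n : sqnorm (s (n, r)) <= sqnorm v.
    have := S_monotone_dot monG (Hs (n, r)) Grv; rewrite /=.
    have := sqnorm_ge0 (vsub (s (n, r)) v).
    move: (s (n, r)) (lam n) (lam0 n) => a l l0.
    rewrite /sqnorm !dotE (dotC v a).
    move: (dot r r) (dot r a) (dot r v) (dot a a) (dot a v) (dot v v) => x1 x2 x3 x4 x5 x6.
    by nra.
  (* For [n < p], monotonicity and [lam p < lam n] give [<s_n, s_n - s_p> <= 0]. The norms therefore
     increase, and their convergence makes the vectors Cauchy. *)
  have step n p : (n <= p)%N -> sqnorm (vsub (s (n, r)) (s (p, r))) <=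
      sqnorm (s (p, r)) - sqnorm (s (n, r)).
    rewrite leq_eqVlt => /orP[/eqP->|np].
      by rewrite /sqnorm !dotE; lra.
    have := S_monotone_dot monG (Hs (n, r)) (Hs (p, r)); rewrite /=.
    have := sqnorm_ge0 (vsub (s (n, r)) (s (p, r))).
    have := lam_nd n p np; have := lam0 p.
    move: (s (n, r)) (s (p, r)) (lam n) (lam p) => a b l l'.
    rewrite /sqnorm !dotE (dotC b a).
    move: (dot r r) (dot r a) (dot r b) (dot a a) (dot a b) (dot b b) => x1 x2 x3 x4 x5 x6.
    move=> l0 ll h1 h2.
    have : (l - l') * (x4 - x5) <= 0 by nra.
    by rewrite pmulr_rle0; lra.
  have nd : nondecreasing_seq (fun n => sqnorm (s (n, r))).
    by move=> n p np; have := sqnorm_ge0 (vsub (s (n, r)) (s (p, r))); have := step n p np; lra.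
  have cv : cvgn (fun n => sqnorm (s (n, r))).
    by apply: nondecreasing_is_cvgn nd _; exists (sqnorm v) => _ [n _ <-].
  apply: vec_cauchy => eps eps0.
  have [N _ HN] : \forall n \near \oo, `|limn (fun n => sqnorm (s (n, r))) - sqnorm (s (n, r))| < eps / 2.
    by move/cvgrPdist_lt : cv; apply; lra.
  have key n p : (N <= n)%N -> (n <= p)%N -> sqnorm (vsub (s (n, r)) (s (p, r))) < eps.
    move=> Nn np; have := HN n Nn; have := HN p (leq_trans Nn np); rewrite /= !ltr_norml.
    by have := step n p np; lra.
  exists N => n p Nn Np; have [np|/ltnW pn] := leqP n p; first exact: key.
  have := key p n Np pn; congr (_ < _).
  by rewrite /sqnorm !dotE; ring.
have /choice[f Hf] := lim.
exists f.
  apply/measurable_fun_tnthP => i.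
  apply: (@measurable_fun_cvg _ _ _ _ (fun n r => tnth (s (n, r)) i)).
    by move=> n; move/measurable_fun_tnthP : (ms n); exact.
  by move=> r _; exact: Hf.
move=> [r v] vf; have {vf} -> : v = f r by [].
apply: maximal_mem mG _ => g Gg.
have cl : vcvg (fun n => lin 1 r (- lam n) (s (n, r))) r.
  have -> : r = lin 1 r (- 0) (f r).
    by apply: eq_from_tnth => i; rewrite tnth_lin; ring.
  have := @lin_cvg R m 1 (- 0) (fun=> r) (fun n => s (n, r)) r (f r) (fun=> 1) (fun n => - lam n).
  have -> : lin 1 r (- 0) (f r) = r.
    by apply: eq_from_tnth => i; rewrite tnth_lin; ring.
  apply; [exact: vcvg_cst|exact: Hf|exact: cvg_cst|].
  by apply: cvgN; exact: cvg_harmonic.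
have c1 : (fun n => aff g (lin 1 r (- lam n) (s (n, r)), s (n, r))) @ \oo --> aff g (r, f r).
  under eq_fun do rewrite affE /=.
  rewrite affE /=; apply: cvgB; last exact: cvg_cst.
  by apply: cvgD; apply: dot_cvg => //; try exact: vcvg_cst; exact: Hf.
have c2 : (fun n => qf (lin 1 r (- lam n) (s (n, r)), s (n, r))) @ \oo --> qf (r, f r).
  by apply: dot_cvg => //; exact: Hf.
apply: (ler_cvg_to c1 c2); apply: nearW => n.
by apply: (iffLR (S_monotoneP _) monG) => //; exact: (Hs (n, r)).
Qed.

End Selection.

(** * Equilibria *)

Section Equilibrium.
Context {d : measure_display} {T : measurableType d} {R : realType}.
Variable P : probability T R.
Variable m : nat.
Implicit Types (X Y : T -> vec2 R m).

Lemma Rintegrable_ae (f g : T -> R) : measurable_fun setT g ->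
  {ae P, forall w, f w = g w} -> Rintegrable P f -> Rintegrable P g.
Proof.
move=> mg fg ifT; have mf := Rintegrable_meas ifT; have /integrableP[_ h] := ifT.
apply/integrableP; split; first exact/measurable_EFinP.
suff -> : (\int[P]_x `|(EFin \o g) x| = \int[P]_x `|(EFin \o f) x|)%E by [].
apply: ae_eq_integral => //; try by apply: measurableT_comp => //; exact/measurable_EFinP.
by move: fg; apply: filterS => w /= -> _.
Qed.

Lemma measurable_indicW d1 (T1 : measurableType d1) (W : T -> T1) (B : set T1) :
  measurable_fun setT W -> measurable B ->
  measurable_fun setT (fun w => \1_B (W w) : R).
Proof.
move=> mW mB; have mWB := measurable_preimageW mW mB.
by rewrite (_ : (fun w => _) = \1_(W @^-1` B)).
Qed.

Lemma same_cexp_comp d1 (T1 : measurableType d1) d2 (T2 : measurableType d2)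
    (W : T -> T1) (phi : T1 -> T2) (h k : T -> R) : measurable_fun setT phi ->
  same_cexp P W h k -> same_cexp P (phi \o W) h k.
Proof.
move=> mphi hk B mB; have mB' : measurable (phi @^-1` B) by exact: measurable_preimageW.
exact: (hk _ mB').
Qed.

Lemma meas_wrt_comp d0 (T0 : measurableType d0) d1 (T1 : measurableType d1)
    d2 (T2 : measurableType d2) (Y : T -> T0) (W : T -> T1) (phi : T1 -> T2) :
  measurable_fun setT phi -> meas_wrt Y W -> meas_wrt Y (phi \o W).
Proof.
move=> mphi YW B mB; have mB' : measurable (phi @^-1` B) by exact: measurable_preimageW.
exact: YW _ mB'.
Qed.

Lemma meas_wrt_id d0 (T0 : measurableType d0) (Y : T -> T0) : meas_wrt Y Y.
Proof. by move=> B mB; exists B. Qed.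

Lemma Xset_martingale X Y : sqint2 P Y -> Xset P Y X -> martingale P X Y.
Proof.
move=> sY [/L2_2_sqint2 sX [_ [[_ c1] [_ c2]]]].
have mX := sqint2_meas sX; split=> // i.
- apply/same_cexp_integralP => //; [exact: sqint_int (sY.1 i)|exact: sqint_int (sX.1 i)|].
  by move=> B mB; exact: c1.
- apply/same_cexp_integralP => //; [exact: sqint_int (sY.2 i)|exact: sqint_int (sX.2 i)|].
  by move=> B mB; exact: c2.
Qed.

Lemma martingale_Xset X Y : martingale P X Y -> meas_wrt Y X -> Xset P Y X.
Proof.
move=> [sX sY c1 c2] YX; have mX := sqint2_meas sX.
split; first exact/L2_2_sqint2.
split=> //; split; split.
- exact: (meas_wrt_comp measurable_fst (@meas_wrt_id _ _ X)).
- move=> B mB i.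
  exact: (iffRL (same_cexp_integralP mX (sqint_int (sY.1 i)) (sqint_int (sX.1 i))) (c1 i) B mB).
- exact: (meas_wrt_comp measurable_snd (@meas_wrt_id _ _ X)).
- move=> B mB i.
  exact: (iffRL (same_cexp_integralP mX (sqint_int (sY.2 i)) (sqint_int (sX.2 i))) (c2 i) B mB).
Qed.

Lemma integral_Sform X Y : martingale P X Y ->
  (\int[P]_w (Sform (X w) (Y w) / 2)%:E = (Ex P (fun w => qf (X w)))%:E)%E.
Proof.
move=> mXY; have [sX sY _ _] := mXY; rewrite -(martingale_value mXY) ExE//.
by apply: eq_intb (RintegrableZ 2^-1 (Rintegrable_Sform sX sY)) => w; exact: mulrC.
Qed.

(** The bound on the integral of [psi] is the zero duality gap. It is the common certificate for
    this lemma and for [dual_optimal_of_value] and [optimal_plan_of_value]. *)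
Lemma optimal_map_of_value G X Y : maximal_S_monotone G -> martingale P X Y ->
  meas_wrt Y X -> (\int[P]_w psi G (Y w) <= (Ex P (fun w => qf (X w)))%:E)%E ->
  optimal_map P Y X.
Proof.
move=> mG mXY YX le; have [_ sY _ _] := mXY; split; first exact: martingale_Xset.
move=> X' /(Xset_martingale sY) mX'Y; rewrite !integral_Sform//.
apply: le_trans le; have := weak_duality mG mX'Y; by rewrite martingale_value.
Qed.

Section Law.
Variable nu : probability (vec2 R m) R.
Variable Y : T -> vec2 R m.
Hypothesis sY : sqint2 P Y.
Hypothesis lawY : is_law_of P nu Y.

Lemma integral_psi_law G : maximal_S_monotone G ->
  (\int[nu]_y psi G y = \int[P]_w psi G (Y w))%E.
Proof.
move=> mG; apply: (integral_law (sqint2_meas sY) lawY).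
by apply: measurable_psi; exact: maximal_nonempty.
Qed.

Lemma dual_optimal_of_value G X : maximal_S_monotone G -> martingale P X Y ->
  (\int[P]_w psi G (Y w) <= (Ex P (fun w => qf (X w)))%:E)%E -> dual_optimal nu G.
Proof.
move=> mG mXY le; split=> // G' mG'; rewrite !integral_psi_law//.
apply: le_trans le _; have := weak_duality mG' mXY; by rewrite martingale_value.
Qed.

Lemma optimal_plan_of_value G X gamma : maximal_S_monotone G -> martingale P X Y ->
  is_law_of P gamma (fun w => (X w, Y w)) ->
  (\int[P]_w psi G (Y w) <= (Ex P (fun w => qf (X w)))%:E)%E ->
  optimal_plan nu gamma.
Proof.
move=> mG mXY law le; split; first exact: martingale_in_Gamma mXY lawY law.
(* The competing plan serves as its own probability space, with the two projections as martingale
   pair. *)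
move=> gamma' Gg'; have m' := in_Gamma_martingale Gg'.
rewrite (integral_plan mXY law); apply: le_trans le.
have [s1 s2 _ _] := m'.
have := weak_duality mG m'; rewrite -ExE; last first.
  by apply: eq_intb (RintegrableZ 2^-1 (Rintegrable_Sform s1 s2)) => w; exact: mulrC.
move=> /le_trans; apply; rewrite -integral_psi_law//.
have [_ [lawsnd _]] := Gg'.
rewrite le_eqVlt; apply/orP; left; apply/eqP; symmetry.
apply: integral_law => //.
- by move=> A mA; rewrite -lawsnd.
- by apply: measurable_psi; exact: maximal_nonempty.
Qed.

End Law.

Variables (U V : T -> vec R m).
Hypothesis sU : sqintv P U.
Hypothesis sV : sqintv P V.
Local Notation Y := (fun w => (U w, V w)).

Let sY : sqint2 P Y. Proof. by split. Qed.

Lemma equilibrium_value Rv f : equilibrium P U V Rv f -> monotone_fun f ->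
  exists X G, [/\ martingale P X Y, meas_wrt Y X, maximal_S_monotone G, graph_of f `<=` G &
    (\int[P]_w psi G (Y w) <= (Ex P (fun w => qf (X w)))%:E)%E].
Proof.
move=> [/L2_sqintv sR [YR [mf [[_ cV] argmax]]]] monf.
have mR := sqintv_meas sR.
have mfi i : measurable_fun setT (fun r => tnth (f r) i).
  by move/measurable_fun_tnthP : mf; exact.
have ifR i : Rintegrable P ((fun r => tnth (f r) i) \o Rv).
  apply: (same_cexp_integrable mR (mfi i) (sqint_int (sV i))).
  exact: (cV setT measurableT i).
have cVf i : same_cexp P Rv (fun w => tnth (V w) i) ((fun r => tnth (f r) i) \o Rv).
  apply/(same_cexp_integralP mR (sqint_int (sV i)) (ifR i)) => B mB; exact: cV.
have sfR : sqintv P (f \o Rv).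
  by move=> i; exact: (same_cexp_sqint mR (mfi i) (sV i) (ifR i) (cVf i)).
(* [R] itself need not be [E[U|R]]; the first component of [X] is this conditional expectation, so
   that [X], [Y] is a martingale pair. *)
have [g [mg sg cg]] := cond_expv_exists mR sU.
pose k r := (g r, f r).
have mk : measurable_fun setT k by exact: measurable_fun_pair.
have [G mG fG] : exists2 G, maximal_S_monotone G & graph_of f `<=` G.
  apply: maximal_extension => x y /= fx fy; rewrite Sform_diag /qf /vsub2 /=.
  by rewrite fx fy mulr_ge0.
exists (k \o Rv), G; split=> //.
- split=> //.
  + move=> i; exact: (same_cexp_comp mk (cg i)).
  + move=> i; exact: (same_cexp_comp mk (cVf i)).
- exact: (meas_wrt_comp mk YR).
pose b w := aff (Rv w, f (Rv w)) (U w, V w).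
have j1 := Rintegrable_dot sfR sU; have j2 := Rintegrable_dot sR sV; have j3 := Rintegrable_dot sR sfR.
have ib : Rintegrable P b.
  by apply: eq_intb (RintegrableB (RintegrableD j1 j2) j3) => w; rewrite /b affE.
have ub : {ae P, forall w, (psi G (U w, V w) <= (b w)%:E)%E}.
  move: argmax; apply: filterS => w hw; apply/psi_le.
  apply: (aff_le_graph mG.1 fG) => r; have := hw r.
  rewrite /b !affE /qf /= !dotE (dotC (f r) (U w)) (dotC (f (Rv w)) (U w)); lra.
apply: le_trans (psi_integral_le mG sY ib ub) _; rewrite lee_fin.
(* In expectation [<R, V>] cancels [<R, f(R)>], and [<f(R), U>] becomes [<f(R), g(R)>], which is
   [qf(X)]. *)
have -> : Ex P b = Ex P (fun w => dot (f (Rv w)) (U w)) + Ex P (fun w => dot (Rv w) (V w))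
    - Ex P (fun w => dot (Rv w) (f (Rv w))).
  by rewrite -ExD// -ExB//; [apply: eq_Ex => w; rewrite /b affE|exact: RintegrableD].
have -> : Ex P (fun w => dot (Rv w) (V w)) = Ex P (fun w => dot (Rv w) (f (Rv w))).
  exact: (tower_dot mR (g := id) _ sR sV sfR cVf).
have -> : Ex P (fun w => dot (f (Rv w)) (U w)) = Ex P (fun w => dot (f (Rv w)) (g (Rv w))).
  exact: (tower_dot mR mf sfR sU sg cg).
rewrite addrK le_eqVlt; apply/orP; left; apply/eqP.
by apply: eq_Ex => w; rewrite /qf /= dotC.
Qed.

Lemma maximal_measurable (G : set (vec2 R m)) : maximal_S_monotone G -> measurable G.
Proof.
move=> mG; have [e [Ge He]] := aff_dense (maximal_nonempty mG).
rewrite (_ : G = \bigcap_k [set x | aff (e k) x <= qf x]).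
  by apply: bigcap_measurable => [|k _]; [exists 0%N|apply: measurable_set_le; [exact: measurable_aff|exact: measurable_qf]].
apply/seteqP; split=> [x Gx k _|x h] /=.
  by apply: (iffLR (S_monotoneP _) mG.1).
apply: maximal_mem mG _ => g Gg; rewrite leNgt; apply/negP => lt.
have [k] := He g _ _ Gg lt; rewrite ltNge => /negP; apply; exact: (h k I).
Qed.

(* The fibres of a maximal monotone set are closed and convex, so they contain
   the conditional expectation of their elements. *)
Lemma cond_exp_in_fibre (G : set (vec2 R m)) X (f0 : vec R m -> vec R m) :
  maximal_S_monotone G -> sqint2 P X -> {ae P, forall w, G (X w)} ->
  measurable_fun setT f0 -> sqintv P (f0 \o (fst \o X)) ->
  same_cexpv P (fst \o X) (snd \o X) (f0 \o (fst \o X)) ->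
  {ae P, forall w, G ((X w).1, f0 (X w).1)}.
Proof.
move=> mG sX GX mf0 sf0 c0; have [sX1 sX2] := sX.
have mR : measurable_fun setT (fst \o X) by exact: sqintv_meas sX1.
have [e [Ge He]] := aff_dense (maximal_nonempty mG).
suff key k : {ae P, forall w, aff (e k) ((X w).1, f0 (X w).1) <= qf ((X w).1, f0 (X w).1)}.
  have := ae_foralln key; apply: filterS => w hw.
  apply: maximal_mem mG _ => g Gg; rewrite leNgt; apply/negP => lt.
  have [k] := He g _ _ Gg lt; rewrite ltNge => /negP; apply; exact: hw.
pose D (r v : vec R m) := dot (vsub r (e k).1) (vsub v (e k).2).
have DE r v : D r v = qf (r, v) - aff (e k) (r, v).
  by rewrite /D affE /qf /= !dotE (dotC r (e k).2); ring.
pose B := [set r | D r (f0 r) < 0].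
have msub (h : vec R m -> vec R m) (c : vec R m) : measurable_fun setT h ->
    measurable_fun setT (fun r => vsub (h r) c).
  move=> /measurable_fun_tnthP mh; apply/measurable_fun_tnthP => i; rewrite /comp.
  under eq_fun do rewrite tnth_mktuple.
  by apply: measurable_funB; [exact: mh|exact: measurable_cst].
have mB : measurable B.
  apply: measurable_set_lt; last exact: measurable_cst.
  by apply: measurable_dot; exact: (msub id) || exact: msub.
(* [D] is affine in its second argument, so testing with [g] gives [X.2] and [f0(X.1)] the same mean
   of [D] over [B]. It is nonnegative for [X] in [G], whereas [D] is negative at [f0] on [B]; so
   [X.1] avoids [B] almost surely. *)
pose g r : vec R m := vscale (\1_B r) (vsub r (e k).1).
have mg : measurable_fun setT g.
  apply/measurable_fun_tnthP => i; rewrite /comp /g.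
  under eq_fun do rewrite tnth_vscale.
  apply: measurable_funM => //.
  by have /measurable_fun_tnthP := msub id (e k).1 (@measurable_id _ _ _); exact.
have sg : sqintv P (g \o (fst \o X)).
  move=> i; rewrite /comp /g; under eq_fun do rewrite tnth_vscale tnth_mktuple.
  apply: (@sqint_bM _ _ _ _ 1).
  - exact: (measurable_indicW mR mB).
  - by move=> w; rewrite indicE; case: (_ \in _); rewrite ?normr1 ?normr0.
  - exact: sqintB (sX1 i) (sqint_cst _ _).
have t := tower_dot mR mg sg sX2 sf0 c0.
have s2 := sqintv_cst P (e k).2.
have i1 := Rintegrable_dot sg sX2; have i2 := Rintegrable_dot sg sf0; have i3 := Rintegrable_dot sg s2.
have gE w (v : vec R m) : \1_B (X w).1 * D (X w).1 v =
    dot (g (X w).1) v - dot (g (X w).1) (e k).2.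
  by rewrite /g !dot_vscalel /D vsubE (vsubE v) !dot_linr; ring.
have h0 : 0 <= Ex P (fun w => \1_B (X w).1 * D (X w).1 (f0 (X w).1)).
  under eq_Ex do rewrite gE.
  rewrite ExB// -t -ExB//; rewrite -[leLHS](Ex_cst P 0).
  apply: Ex_le_ae; [exact: Rintegrable_cst|exact: RintegrableB|].
  move: GX; apply: filterS => w Gw; rewrite -gE mulr_ge0//.
  rewrite DE subr_ge0 -surjective_pairing; exact: (iffLR (S_monotoneP _) mG.1).
have ineg : Rintegrable P (fun w => - 1 * (\1_B (X w).1 * D (X w).1 (f0 (X w).1))).
  by apply: RintegrableZ; under eq_fun do rewrite gE; exact: RintegrableB.
have : {ae P, forall w, - 1 * (\1_B (X w).1 * D (X w).1 (f0 (X w).1)) = 0}.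
  apply: Ex_eq0_ae ineg _ _ => [w|].
    rewrite indicE; case: (boolP ((X w).1 \in B)); rewrite ?mul0r ?mulr0//.
    by rewrite inE /B /= mul1r; lra.
  rewrite ExZ; first by lra.
  by under eq_fun do rewrite gE; exact: RintegrableB.
apply: filterS => w; rewrite indicE; case: (boolP ((X w).1 \in B)).
  by rewrite inE /B /= mul1r; lra.
move=> /negP; rewrite inE /B /= => /negP; rewrite -leNgt DE; lra.
Qed.

Lemma equilibrium_of_value (G : set (vec2 R m)) X : maximal_S_monotone G -> proj1_set G = setT ->
  martingale P X Y -> meas_wrt Y X ->
  (\int[P]_w psi G (Y w) <= (Ex P (fun w => qf (X w)))%:E)%E ->
  exists Rv f, [/\ equilibrium P U V Rv f, graph_of f `<=` G &
    optimal_map P Y (fun w => (Rv w, f (Rv w)))].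
Proof.
move=> mG pG mXY YX le; have [sX _ c1 c2] := mXY; have [sX1 sX2] := sX.
have [GX _] : {ae P, forall w, G (X w)} /\ {ae P, forall w, psi G (U w, V w) = (aff (X w) (U w, V w))%:E}.
  by apply: (weak_duality_eq mG mXY); rewrite martingale_value.
pose Rv := fst \o X.
have mR : measurable_fun setT Rv by exact: sqintv_meas sX1.
have [f0 [mf0 sf0 cf0]] := cond_expv_exists mR sX2.
have Gf0 := cond_exp_in_fibre mG sX GX mf0 sf0 cf0.
have [f1 mf1 f1G] := borel_selection mG pG.
pose B := [set r | G (r, f0 r)].
have mB : measurable B.
  have mk0 : measurable_fun setT (fun r => (r, f0 r)) by exact: measurable_fun_pair.
  exact: (measurable_preimageW mk0 (maximal_measurable mG)).
pose f r := if r \in B then f0 r else f1 r.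
have mf : measurable_fun setT f.
  apply: measurable_fun_ifT => //; apply: (measurable_fun_bool true).
  rewrite setTI (_ : _ @^-1` _ = B)//.
  by apply/seteqP; split=> r /=; [move/set_mem|move/mem_set].
have fG : graph_of f `<=` G.
  move=> [r v] vf; have {vf} -> : v = f r by [].
  rewrite /f; case: (boolP (r \in B)); first by rewrite inE.
  by move=> _; exact: f1G.
have ff0 : {ae P, forall w, f0 (Rv w) = f (Rv w)}.
  by move: Gf0; apply: filterS => w h; rewrite /f mem_set.
have mfi i : measurable_fun setT (fun w => tnth (f (Rv w)) i).
  by have /measurable_fun_tnthP := measurableT_comp mf mR; exact.
have sf : sqintv P (f \o Rv).
  move=> i; split; first exact: mfi.
  apply: (Rintegrable_ae _ _ (sf0 i).2); first exact: measurable_funX (mfi i).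
  by move: ff0; apply: filterS => w /= ->.
have cf : same_cexpv P Rv (snd \o X) (f \o Rv).
  move=> i C mC; rewrite (cf0 i C mC); apply: eq_Ex_ae.
  - by apply: measurable_funM; [exact: (measurable_indicW mR mC)|exact: (sf0 i).1].
  - by apply: measurable_funM; [exact: (measurable_indicW mR mC)|exact: mfi].
  - by move: ff0; apply: filterS => w /= ->.
have cV i : same_cexp P Rv (fun w => tnth (V w) i) (fun w => tnth (f (Rv w)) i).
  by move=> C mC; rewrite -(cf i C mC); exact: (same_cexp_comp measurable_fst (c2 i) mC).
pose k r := (r, f r).
have mk : measurable_fun setT k by exact: measurable_fun_pair.
have martingale' : martingale P (k \o Rv) Y.
  split=> //.
  - by move=> i; apply: (same_cexp_comp mk); exact: (same_cexp_comp measurable_fst (c1 i)).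
  - by move=> i; apply: (same_cexp_comp mk); exact: cV.
have YR : meas_wrt Y Rv by exact: (meas_wrt_comp measurable_fst YX).
have YX' : meas_wrt Y (k \o Rv) by exact: (meas_wrt_comp mk YR).
(* Replacing [X.2] by its conditional expectation given [X.1] preserves [E[qf(X)]], so the gap stays
   zero and the equality case applies to [(R, f(R))] itself. *)
have le' : (\int[P]_w psi G (U w, V w) <= (Ex P (fun w => qf ((k \o Rv) w)))%:E)%E.
  apply: le_trans le _; rewrite lee_fin le_eqVlt; apply/orP; left; apply/eqP.
  exact: (tower_dot mR (g := id) _ sX1 sX2 sf cf).
exists Rv, f; split=> //; last exact: (optimal_map_of_value mG martingale' YX' le').
have [_ psiE] : {ae P, forall w, G ((k \o Rv) w)} /\
    {ae P, forall w, psi G (U w, V w) = (aff ((k \o Rv) w) (U w, V w))%:E}.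
  by apply: (weak_duality_eq mG martingale'); rewrite martingale_value.
split; first exact/L2_sqintv.
split=> //; split=> //; split.
  split; first exact: (meas_wrt_comp mf (@meas_wrt_id _ _ Rv)).
  move=> C mC i.
  exact: (iffRL (same_cexp_integralP mR (sqint_int (sV i)) (sqint_int (sf i))) (cV i) C mC).
move: psiE; apply: filterS => w e r.
have : ((aff (r, f r) (U w, V w))%:E <= psi G (U w, V w))%E by apply/aff_le_psi/fG.
rewrite e lee_fin !affE /qf /= !dotE (dotC (f r) (U w)) (dotC (f (Rv w)) (U w)); lra.
Qed.

End Equilibrium.

Theorem theorem8 (R : realType) (d : measure_display) (Omega : measurableType d)
  (P : probability Omega R) (m : nat) (U V : Omega -> vec R m)
  (nu : probability (vec2 R m) R) :
  L2 P U -> L2 P V ->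
  is_law_of P nu (fun w => (U w, V w)) ->
  ((exists (Rv : Omega -> vec R m) (f : vec R m -> vec R m),
       equilibrium P U V Rv f /\ monotone_fun f) <->
   (exists (X : Omega -> vec2 R m) (G : set (vec2 R m)),
       optimal_map P (fun w => (U w, V w)) X /\ dual_optimal nu G /\
       (exists gamma : probability (vec2 R m * vec2 R m)%type R,
          is_law_of P gamma (fun w => (X w, (U w, V w))) /\ optimal_plan nu gamma) /\
       proj1_set G = setT)) /\
  ((exists (Rv : Omega -> vec R m) (f : vec R m -> vec R m),
       equilibrium P U V Rv f /\ monotone_fun f) ->
   forall G : set (vec2 R m), dual_optimal nu G -> proj1_set G = setT ->
   exists (Rv : Omega -> vec R m) (f : vec R m -> vec R m),
     equilibrium P U V Rv f /\ graph_of f `<=` G /\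
     optimal_map P (fun w => (U w, V w)) (fun w => (Rv w, f (Rv w)))).
Proof.
move=> /L2_sqintv sU /L2_sqintv sV lawY; set Y := fun w => (U w, V w) in lawY *.
have sY : sqint2 P Y by split.
(* Dual optimality of [G] enters by comparison with a set [G'] of zero gap: [G] then has zero gap
   for the same [X]. *)
have construct (G : set (vec2 R m)) X : dual_optimal nu G -> proj1_set G = setT ->
    martingale P X Y -> meas_wrt Y X ->
    (exists2 G', maximal_S_monotone G' &
      (\int[P]_w psi G' (Y w) <= (Ex P (fun w => qf (X w)))%:E)%E) ->
    exists Rv f, [/\ equilibrium P U V Rv f, graph_of f `<=` G &
      optimal_map P Y (fun w => (Rv w, f (Rv w)))].
  move=> [mG optG] pG mXY YX [G' mG' le].
  apply: (equilibrium_of_value sU sV mG pG mXY YX).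
  rewrite -(integral_psi_law sY lawY mG).
  by apply: le_trans (optG _ mG') _; rewrite (integral_psi_law sY lawY mG').
split; first split.
- move=> [Rv [f [eq monf]]].
  have [X [G [mXY YX mG fG le]]] := equilibrium_value sU sV eq monf.
  have [sX _ _ _] := mXY.
  have [|gamma law] := law_exists P (Z := fun w => (X w, Y w)).
    by apply: measurable_fun_pair; [exact: sqint2_meas sX|exact: sqint2_meas sY].
  exists X, G; split; first exact: optimal_map_of_value mG mXY YX le.
  split; first exact: (dual_optimal_of_value sY lawY mG mXY le).
  split.
    by exists gamma; split=> //; exact: (optimal_plan_of_value sY lawY mG mXY law le).
  by apply/seteqP; split=> // r _; exists (f r); exact: fG.
- move=> [X [G [[XY _] [dG [[gamma [law opt]] pG]]]]].
  have mXY := Xset_martingale sY XY; have [_ [YX _]] := XY.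
  have [Rv [f [eq fG _]]] := construct G X dG pG mXY YX (strong_duality mXY lawY law opt).
  exists Rv, f; split=> // u r.
  have := S_monotone_dot dG.1.1 (fG (u, f u) erefl) (fG (r, f r) erefl).
  by [].
- move=> [Rv [f [eq monf]]] G dG pG.
  have [X [G' [mXY YX mG' _ le]]] := equilibrium_value sU sV eq monf.
  have [Rv' [f' [eq' fG' opt']]] := construct G X dG pG mXY YX (ex_intro2 _ _ G' mG' le).
  by exists Rv', f'.
Qed.
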